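(* Let $d\ge3$, $p=d/2$, $\omega>s_+$, $s_\gamma=\omega-s_+$, and $\tilde h=\tilde h_o+V$ on $L^2(\mathbb{T}_\tau,\ell^2(\mathcal V))$. Let $\delta_\pm=\sup_{(t,x)\in\mathbb{T}_\tau\times\mathcal V}(V_x(t))_\pm<\tfrac{s_\gamma}{2}$. (i) Let $\sup_{t}|V_x(t)|\le u_x$ and $\sup_t (V_x(t))_-\le (v_-)_x$ for all $x\in\mathcal V$, where $u^2,v_-\in\ell^{p}(\mathcal V)$. Let $q_-=cu^2+v_-\ge0$, where $c>\frac{4\omega}{s_\gamma^2}$ and $\delta_+c\le\sqrt3$, and let $$\omega\ge s_++\delta_-+\sqrt{\delta_-(2s_++\delta_-)}.$$ Then the number of eigenvalues of $\tilde h$ in $\gamma_-=[-\delta_-,0)$ satisfies $$\tilde n(\gamma_-)\le n_-(q_-)\le C_{ks}^-\|q_-\|_p^p,$$ where $n_-(q_-)$ is the number of eigenvalues, with multiplicity, of $h_o-q_-$ in $(-\infty,0)$. (ii) Let the top $s_+$ of the spectrum of $h_o$ be regular (or let the graph $\mathcal G$ be bipartite). Let $\sup_{t}|V_x(t)|\le u_x$ and $\sup_t (V_x(t))_+\le (v_+)_x$ for all $x\in\mathcal V$, where $u^2,v_+\in\ell^{p}(\mathcal V)$. Let $q_+=cu^2+v_+$, where $c>\frac{4\omega}{s_\gamma^2}$ and $\delta_-c\le\sqrt3$, and let $$\omega\ge s_++\delta_++\sqrt{\delta_+(2s_++\delta_+)}.$$ Then the number of eigenvalues of $\tilde h$ in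 $\gamma_+=(-s_\gamma,\delta_+-s_\gamma]$ satisfies $$\tilde n(\gamma_+)\le n_+(q_+)\le C_{ks}^+\|q_+\|_p^p,$$ where $n_+(q_+)$ is the number of eigenvalues, with multiplicity, of $h_o+q_+$ in $(s_+,\infty)$. (iii) Let the conditions of (i) and (ii) hold. Then the number of eigenvalues of $\tilde h$ in the main gap $\gamma=(-s_\gamma,0)$ satisfies $$\tilde n(\gamma)\le C_{ks}^+\|q_+\|_p^p+C_{ks}^-\|q_-\|_p^p.$$
   Context: Graph: $\Gamma\subset\mathbb{R}^d$ is a lattice of rank $d$ with basis $a_1,\dots,a_d$; $\mathcal G=(\mathcal V,\mathcal E)$ is a connected infinite locally finite graph embedded in $\mathbb{R}^d$ (loops and multiple edges allowed), with $\mathcal G+a=\mathcal G$ for all $a\in\Gamma$ and with $\mathcal G/\Gamma$ finite. $\mathcal G$ is bipartite if $\mathcal V$ is a disjoint union of two sets such that every edge joins vertices of different sets. Unperturbed operator: $h_o=\Delta+\mathfrak p$ on $\ell^2(\mathcal V)$, where $(\Delta f)_x=\sum_{y\sim x}(f_x-f_y)$ (sum over all edges starting at $x$) and $\mathfrak p:\mathcal V\to\mathbb{R}$ is a $\Gamma$-periodic potential, acting by multiplication. $s_+=\max\sigma(h_o)$ and it is assumed that $\sigma(h_o)\subset[0,s_+]$. Regularity: for $\vartheta\in\mathbb{T}^d=\mathbb{R}^d/(2\pi\mathbb{Z})^d$ let $h_o(\vartheta)$ be the fiber operator, i.e. $h_o$ acting on the finite-dimensional space of functions with $f_{x+a_s}=e^{i\vartheta_s}f_x$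 for all $x,s$ (dimension $\nu=\#(\mathcal V/\Gamma)$), and let $\mathfrak b_\nu(\vartheta)$ be its largest eigenvalue. The top $s_+$ is called regular if $\{\vartheta\in\mathbb{T}^d:\mathfrak b_\nu(\vartheta)=s_+\}$ is a finite set of points $\vartheta_1,\dots,\vartheta_{n_R}$ and for each $j$ there is a positive definite matrix $B_j$ with $\mathfrak b_\nu(\vartheta)=s_+-(B_ja,a)+O(|a|^3)$ as $a=\vartheta-\vartheta_j\to0$. Time-periodic operator: $\tau>0$, $\omega=2\pi/\tau$, $\mathbb{T}_\tau=\mathbb{R}/\tau\mathbb{Z}$; $V=V_x(t)$, $(t,x)\in\mathbb{R}\times\mathcal V$, is a real (measurable) function, $\tau$-periodic in $t$. On $L^2(\mathbb{T}_\tau,\ell^2(\mathcal V))$ put $\partial=-i\,\partial/\partial t$ (self-adjoint, periodic boundary conditions), $\tilde h_o=\partial+h_o$, and $\tilde h=\tilde h_o+V$, with $V$ acting by multiplication by $V_x(t)$. For $A\subset\mathbb{R}$, $\tilde n(A)$ is the number of eigenvalues of $\tilde h$ in $A$ counted with multiplicity. Notation: $(z)_\pm=(|z|\pm z)/2$ for real $z$; $\|q\|_p=(\sum_{x}|q_x|^p)^{1/p}$. Constants: $C_{ks}^-$ is a constant depending only on $\mathcal G$ and $\mathfrak p$ such that for every real $\mathfrak q\in\ell^{d/2}(\mathcal V)$ and $\mu<0$ the number (with multiplicity) of eigenvalues of $h_o+\mathfrak q$ below $\mu$ is at most $C_{ks}^-\sum_x\big((\mathfrak q_x-\mu)_-\big)^{d/2}$.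 If $s_+$ is regular (or $\mathcal G$ is bipartite), $C_{ks}^+$ is a constant depending only on $\mathcal G$ and $\mathfrak p$ such that for every real $\mathfrak q\in\ell^{d/2}(\mathcal V)$ and $\mu>s_+$ the number of eigenvalues of $h_o+\mathfrak q$ above $\mu$ is at most $C_{ks}^+\sum_x\big((\mathfrak q_x-\mu+s_+)_+\big)^{d/2}$. (Both are known estimates; such constants exist.) *)

(* Defs.v *)
From HB Require Import structures.
From mathcomp Require Import all_boot all_order all_algebra.
From mathcomp Require Import complex.
From mathcomp Require Import all_classical all_reals all_analysis.

Set Implicit Arguments.
Unset Strict Implicit.
Unset Printing Implicit Defensive.

Import Order.TTheory GRing.Theory Num.Theory.
Local Open Scope classical_set_scope.
Local Open Scope ring_scope.
Local Open Scope complex_scope.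

Fixpoint is_walk (V E : Type) (src tgt : E -> V) (x : V) (w : seq E) (y : V)
    : Prop :=
  if w is e :: w' then src e = x /\ is_walk src tgt (tgt e) w' y else x = y.

(* Multigraphs are encoded by oriented edges: an unoriented edge (possibly a
   loop) is a pair {e, reverse e} with reverse e <> e, and parallel edges are
   distinct elements of [edge].  The vertices are points of R^d, recorded by the
   injection [pos]; [vtrans m] and [etrans m] are the translations of vertices
   and edges by the lattice vector m_1 a_1 + ... + m_d a_d. *)
Record periodic_graph (R : realType) (d : nat) := PeriodicGraph {
  lattice_basis : 'M[R]_d;
  vertex : choiceType;
  edge : choiceType;
  pos : vertex -> 'rV[R]_d;
  src : edge -> vertex;
  reverse : edge -> edge;
  vtrans : 'rV[int]_d -> vertex -> vertex;
  etrans : 'rV[int]_d -> edge -> edge;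
  lattice_basis_unit : lattice_basis \in unitmx;
  pos_inj : injective pos;
  reverseK : involutive reverse;
  reverse_neq : forall e, reverse e <> e;
  pos_vtrans : forall m x,
    pos (vtrans m x) = pos x + map_mx intr m *m lattice_basis;
  etrans0 : forall e, etrans 0 e = e;
  etransD : forall m n e, etrans (m + n) e = etrans m (etrans n e);
  src_etrans : forall m e, src (etrans m e) = vtrans m (src e);
  reverse_etrans : forall m e, reverse (etrans m e) = etrans m (reverse e);
  vertex_infinite : infinite_set [set: vertex];
  locally_finite : forall x, finite_set [set e | src e = x];
  graph_connected : forall x y,
    exists w, is_walk src (fun e => src (reverse e)) x w y;
  finite_vertex_quotient : exists F : set vertex, finite_set F /\
    forall x, exists2 y, F y & exists m, x = vtrans m y;
  finite_edge_quotient : exists F : set edge, finite_set F /\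
    forall e, exists2 e', F e' & exists m, e = etrans m e'
}.

Definition tgt (R : realType) (d : nat) (G : periodic_graph R d) (e : edge G)
  : vertex G := src (reverse e).

Definition bipartite (R : realType) (d : nat) (G : periodic_graph R d) : Prop :=
  exists A : set (vertex G), forall e : edge G, A (src e) <-> ~ A (tgt e).

Definition periodic_potential (R : realType) (d : nat) (G : periodic_graph R d)
    (p : vertex G -> R) : Prop :=
  forall m x, p (vtrans m x) = p x.

Definition positive_part (R : realType) (z : R) : R := (`|z| + z) / 2.
Definition negative_part (R : realType) (z : R) : R := (`|z| - z) / 2.

Definition normp_sum (R : realType) (T : choiceType) (p : R) (q : T -> R)
  : \bar R := \esum_(x in [set: T]) (`|q x| `^ p)%:E.

Definition lp_norm (R : realType) (T : choiceType) (p : R) (q : T -> R)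
  : \bar R := (normp_sum p q `^ p^-1)%E.

Definition lp_space (R : realType) (T : choiceType) (p : R) (q : T -> R)
  : Prop := (lp_norm p q < +oo)%E.

Definition sqnorm (R : realType) (z : R[i]) : R :=
  complex.Re z ^+ 2 + complex.Im z ^+ 2.

Definition ell2_sqnorm (R : realType) (T : choiceType) (f : T -> R[i])
  : \bar R := \esum_(x in [set: T]) (sqnorm (f x))%:E.

Definition ell2 (R : realType) (T : choiceType) (f : T -> R[i]) : Prop :=
  (ell2_sqnorm f < +oo)%E.

(* Eigenvalues of an operator given by its graph [Op] (Op f g means that f is in
   the domain and Op f = g) on a space of functions modulo the null functions
   [Z].  Dimensions and counts are extended reals. *)
Definition lin_indep_mod (R : realType) (T : Type) (Z : set (T -> R[i]))
    (n : nat) (e : 'I_n -> T -> R[i]) : Prop :=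
  forall c : 'I_n -> R[i],
    Z (fun z => \sum_(i < n) c i * e i z) -> forall i, c i = 0.

Definition dim_mod (R : realType) (T : Type) (Z E : set (T -> R[i]))
  : \bar R :=
  ereal_sup [set n%:R%:E | n in [set n : nat | exists e : 'I_n -> T -> R[i],
    (forall i, E (e i)) /\ lin_indep_mod Z e]].

Definition eigenspace (R : realType) (T : Type)
    (Op : (T -> R[i]) -> (T -> R[i]) -> Prop) (l : R) : set (T -> R[i]) :=
  [set f | Op f (fun z => l%:C * f z)].

Definition num_eigenvalues (R : realType) (T : Type) (Z : set (T -> R[i]))
    (Op : (T -> R[i]) -> (T -> R[i]) -> Prop) (A : set R) : \bar R :=
  \esum_(l in A) dim_mod Z (eigenspace Op l).

Definition laplacian (R : realType) (d : nat) (G : periodic_graph R d)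
    (f : vertex G -> R[i]) (x : vertex G) : R[i] :=
  \sum_(e \in [set e : edge G | src e = x]) (f x - f (tgt e)).

Definition h_o (R : realType) (d : nat) (G : periodic_graph R d)
    (p : vertex G -> R) (f : vertex G -> R[i]) (x : vertex G) : R[i] :=
  laplacian f x + (p x)%:C * f x.

Definition h_o_plus (R : realType) (d : nat) (G : periodic_graph R d)
    (p q : vertex G -> R) (f g : vertex G -> R[i]) : Prop :=
  ell2 f /\ forall x, g x = h_o p f x + (q x)%:C * f x.

Definition n_h_o_plus (R : realType) (d : nat) (G : periodic_graph R d)
    (p q : vertex G -> R) (A : set R) : \bar R :=
  num_eigenvalues [set f | forall x, f x = 0] (h_o_plus p q) A.

Definition resolvent_set (R : realType) (T : choiceType)
    (H : (T -> R[i]) -> T -> R[i]) : set R[i] :=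
  [set z |
    (forall g, ell2 g ->
       exists2 f, ell2 f & forall x, H f x - z * f x = g x) /\
    (exists M : R, forall f, ell2 f ->
       (ell2_sqnorm f <= M%:E * ell2_sqnorm (fun x => H f x - z * f x)%R)%E)].

Definition spectrum (R : realType) (T : choiceType)
    (H : (T -> R[i]) -> T -> R[i]) : set R[i] := ~` resolvent_set H.

(* The order of R[i] is partial: z <= s%:C forces z to be real. *)
Definition is_spectrum_max (R : realType) (T : choiceType)
    (H : (T -> R[i]) -> T -> R[i]) (s : R) : Prop :=
  spectrum H s%:C /\ forall z, spectrum H z -> z <= s%:C.

Definition expi (R : realType) (t : R) : R[i] := cos t +i* sin t.

Definition fiber_eigenvalue (R : realType) (d : nat) (G : periodic_graph R d)
    (p : vertex G -> R) (theta : 'rV[R]_d) (l : R) : Prop :=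
  exists f : vertex G -> R[i],
    [/\ exists x, f x <> 0,
        forall (s : 'I_d) x,
          f (vtrans (delta_mx 0 s) x) = expi (theta 0 s) * f x &
        forall x, h_o p f x = l%:C * f x].

(* The fiber operator is Hermitian in finite positive dimension, so this [sup]
   is the maximum of its spectrum. *)
Definition band_top (R : realType) (d : nat) (G : periodic_graph R d)
    (p : vertex G -> R) (theta : 'rV[R]_d) : R :=
  sup [set l | fiber_eigenvalue p theta l].

Definition qform (R : realType) (d : nat) (B : 'M[R]_d) (a : 'rV[R]_d) : R :=
  (a *m B *m a^T) 0 0.

Definition euclid_norm (R : realType) (d : nat) (a : 'rV[R]_d) : R :=
  Num.sqrt (qform 1%:M a).

Definition posdef (R : realType) (d : nat) (B : 'M[R]_d) : Prop :=
  B^T = B /\ forall a, a != 0 -> 0 < qform B a.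

(* Points of the torus are represented in [0, 2 pi)^d; [band_top] is defined on
   all of R^d and is 2 pi-periodic. *)
Definition regular_top (R : realType) (d : nat) (G : periodic_graph R d)
    (p : vertex G -> R) (s : R) : Prop :=
  let M := [set theta : 'rV[R]_d |
    (forall i, 0 <= theta 0 i < 2 * pi) /\ band_top p theta = s] in
  finite_set M /\
  forall theta, M theta -> exists B : 'M[R]_d, posdef B /\
    exists K e : R, 0 < e /\ forall a : 'rV[R]_d, euclid_norm a < e ->
      `|band_top p (theta + a) - (s - qform B a)| <= K * euclid_norm a ^+ 3.

(* L^2(T_tau, ell^2(T)): functions on R * T restricted to [0, tau] * T, modulo
   equality almost everywhere.  For countable T, measurability with values in
   ell^2(T) is measurability of every component. *)
Definition ae_eq_time (R : realType) (T : Type) (tau : R)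
    (f g : R * T -> R[i]) : Prop :=
  {ae @lebesgue_measure R, forall t,
    0 <= t <= tau -> forall x, f (t, x) = g (t, x)}.

Definition L2_time (R : realType) (T : choiceType) (tau : R)
    (f : R * T -> R[i]) : Prop :=
  (forall x,
     measurable_fun `[0%R, tau]%classic (fun t => complex.Re (f (t, x))) /\
     measurable_fun `[0%R, tau]%classic (fun t => complex.Im (f (t, x)))) /\
  (\int[@lebesgue_measure R]_(t in `[0%R, tau]%classic)
     ell2_sqnorm (fun x => f (t, x)) < +oo)%E.

Definition cintegral (R : realType) (D : set R) (g : R -> R[i]) : R[i] :=
  Rintegral (@lebesgue_measure R) D (fun t => complex.Re (g t)) +i*
  Rintegral (@lebesgue_measure R) D (fun t => complex.Im (g t)).

(* Graph of -i d/dt with periodic boundary conditions: f has an absolutely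
   continuous tau-periodic representative F with F' = i g. *)
Definition time_derivative (R : realType) (T : choiceType) (tau : R)
    (f g : R * T -> R[i]) : Prop :=
  [/\ L2_time tau f, L2_time tau g &
    exists F : R * T -> R[i],
      [/\ ae_eq_time tau f F,
          forall x, F (tau, x) = F (0, x) &
          forall t x, 0 <= t <= tau ->
            F (t, x) = F (0, x) + (0 +i* 1) *
              cintegral `[0%R, t]%classic (fun r => g (r, x))]].

Definition h_tilde (R : realType) (d : nat) (G : periodic_graph R d)
    (p : vertex G -> R) (tau : R) (V : R -> vertex G -> R)
    (f g : R * vertex G -> R[i]) : Prop :=
  exists2 k, time_derivative tau f k &
    ae_eq_time tau g (fun z =>
      k z + h_o p (fun x => f (z.1, x)) z.2 + (V z.1 z.2)%:C * f z).

Definition n_tilde (R : realType) (d : nat) (G : periodic_graph R d)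
    (p : vertex G -> R) (tau : R) (V : R -> vertex G -> R) (A : set R)
  : \bar R :=
  num_eigenvalues [set f | ae_eq_time tau f (fun=> 0)] (h_tilde p tau V) A.

Definition Cks_minus (R : realType) (d : nat) (G : periodic_graph R d)
    (p : vertex G -> R) (C : R) : Prop :=
  forall (q : vertex G -> R) (mu : R), lp_space (d%:R / 2) q -> mu < 0 ->
    (n_h_o_plus p q [set l | (l < mu)%R] <=
     C%:E * \esum_(x in [set: vertex G])
              (negative_part (q x - mu) `^ (d%:R / 2))%:E)%E.

Definition Cks_plus (R : realType) (d : nat) (G : periodic_graph R d)
    (p : vertex G -> R) (s C : R) : Prop :=
  forall (q : vertex G -> R) (mu : R), lp_space (d%:R / 2) q -> s < mu ->
    (n_h_o_plus p q [set l | (mu < l)%R] <=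
     C%:E * \esum_(x in [set: vertex G])
              (positive_part (q x - mu + s) `^ (d%:R / 2))%:E)%E.

(* [w] is a part ((V_x(t))_- or (V_x(t))_+) of the potential V, [v] dominates
   it, [delta] is its supremum and [delta'] that of the other part. *)
Definition gap_condition (R : realType) (T : choiceType)
    (pp s omega : R) (V w : R -> T -> R) (delta delta' : R)
    (u v : T -> R) (c : R) : Prop :=
  [/\ (forall t x, `|V t x| <= u x) /\ (forall t x, w t x <= v x),
      lp_space pp (fun x => u x ^+ 2) /\ lp_space pp v,
      4 * omega / (omega - s) ^+ 2 < c,
      delta' * c <= Num.sqrt 3 &
      s + delta + Num.sqrt (delta * (2 * s + delta)) <= omega].

(* Main.v *)
Require Import Defs.
From HB Require Import structures.
From mathcomp Require Import all_boot all_order all_algebra.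
From mathcomp Require Import complex finmap.
From mathcomp Require Import all_classical all_reals all_analysis.
From mathcomp Require Import measurable_realfun.
From mathcomp Require Import ring lra.

Set Implicit Arguments.
Unset Strict Implicit.
Unset Printing Implicit Defensive.

Import Order.TTheory GRing.Theory Num.Theory.
Import numFieldNormedType.Exports.
Local Open Scope classical_set_scope.
Local Open Scope ring_scope.
Local Open Scope complex_scope.

(** Expand an eigenfunction of the time-periodic operator, or a superposition F of
    eigenfunctions, in Fourier modes F = sum_n f_n e^{i n omega t}, and split it
    into the half F_+ with n >= 0 and the half F_- with n < 0. Pairing the equation
    (-i d/dt + h_o + V) F = w with F_+ and with F_- and subtracting, the cross terms
    (V F_+, F_-) cancel, so that
      E(F_+) - E(F_-) = (w, F_+) - (w, F_-)
    where E is the quadratic form of the time-periodic operator ([energy_identity]).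

    For the lower end of the gap let w = h~ F, with eigenvalues l in [- dm, 0). On
    F_- the term n omega <= - omega outweighs 0 <= h_o <= s and V <= dp, hence
    E(F_-) <= - d |F_-|^2 with d = omega - s - dp > dm. On F_+ only the mode 0 has
    no positive contribution from n omega: if V >= - q with 0 <= q <= dm <= omega,
    then E(F_+) >= ((h_o - q) f_0, f_0). Completing the square in w over F_- gives
      ((h_o - q) f_0, f_0) <= (w, F) + |w|^2 / d          ([form_le_residual]).
    Eigenfunctions of different eigenvalues are orthogonal, so the right-hand side
    is a sum of terms (l + l^2 / d) |F_l|^2, negative because - d < l < 0. Thus F
    |-> f_0 is injective on the span of the eigenfunctions and its image is a space
    on which the form of h_o - q is negative ([superposition_form_lt0]); a fortiori
    the form of h_o - q_- is, because q_- >= v_-, and the variational principle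
    gives the bound. For the upper end the argument is the same after adding omega -
    s to the energy and exchanging the two halves: the exceptional mode is n = -1
    and h_o is replaced by s - h_o ([superposition_reflected_form_lt0]). For l
    between the two bands, E - l is positive on F_+ and negative on F_-, whence F =
    0 ([gap_solution_eq0]), and the count over the whole gap is the sum of the two.

    Three analytic facts carry the argument. The variational principle
    ([count_bound_states]) is obtained by minimising the form over the unit ball,
    which is weakly compact: a nonnegative bounded form is weakly lower
    semicontinuous, and a potential vanishing at infinity is weakly continuous;
    restricting to orthogonal complements produces as many orthonormal
    eigenfunctions as the dimension of the negative space. That h_o has form between
    0 and s follows from its spectrum because the infimum of the form is an
    approximate eigenvalue ([form_ge]). Finally the pairings above are made with the
    truncations to - N <= n < N, and the remainder must disappear as N grows: at
    each vertex an eigenfunction is Lipschitz in time, so its Fourier sums converge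
    uniformly with squared error at most G x / N, where G is summable over the
    vertices ([fourier_tail], [eigenfunction_solution], [vform_residual_small]).

    In the counting estimates with a constant C the endpoint of the half-line is
    reached from mu < 0 (or mu > s), since finitely many eigenvalues stay away from
    it ([Cks_minus_le], [Cks_plus_le]). *)

(** * Unordered sums of real families *)

Section unordered_sums.
Variables (R : realType) (T : choiceType).
Implicit Types (F G a b : T -> R) (K : seq T).

Definition summ F : Prop := (\esum_(x in [set: T]) (`|F x|)%:E < +oo)%E.

(** A difference of two sums of nonnegative families, so that every family has a
    value and reindexing needs no convergence. *)
Definition tsum F : R :=
  fine (\esum_(x in [set: T]) (Num.max (F x) 0)%:E) -
  fine (\esum_(x in [set: T]) (Num.max (- F x) 0)%:E).

Lemma summ_le F G : summ G -> (forall x, `|F x| <= `|G x|) -> summ F.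
Proof.
by move=> sG FG; apply: le_lt_trans sG; apply: le_esum => x _; rewrite lee_fin.
Qed.

Lemma eq_summ F G : F =1 G -> summ F -> summ G.
Proof. by move=> FG /summ_le; apply => x; rewrite FG. Qed.

Lemma summD F G : summ F -> summ G -> summ (fun x => F x + G x).
Proof.
move=> sF sG; apply: le_lt_trans (lte_add_pinfty sF sG).
rewrite -esumD; [|by move=> x _; rewrite lee_fin..].
by apply: le_esum => x _; rewrite -EFinD lee_fin ler_normD.
Qed.

Lemma summN F : summ F -> summ (fun x => - F x).
Proof. by move=> /summ_le; apply => x; rewrite normrN. Qed.

Lemma summB F G : summ F -> summ G -> summ (fun x => F x - G x).
Proof. by move=> sF sG; apply: summD => //; exact: summN. Qed.

Lemma summ0 : summ (fun=> 0).
Proof. by rewrite /summ esum1 ?ltry// => x _; rewrite normr0. Qed.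

(** The factor is first bounded by a natural number, for which scaling is repeated
    addition. *)
Lemma summZ (c : R) F : summ F -> summ (fun x => c * F x).
Proof.
move=> sF.
have sn n : summ (fun x => n%:R * F x).
  elim: n => [|n ih]; first by apply: eq_summ summ0 => x; rewrite mul0r.
  by apply: eq_summ (summD ih sF) => x; rewrite -natr1 mulrDl mul1r.
apply: (summ_le (sn (Num.truncn `|c|).+1)) => x.
rewrite !normrM ler_wpM2r// [leRHS]ger0_norm// ltW//.
by have /andP[] := truncn_itv (normr_ge0 c).
Qed.

Lemma summ_sum (I : Type) (r : seq I) (F : I -> T -> R) :
  (forall i, summ (F i)) -> summ (fun x => \sum_(i <- r) F i x).
Proof.
move=> sF; elim: r => [|i r ih].
  by apply: eq_summ summ0 => x; rewrite big_nil.
by apply: eq_summ (summD (sF i) ih) => x; rewrite big_cons.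
Qed.

Lemma summ_abs F : summ F -> summ (fun x => `|F x|).
Proof. by move=> /summ_le; apply => x; rewrite normr_id. Qed.

Lemma summ_fin_num a : summ a -> (forall x, 0 <= a x) ->
  (\esum_(x in [set: T]) (a x)%:E \is a fin_num)%E.
Proof.
move=> sa a0; rewrite ge0_fin_numE; last by apply: esum_ge0 => x _; rewrite lee_fin.
by apply: le_lt_trans sa; apply: le_esum => x _; rewrite lee_fin ler_norm.
Qed.

Let nsum a := fine (\esum_(x in [set: T]) (a x)%:E).

Lemma nsumD a b : summ a -> summ b -> (forall x, 0 <= a x) ->
  (forall x, 0 <= b x) -> nsum (fun x => a x + b x) = nsum a + nsum b.
Proof.
move=> sa sb a0 b0; rewrite /nsum -fineD ?summ_fin_num// -esumD//;
  by move=> x _; rewrite lee_fin.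
Qed.

(** Additivity of the sum of nonnegative families makes the value independent of the
    chosen decomposition; linearity then follows from the decomposition into
    positive parts. *)
Lemma tsum_diff F a b : summ a -> summ b -> (forall x, 0 <= a x) ->
  (forall x, 0 <= b x) -> (forall x, F x = a x - b x) ->
  tsum F = nsum a - nsum b.
Proof.
move=> sa sb a0 b0 Fab.
have s1 : summ (fun x => Num.max (F x) 0).
  apply: (summ_le sa) => x; rewrite !ger0_norm ?le_max ?lexx ?orbT//.
  by rewrite ge_max a0 Fab lerBlDr lerDl b0.
have s2 : summ (fun x => Num.max (- F x) 0).
  apply: (summ_le sb) => x; rewrite !ger0_norm ?le_max ?lexx ?orbT//.
  by rewrite ge_max b0 Fab opprB lerBlDr lerDl a0.
have : nsum (fun x => Num.max (F x) 0 + b x) = nsum (fun x => Num.max (- F x) 0 + a x).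
  congr fine; apply: eq_esum => x _; congr EFin; rewrite Fab.
  by case: (lerP (a x - b x) 0); case: (lerP (- (a x - b x)) 0); lra.
rewrite !nsumD//; last 2 first.
  by move=> x; rewrite le_max lexx orbT.
  by move=> x; rewrite le_max lexx orbT.
by rewrite /tsum /nsum; lra.
Qed.

Lemma tsum_ge0E a : summ a -> (forall x, 0 <= a x) -> tsum a = nsum a.
Proof.
move=> sa a0; rewrite (@tsum_diff _ a (fun=> 0))//; last 2 first.
- exact: summ0.
- by move=> x; rewrite subr0.
by rewrite [X in _ - X]/nsum esum1//= subr0.
Qed.

Let posp F x := Num.max (F x) 0.
Let negp F x := Num.max (- F x) 0.

Let posp_ge0 F x : 0 <= posp F x. Proof. by rewrite le_max lexx orbT. Qed.
Let negp_ge0 F x : 0 <= negp F x. Proof. by rewrite le_max lexx orbT. Qed.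
Let posnegE F x : F x = posp F x - negp F x.
Proof. by rewrite /posp /negp; case: (lerP (F x) 0); case: (lerP (- (F x)) 0); lra. Qed.
Let posp_summ F : summ F -> summ (posp F).
Proof.
move=> sF; apply: (summ_le sF) => x.
by rewrite ger0_norm// ge_max normr_ge0 ler_norm.
Qed.
Let negp_summ F : summ F -> summ (negp F).
Proof. by move=> sF; apply: (@posp_summ (fun x => - F x)); exact: summN. Qed.

Lemma eq_tsum F G : F =1 G -> tsum F = tsum G.
Proof. by move=> /funext ->. Qed.

Lemma tsumD F G : summ F -> summ G ->
  tsum (fun x => F x + G x) = tsum F + tsum G.
Proof.
move=> sF sG.
rewrite (@tsum_diff _ (fun x => posp F x + posp G x) (fun x => negp F x + negp G x)).
- rewrite !nsumD//; try exact: posp_summ; try exact: negp_summ.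
  by rewrite /tsum /nsum /posp /negp; ring.
- by apply: summD; exact: posp_summ.
- by apply: summD; exact: negp_summ.
- by move=> x; rewrite addr_ge0.
- by move=> x; rewrite addr_ge0.
- by move=> x; rewrite (posnegE F) (posnegE G); ring.
Qed.

Lemma tsumN F : tsum (fun x => - F x) = - tsum F.
Proof.
rewrite /tsum opprB; congr (_ - fine _).
by apply: eq_esum => x _; rewrite opprK.
Qed.

Lemma tsumB F G : summ F -> summ G ->
  tsum (fun x => F x - G x) = tsum F - tsum G.
Proof. by move=> sF sG; rewrite tsumD ?tsumN//; exact: summN. Qed.

Lemma tsum0 : tsum (fun=> 0) = 0.
Proof. by rewrite /tsum oppr0 subrr. Qed.

Lemma tsum_ge0 F : (forall x, 0 <= F x) -> 0 <= tsum F.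
Proof.
move=> F0; rewrite /tsum [X in _ - fine X]esum1 /= ?subr0.
  by rewrite fine_ge0// esum_ge0// => x _; rewrite lee_fin le_max lexx orbT.
by move=> x _; rewrite (max_idPr _)// oppr_le0.
Qed.

Lemma le_tsum F G : summ F -> summ G -> (forall x, F x <= G x) ->
  tsum F <= tsum G.
Proof.
by move=> sF sG FG; rewrite -subr_ge0 -tsumB// tsum_ge0// => x; rewrite subr_ge0.
Qed.

Lemma tsum_sum (I : Type) (r : seq I) (F : I -> T -> R) :
  (forall i, summ (F i)) ->
  tsum (fun x => \sum_(i <- r) F i x) = \sum_(i <- r) tsum (F i).
Proof.
move=> sF; elim: r => [|i r ih].
  by rewrite big_nil -[RHS]tsum0; apply: eq_tsum => x; rewrite big_nil.
rewrite big_cons -ih -tsumD//; last exact: summ_sum.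
by apply: eq_tsum => x; rewrite big_cons.
Qed.

Lemma ler_norm_tsum F : summ F -> `|tsum F| <= tsum (fun x => `|F x|).
Proof.
move=> sF; have sA := summ_abs sF.
rewrite ler_norml -tsumN !le_tsum//.
- by move=> x; rewrite ler_norm.
- exact: summN.
- by move=> x; rewrite lerNl -normrN ler_norm.
Qed.

Lemma sum_le_tsum K F : uniq K -> summ F -> (forall x, 0 <= F x) ->
  \sum_(x <- K) F x <= tsum F.
Proof.
move=> uK sF F0; rewrite tsum_ge0E// -lee_fin fineK ?summ_fin_num//.
apply: esum_ge; exists [set` K]; first by split.
by rewrite -fsbig_seq// sumEFin.
Qed.

Lemma ge0_le_tsum F x : summ F -> (forall x, 0 <= F x) -> F x <= tsum F.
Proof.
by move=> sF F0; rewrite -[F x](big_seq1 +%R x F) sum_le_tsum.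
Qed.

Lemma tsum_le F (M : R) : summ F -> (forall x, 0 <= F x) ->
  (forall K, uniq K -> \sum_(x <- K) F x <= M) -> tsum F <= M.
Proof.
move=> sF F0 FM; rewrite tsum_ge0E// -lee_fin fineK ?summ_fin_num//.
apply: ge_ereal_sup => _ [X [finX _]] <-.
by rewrite fsbig_finite//= sumEFin lee_fin FM// fset_uniq.
Qed.

Lemma summ_bounded F (M : R) : (forall x, 0 <= F x) ->
  (forall K, uniq K -> \sum_(x <- K) F x <= M) -> summ F.
Proof.
move=> F0 FM; apply: (@le_lt_trans _ _ M%:E); last exact: ltry.
apply: ge_ereal_sup => _ [X [finX _]] <-.
rewrite fsbig_finite//= sumEFin lee_fin.
apply: le_trans (FM _ (fset_uniq (fset_set X))).
by apply: ler_sum => x _; rewrite ger0_norm.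
Qed.

Lemma tsum_fin K F : uniq K ->
  summ (fun x => if x \in K then F x else 0) /\
  tsum (fun x => if x \in K then F x else 0) = \sum_(x <- K) F x.
Proof.
elim: K => [_|k K ih /= /andP[kK uK]].
  by rewrite big_nil; split; [exact: summ0|rewrite tsum0].
have [sK tK] := ih uK.
have s1 : summ (fun x => if x == k then F x else 0).
  rewrite /summ (esumID [set k]); last by move=> x _; rewrite lee_fin.
  rewrite [X in (_ + X)%E]esum1 ?adde0; last first.
    by move=> x [_ /= /eqP/negbTE ->]; rewrite normr0.
  by rewrite setTI esum_set1// ltry.
have t1 : tsum (fun x => if x == k then F x else 0) = F k.
  have es (c : R -> R) : c 0 = 0 -> (forall z, 0 <= c z) ->
      (\esum_(x in [set: T]) (c (if x == k then F x else 0))%:E = (c (F k))%:E)%E.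
    move=> c0 cp; rewrite (esumID [set k]); last by move=> x _; rewrite lee_fin.
    rewrite [X in (_ + X)%E]esum1 ?adde0; last first.
      by move=> x [_ /= /eqP/negbTE ->]; rewrite c0.
    by rewrite setTI esum_set1 ?eqxx ?lee_fin.
  rewrite /tsum [X in fine X - _](_ : _ = (posp F k)%:E); last first.
    apply: (es (fun z => Num.max z 0)); first exact: maxxx.
    by move=> z; rewrite le_max lexx orbT.
  rewrite [X in _ - fine X](_ : _ = (negp F k)%:E) -?posnegE//.
  apply: (es (fun z => Num.max (- z) 0)); first by rewrite oppr0 maxxx.
  by move=> z; rewrite le_max lexx orbT.
have E : (fun x => if x \in k :: K then F x else 0) =1
   (fun x => (if x == k then F x else 0) + (if x \in K then F x else 0)).
  move=> x; rewrite inE; case: eqP => [->|]/=; last by rewrite add0r.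
  by rewrite (negbTE kK) addr0.
split; first by apply: eq_summ (summD s1 sK) => x; rewrite E.
by rewrite (eq_tsum E) tsumD// t1 tK big_cons.
Qed.

Lemma tsum_tail F (e : R) : summ F -> (forall x, 0 <= F x) -> 0 < e ->
  exists2 K, uniq K & tsum (fun x => if x \in K then 0 else F x) < e.
Proof.
move=> sF F0 e0.
have [K uK hK] : exists2 K, uniq K & tsum F - e < \sum_(x <- K) F x.
  apply: contrapT => h; suff : tsum F <= tsum F - e by lra.
  apply: tsum_le => // K uK; rewrite leNgt; apply/negP => hK.
  by apply: h; exists K.
exists K => //; have [sK tK] := tsum_fin F uK.
have -> : (fun x => if x \in K then 0 else F x) =
          (fun x => F x - (if x \in K then F x else 0)).
  by apply/funext => x; case: ifP; rewrite ?subrr ?subr0.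
by rewrite tsumB// tK; lra.
Qed.

Lemma tsumZ (c : R) F : summ F -> tsum (fun x => c * F x) = c * tsum F.
Proof.
have pos (d : R) G : 0 < d -> summ G -> (forall x, 0 <= G x) ->
    tsum (fun x => d * G x) <= d * tsum G.
  move=> d0 sG G0; apply: tsum_le => [|x|K uK].
  - exact: summZ.
  - by rewrite mulr_ge0// ltW.
  - by rewrite -mulr_sumr ler_wpM2l ?(ltW d0)// sum_le_tsum.
have pos_eq (d : R) G : 0 < d -> summ G -> (forall x, 0 <= G x) ->
    tsum (fun x => d * G x) = d * tsum G.
  move=> d0 sG G0; apply/eqP; rewrite eq_le pos//=.
  rewrite -ler_pdivlMl//.
  have := pos d^-1 (fun x => d * G x).
  rewrite invr_gt0 => /(_ d0 (summZ d sG)).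
  under eq_fun do rewrite mulKf ?gt_eqF//.
  by apply => x; rewrite mulr_ge0// ltW.
have gt0 (d : R) G : 0 < d -> summ G -> tsum (fun x => d * G x) = d * tsum G.
  move=> d0 sG; rewrite (_ : tsum G = tsum (posp G) - tsum (negp G)); last first.
    rewrite -tsumB; [|exact: posp_summ|exact: negp_summ].
    by apply: eq_tsum => x; exact: posnegE.
  rewrite mulrBr -!pos_eq//; [|exact: negp_summ|exact: posp_summ].
  rewrite -tsumB; [|exact/summZ/posp_summ|exact/summZ/negp_summ].
  by apply: eq_tsum => x; rewrite {1}(posnegE G) mulrBr.
move=> sF; case: (ltrgtP c 0) => [c0|c0|->].
- rewrite -[c]opprK mulNr -gt0 ?oppr_gt0// -tsumN.
  by apply: eq_tsum => x; rewrite mulNr.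
- exact: gt0.
- by rewrite mul0r -[RHS]tsum0; apply: eq_tsum => x; rewrite mul0r.
Qed.

End unordered_sums.

(** * Square summable functions *)

Section complex_plane.
Variable R : realType.
Implicit Types (z w c : R[i]) (r : R).

(** The real inner product of the plane. Real inner products suffice for quadratic
    forms and keep every estimate in the ordered field. *)
Definition cdot z w : R := complex.Re z * complex.Re w + complex.Im z * complex.Im w.

Lemma cdotzz z : cdot z z = sqnorm z.
Proof. by rewrite /cdot /sqnorm !expr2. Qed.

Lemma cdotC z w : cdot z w = cdot w z.
Proof. by rewrite /cdot; ring. Qed.

Lemma cdotDl z1 z2 w : cdot (z1 + z2) w = cdot z1 w + cdot z2 w.
Proof. by case: z1 z2 w => [a b] [a' b'] [c d]; rewrite /cdot /=; ring. Qed.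

Lemma cdotNl z w : cdot (- z) w = - cdot z w.
Proof. by case: z w => [a b] [c d]; rewrite /cdot /=; ring. Qed.

Lemma cdotNr z w : cdot z (- w) = - cdot z w.
Proof. by rewrite cdotC cdotNl cdotC. Qed.

Lemma cdot0l w : cdot 0 w = 0.
Proof. by rewrite /cdot /= !mul0r addr0. Qed.

Lemma cdot0r w : cdot w 0 = 0.
Proof. by rewrite cdotC cdot0l. Qed.

Lemma cdotMl c z w : cdot (c * z) w = cdot z (c^* * w).
Proof. by case: c z w => [e f] [a b] [c d]; rewrite /cdot /=; ring. Qed.

Lemma cdotRl r z w : cdot (r%:C * z) w = r * cdot z w.
Proof. by case: z w => [a b] [c d]; rewrite /cdot /=; ring. Qed.

Lemma cdotRr r z w : cdot z (r%:C * w) = r * cdot z w.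
Proof. by rewrite cdotC cdotRl cdotC. Qed.

Lemma cdot_suml (I : Type) (s : seq I) (F : I -> R[i]) w :
  cdot (\sum_(i <- s) F i) w = \sum_(i <- s) cdot (F i) w.
Proof.
elim: s => [|i s ih]; first by rewrite !big_nil cdot0l.
by rewrite !big_cons cdotDl ih.
Qed.

Lemma cdot_sumr (I : Type) (s : seq I) (F : I -> R[i]) w :
  cdot w (\sum_(i <- s) F i) = \sum_(i <- s) cdot w (F i).
Proof. by rewrite cdotC cdot_suml; apply: eq_bigr => i _; rewrite cdotC. Qed.

Lemma sqnorm_ge0 z : 0 <= sqnorm z.
Proof. by rewrite addr_ge0// sqr_ge0. Qed.

Lemma sqnorm0 : sqnorm (0 : R[i]) = 0.
Proof. by rewrite /sqnorm /= expr0n addr0. Qed.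

Lemma sqnorm_eq0 z : sqnorm z = 0 -> z = 0.
Proof.
case: z => a b /eqP; rewrite /sqnorm /= paddr_eq0 ?sqr_ge0// !sqrf_eq0.
by move=> /andP[/eqP -> /eqP ->].
Qed.

Lemma sqnormM z w : sqnorm (z * w) = sqnorm z * sqnorm w.
Proof. by case: z w => [a b] [c d]; rewrite /sqnorm /=; ring. Qed.

Lemma sqnormN z : sqnorm (- z) = sqnorm z.
Proof. by case: z => [a b]; rewrite /sqnorm /= !sqrrN. Qed.

Lemma sqnormR r : sqnorm (r%:C : R[i]) = r ^+ 2.
Proof. by rewrite /sqnorm /= expr0n addr0. Qed.

Lemma sqnormC z : sqnorm z^* = sqnorm z.
Proof. by case: z => [a b]; rewrite /sqnorm /= sqrrN. Qed.

Lemma sqnormD z w : sqnorm (z + w) = sqnorm z + 2 * cdot z w + sqnorm w.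
Proof. by case: z w => [a b] [c d]; rewrite /sqnorm /cdot /=; ring. Qed.

(** The weight r plays the role of the equality case of Cauchy-Schwarz, without
    square roots. *)
Lemma ler_cdot r z w : 0 < r ->
  `|cdot z w| <= (r * sqnorm z + r^-1 * sqnorm w) / 2.
Proof.
move=> r0; have key (w' : R[i]) : cdot z w' <= (r * sqnorm z + r^-1 * sqnorm w') / 2.
  have : 0 <= r^-1 * sqnorm (r%:C * z - w').
    by rewrite mulr_ge0 ?sqnorm_ge0// invr_ge0 ltW.
  rewrite sqnormD sqnormN cdotNr cdotRl sqnormM sqnormR.
  rewrite (_ : r^-1 * _ = r * sqnorm z + r^-1 * sqnorm w' - 2 * cdot z w'); last first.
    by field; rewrite gt_eqF.
  lra.
rewrite ler_norml key andbT lerNl -cdotNr (le_trans (key _))// sqnormN//.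
Qed.

Lemma ler_cdot1 z w : `|cdot z w| <= (sqnorm z + sqnorm w) / 2.
Proof. by have := ler_cdot z w ltr01; rewrite invr1 !mul1r. Qed.

Lemma ler_sqnormD r z w : 0 < r ->
  sqnorm (z + w) <= (1 + r) * sqnorm z + (1 + r^-1) * sqnorm w.
Proof.
move=> r0; rewrite sqnormD; have := ler_cdot z w r0.
by rewrite ler_norml => /andP[_]; lra.
Qed.

Lemma ler_sqnormD2 z w : sqnorm (z + w) <= 2 * (sqnorm z + sqnorm w).
Proof. by have := ler_sqnormD z w ltr01; rewrite invr1; lra. Qed.

End complex_plane.

Section ell2_space.
Variables (R : realType) (T : choiceType).
Implicit Types (f g h : T -> R[i]) (c : R[i]) (r : R).

Lemma ell2P f : ell2 f <-> summ (fun x => sqnorm (f x)).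
Proof.
suff -> : summ (fun x => sqnorm (f x)) = ell2 f by [].
congr (is_true (_ < _)%E); apply: eq_esum => x _.
by rewrite ger0_norm// sqnorm_ge0.
Qed.

Lemma eq_ell2 f g : f =1 g -> ell2 f -> ell2 g.
Proof. by move=> /funext ->. Qed.

Lemma ell2_le f g r : ell2 g -> (forall x, sqnorm (f x) <= r * sqnorm (g x)) ->
  ell2 f.
Proof.
move=> /ell2P sg fg; apply/ell2P/(summ_le (summZ r sg)) => x.
rewrite ger0_norm ?sqnorm_ge0// (le_trans (fg x))// ler_norm//.
Qed.

Lemma ell2_0 : ell2 ((fun=> 0) : T -> R[i]).
Proof. by apply/ell2P/(eq_summ _ (summ0 _ _)) => x; rewrite sqnorm0. Qed.

Lemma ell2D f g : ell2 f -> ell2 g -> ell2 (fun x => f x + g x).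
Proof.
move=> /ell2P sf /ell2P sg; apply/ell2P/(summ_le (summZ 2 (summD sf sg))) => x.
rewrite !ger0_norm ?sqnorm_ge0 ?ler_sqnormD2//.
by rewrite mulr_ge0// addr_ge0// sqnorm_ge0.
Qed.

Lemma ell2Z c f : ell2 f -> ell2 (fun x => c * f x).
Proof. by move=> /ell2_le; apply => x; rewrite sqnormM. Qed.

Lemma ell2N f : ell2 f -> ell2 (fun x => - f x).
Proof. by move=> /ell2Z -/(_ (-1)); apply: eq_ell2 => x; rewrite mulN1r. Qed.

Lemma ell2B f g : ell2 f -> ell2 g -> ell2 (fun x => f x - g x).
Proof. by move=> lf lg; apply: ell2D => //; exact: ell2N. Qed.

Lemma ell2_sum (I : Type) (s : seq I) (F : I -> T -> R[i]) :
  (forall i, ell2 (F i)) -> ell2 (fun x => \sum_(i <- s) F i x).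
Proof.
move=> lF; elim: s => [|i s ih].
  by apply: eq_ell2 ell2_0 => x; rewrite big_nil.
by apply: eq_ell2 (ell2D (lF i) ih) => x; rewrite big_cons.
Qed.

Lemma summ_cdot f g : ell2 f -> ell2 g -> summ (fun x => cdot (f x) (g x)).
Proof.
move=> /ell2P sf /ell2P sg; apply: summ_le (summD sf sg) _ => x.
rewrite [leRHS]ger0_norm; last by rewrite addr_ge0// sqnorm_ge0.
apply: le_trans (ler_cdot1 _ _) _.
by have := sqnorm_ge0 (f x); have := sqnorm_ge0 (g x); lra.
Qed.

Definition rdot f g : R := tsum (fun x => cdot (f x) (g x)).

Lemma eq_rdot f f' g g' : f =1 f' -> g =1 g' -> rdot f g = rdot f' g'.
Proof. by move=> /funext -> /funext ->. Qed.

Lemma rdotC f g : rdot f g = rdot g f.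
Proof. by apply: eq_tsum => x; rewrite cdotC. Qed.

Lemma rdotDl f g h : ell2 f -> ell2 g -> ell2 h ->
  rdot (fun x => f x + g x) h = rdot f h + rdot g h.
Proof.
move=> lf lg lh; rewrite /rdot -tsumD; try exact: summ_cdot.
by apply: eq_tsum => x; rewrite cdotDl.
Qed.

Lemma rdotDr f g h : ell2 f -> ell2 g -> ell2 h ->
  rdot h (fun x => f x + g x) = rdot h f + rdot h g.
Proof. by move=> lf lg lh; rewrite rdotC rdotDl// !(rdotC h). Qed.

Lemma rdotNl f g : rdot (fun x => - f x) g = - rdot f g.
Proof. by rewrite -tsumN; apply: eq_tsum => x; rewrite cdotNl. Qed.

Lemma rdotNr f g : rdot f (fun x => - g x) = - rdot f g.
Proof. by rewrite rdotC rdotNl rdotC. Qed.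

Lemma rdotBl f g h : ell2 f -> ell2 g -> ell2 h ->
  rdot (fun x => f x - g x) h = rdot f h - rdot g h.
Proof. by move=> lf lg lh; rewrite rdotDl ?rdotNl//; exact: ell2N. Qed.

Lemma rdotBr f g h : ell2 f -> ell2 g -> ell2 h ->
  rdot h (fun x => f x - g x) = rdot h f - rdot h g.
Proof. by move=> lf lg lh; rewrite rdotDr ?rdotNr//; exact: ell2N. Qed.

Lemma rdotRl r f g : ell2 f -> ell2 g ->
  rdot (fun x => r%:C * f x) g = r * rdot f g.
Proof.
move=> lf lg; rewrite /rdot -tsumZ; last exact: summ_cdot.
by apply: eq_tsum => x; rewrite cdotRl.
Qed.

Lemma rdotRr r f g : ell2 f -> ell2 g ->
  rdot f (fun x => r%:C * g x) = r * rdot f g.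
Proof. by move=> lf lg; rewrite rdotC rdotRl// rdotC. Qed.

Lemma rdotMl c f g : rdot (fun x => c * f x) g = rdot f (fun x => c^* * g x).
Proof. by apply: eq_tsum => x; rewrite cdotMl. Qed.

Lemma rdot_suml (I : Type) (s : seq I) (F : I -> T -> R[i]) g :
  (forall i, ell2 (F i)) -> ell2 g ->
  rdot (fun x => \sum_(i <- s) F i x) g = \sum_(i <- s) rdot (F i) g.
Proof.
move=> lF lg; rewrite -tsum_sum; last by move=> i; exact: summ_cdot.
by apply: eq_tsum => x; rewrite cdot_suml.
Qed.

Lemma rdotff f : rdot f f = tsum (fun x => sqnorm (f x)).
Proof. by apply: eq_tsum => x; rewrite cdotzz. Qed.

Lemma rdot_ge0 f : 0 <= rdot f f.
Proof. by rewrite rdotff tsum_ge0// => x; exact: sqnorm_ge0. Qed.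

Lemma sqnorm_le_rdot f x : ell2 f -> sqnorm (f x) <= rdot f f.
Proof.
move=> /ell2P lf; rewrite rdotff.
by apply: (ge0_le_tsum x lf) => y; exact: sqnorm_ge0.
Qed.

Lemma rdot_eq0 f : ell2 f -> rdot f f = 0 -> forall x, f x = 0.
Proof.
move=> lf f0 x; apply: sqnorm_eq0; apply/eqP.
by rewrite eq_le sqnorm_ge0 andbT -f0 sqnorm_le_rdot.
Qed.

Lemma ler_rdot_weighted (r : R) (f g : T -> R[i]) : ell2 f -> ell2 g -> 0 < r ->
  2 * `|rdot f g| <= r * rdot f f + r^-1 * rdot g g.
Proof.
move=> lf lg r0; have /ell2P sf := lf; have /ell2P sg := lg.
have sr := summZ r sf; have si := summZ r^-1 sg.
rewrite !rdotff -(tsumZ r sf) -(tsumZ r^-1 sg) -tsumD// mulrC -ler_pdivlMr// mulrC.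
rewrite -tsumZ; last exact: summD.
apply: (le_trans (ler_norm_tsum (summ_cdot lf lg))).
apply: le_tsum; [exact/summ_abs/summ_cdot|exact/summZ/summD|move=> x].
by rewrite mulrC; exact: ler_cdot.
Qed.

Lemma ell2_sqnormE f : ell2 f -> ell2_sqnorm f = (rdot f f)%:E.
Proof.
move=> /ell2P lf; rewrite rdotff tsum_ge0E//; last by move=> x; exact: sqnorm_ge0.
by rewrite fineK// summ_fin_num// => x; exact: sqnorm_ge0.
Qed.

(** The complex inner product, linear on the left, recovered from the real one. *)
Definition hdot f g : R[i] := rdot f g +i* rdot f (fun x => 'i%C * g x).

Lemma hdot_suml (n : nat) (c : 'I_n -> R[i]) (F : 'I_n -> T -> R[i]) g :
  (forall i, ell2 (F i)) -> ell2 g ->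
  hdot (fun x => \sum_(i < n) c i * F i x) g = \sum_(i < n) c i * hdot (F i) g.
Proof.
move=> lF lg; have lig := ell2Z 'i%C lg.
have lcF i : ell2 (fun x => c i * F i x) by exact: ell2Z.
rewrite /hdot !rdot_suml//.
have E i : c i * hdot (F i) g = rdot (fun x => c i * F i x) g +i*
    rdot (fun x => c i * F i x) (fun x => 'i%C * g x).
  have dec (u : T -> R[i]) : ell2 u -> rdot (fun x => c i * F i x) u =
      complex.Re (c i) * rdot (F i) u + complex.Im (c i) * rdot (F i) (fun x => - 'i%C * u x).
    move=> lu; have s1 := summ_cdot (lF i) lu.
    have s2 := summ_cdot (lF i) (ell2Z (- 'i%C) lu).
    rewrite /rdot -!tsumZ// -tsumD; [|exact: summZ..].
    by apply: eq_tsum => x; case: (c i) (F i x) (u x) => [a b] [a' b'] [e d]; rewrite /cdot /=; ring.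
  rewrite !dec// /hdot.
  have -> : rdot (F i) (fun x => - 'i%C * g x) = - rdot (F i) (fun x => 'i%C * g x).
    by rewrite -rdotNr; apply: eq_rdot => // x; rewrite mulNr.
  have -> : rdot (F i) (fun x => - 'i%C * ('i%C * g x)) = rdot (F i) g.
    by apply: eq_rdot => // x; rewrite mulrA mulNr -expr2 sqr_i opprK mul1r.
  by case: (c i) => a b; apply/eqP; rewrite eq_complex /=; apply/andP; split; apply/eqP; ring.
under [RHS]eq_bigr do rewrite E.
elim: (index_enum _) => [|i s ih]; first by rewrite !big_nil.
by rewrite !big_cons -ih; apply/eqP; rewrite eq_complex /= !eqxx.
Qed.

Lemma hdot_eq0 f g : hdot f g = 0 <->
  rdot f g = 0 /\ rdot f (fun x => 'i%C * g x) = 0.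
Proof. by rewrite /hdot; split => [[-> ->]|[-> ->]]. Qed.

End ell2_space.

(** * Weak limits in the unit ball *)

Section weak_compactness.
Variables (R : realType) (T : choiceType).
Implicit Types (f g h : T -> R[i]).

(** A cluster point for pointwise convergence, which on bounded sets of square
    summable functions is weak convergence. *)
Definition weak_limit (S : nat -> set (T -> R[i])) (f : T -> R[i]) : Prop :=
  forall (n : nat) (K : seq T) (e : R), 0 < e ->
    exists2 g, S n g & forall x, x \in K -> sqnorm (g x - f x) <= e.

Lemma filter_all_seq (X : Type) (F : set_system X) (I : eqType) (P : I -> set X) :
  Filter F -> (forall i, F (P i)) -> forall K : seq I,
  F [set x | forall i, i \in K -> P i x].
Proof.
move=> FF FP; elim=> [|k K ih]; first by apply: filterS filterT => x _ i.
apply: filterS (filterI (FP k) ih) => x [Px Kx] i.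
by rewrite inE => /orP[/eqP->|/Kx].
Qed.

(** The coordinates of functions in the unit ball lie in a product of segments,
    compact by the theorem of Tychonoff; the required f is a cluster point of the
    filter generated by the decreasing sets S n. *)
Lemma weak_compact (S : nat -> set (T -> R[i])) :
  (forall n, S n !=set0) -> (forall m n, (m <= n)%N -> S n `<=` S m) ->
  (forall n f, S n f -> ell2 f /\ rdot f f <= 1) ->
  exists f, weak_limit S f.
Proof.
move=> S0 Sdec Sball.
pose coord f (i : T * bool) : R :=
  if i.2 then complex.Im (f i.1) else complex.Re (f i.1).
have Acomp := @tychonoff (T * bool)%type (fun=> R) (fun=> `[(-1 : R), 1]%classic)
  (fun=> @segment_compact R _ _).
pose F : set_system {ptws (T * bool) -> R} := filter_from setT (fun n => coord @` S n).
have FF : ProperFilter F.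
  apply: filter_from_proper; last by move=> n _; have [f Sf] := S0 n; exists (coord f), f.
  apply: filter_from_filter; first by exists 0%N.
  move=> m n _ _; exists (maxn m n) => // _ [f Sf <-].
  by split; exists f => //; apply: Sdec Sf; rewrite ?leq_maxl ?leq_maxr.
have FA : F [set f : forall i, R | forall i, `[(-1 : R), 1]%classic (f i)].
  exists 0%N => // _ [f /Sball[lf f1] <-] [x b] /=.
  have sx : sqnorm (f x) <= 1 by rewrite (le_trans (sqnorm_le_rdot x lf)).
  have : coord f (x, b) ^+ 2 <= 1.
    apply: le_trans sx; rewrite /coord /sqnorm /=.
    by case: b; rewrite ?lerDl ?lerDr sqr_ge0.
  by rewrite in_itv /= expr2 => h; apply/andP; split; nra.
have [phi [_ clphi]] := Acomp F FF FA.
exists (fun x => phi (x, false) +i* phi (x, true)) => n K e e0.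
pose d : R := Num.min 1 (e / 2).
have d0 : 0 < d by rewrite /d lt_min ltr01 divr_gt0.
pose B : set {ptws (T * bool) -> R} :=
  [set psi | forall x b, x \in K -> `|psi (x, b) - phi (x, b)| < d].
have nB : nbhs (phi : {ptws (T * bool) -> R}) B.
  have nb (i : T * bool) : nbhs (phi : {ptws (T * bool) -> R}) [set psi : {ptws (T * bool) -> R} | `|psi i - phi i| < d].
    have := @proj_continuous (T * bool)%type (fun=> R) i phi.
    move=> /(_ [set y | `|y - phi i| < d]); apply.
    apply/nbhs_ballP; exists d => //= y; rewrite /ball/= distrC//.
  have FB := filter_all_seq (nbhs_filter (phi : {ptws (T * bool) -> R})) nb [seq (k, b) | k <- K, b <- [:: false; true]].
  apply: (@filterS _ _ (nbhs_filter (phi : {ptws (T * bool) -> R})) _ _ _ FB) => psi h x b xK; apply: h.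
  by apply/allpairsP; exists (x, b); split=> //; case: b.
have Fn : F (coord @` S n) by exists n.
have [_ [[g Sg <-] Bg]] := clphi _ B Fn nB.
exists g => // x xK.
have bnd (u : R) : `|u| < d -> u ^+ 2 <= e / 2.
  have d1 : d <= 1 by rewrite /d ge_min lexx.
  have d2 : d <= e / 2 by rewrite /d ge_min lexx orbT.
  rewrite ltr_norml expr2 => /andP[u1 u2]; apply: le_trans d2.
  by case: (lerP 0 u) => u0; nra.
have := bnd _ (Bg x false xK); have := bnd _ (Bg x true xK).
by rewrite /coord /= /sqnorm; case: (g x) => u v /=; lra.
Qed.

End weak_compactness.

Section weak_limits.
Variables (R : realType) (T : choiceType).
Implicit Types (f g h : T -> R[i]) (q : T -> R) (K : seq T).

(** Vanishing at infinity: multiplication by such a q is a compact operator. *)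
Definition vanishing q : Prop :=
  forall e : R, 0 < e -> exists K, forall x, x \notin K -> `|q x| <= e.

Lemma vanishing_bounded q : vanishing q ->
  exists2 Q, 0 <= Q & forall x, `|q x| <= Q.
Proof.
move=> /(_ 1 ltr01)[K Kq]; exists (1 + \sum_(x <- undup K) `|q x|) => [|x].
  by rewrite addr_ge0// sumr_ge0.
have [xK|xK] := boolP (x \in K).
  rewrite (bigD1_seq x) ?undup_uniq ?mem_undup//=.
  by rewrite addrCA lerDl addr_ge0// sumr_ge0.
by rewrite (le_trans (Kq x xK))// lerDl sumr_ge0.
Qed.

(** Linear functionals are weakly continuous on the ball: outside a finite K the
    function g is small, inside K the difference of the arguments is. *)
Lemma weak_nbhd f g (e : R) : ell2 f -> rdot f f <= 1 -> ell2 g -> 0 < e ->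
  exists K, exists2 d : R, 0 < d & forall f', ell2 f' -> rdot f' f' <= 1 ->
    (forall x, x \in K -> sqnorm (f' x - f x) <= d) ->
    `|rdot g f' - rdot g f| <= e.
Proof.
move=> lf f1 lg e0.
have /ell2P sg := lg.
have /(_ (e ^+ 2 / 16))[|K uK tK] := tsum_tail sg (fun x => sqnorm_ge0 _).
  by rewrite divr_gt0// exprn_gt0.
(* The weighted inequality is used with weight r outside K, where g is small, and
   with weight s on K, where the arguments are close. *)
pose r : R := 8 / e; pose s : R := e / (2 * (rdot g g + 1)).
have Ng := rdot_ge0 g.
have r0 : 0 < r by rewrite divr_gt0.
have s0 : 0 < s by rewrite divr_gt0// mulr_gt0// ltr_wpDl.
pose d : R := e * s / (2 * ((size K)%:R + 1)).
have K0 : 0 < (size K)%:R + 1 :> R by rewrite ltr_wpDl.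
have d0 : 0 < d by apply: divr_gt0; apply: mulr_gt0.
exists K, d => // f' lf' f'1 close.
have lu : ell2 (fun x => f' x - f x) by exact: ell2B.
rewrite -rdotBr//.
have Nu : rdot (fun x => f' x - f x) (fun x => f' x - f x) <= 4.
  rewrite rdotff.
  have := @le_tsum _ _ (fun x => sqnorm (f' x - f x)) (fun x => 2 * (sqnorm (f' x) + sqnorm (f x))).
  move/ell2P : lf => sf; move/ell2P : lf' => sf'; move/ell2P : lu => su.
  move=> /(_ su (summZ 2 (summD sf' sf))) h.
  apply: le_trans (h _) _.
    by move=> x; rewrite -(sqnormN (f x)) ler_sqnormD2.
  by rewrite tsumZ; [rewrite tsumD// -!rdotff; lra|exact: summD].
apply: le_trans (ler_norm_tsum (summ_cdot lg lu)) _.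
have [sK tKE] := tsum_fin (fun=> d) uK.
have sgK : summ (fun x => if x \in K then 0 else sqnorm (g x)).
  apply: (summ_le sg) => x; case: ifP => _//.
  by rewrite normr0.
move/ell2P : (lu) => su.
pose M x := r / 2 * (if x \in K then 0 else sqnorm (g x)) +
  (r^-1 / 2 * sqnorm (f' x - f x) + (s / 2 * sqnorm (g x) +
   s^-1 / 2 * (if x \in K then d else 0))).
have ri0 : 0 <= r^-1 by rewrite invr_ge0 ltW.
have si0 : 0 <= s^-1 by rewrite invr_ge0 ltW.
apply: (@le_trans _ _ (tsum M)).
  apply: le_tsum.
  - by apply/summ_abs/summ_cdot.
  - by apply: summD; [exact: summZ|apply: summD; [exact: summZ|apply: summD; exact: summZ]].
  move=> x; have gx := sqnorm_ge0 (g x); have ux := sqnorm_ge0 (f' x - f x).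
  have h1 : 0 <= s * sqnorm (g x) by rewrite mulr_ge0// ltW.
  have h2 : 0 <= r^-1 * sqnorm (f' x - f x) by rewrite mulr_ge0.
  rewrite /M; case: ifPn => xK.
    have h3 : s^-1 * sqnorm (f' x - f x) <= s^-1 * d by rewrite ler_wpM2l// close.
    by have := ler_cdot (g x) (f' x - f x) s0; lra.
  by have := ler_cdot (g x) (f' x - f x) r0; lra.
rewrite /M tsumD; [|exact: summZ|apply: summD; [exact: summZ|apply: summD; exact: summZ]].
rewrite tsumD; [|exact: summZ|apply: summD; exact: summZ].
rewrite tsumD; [|exact: summZ|exact: summZ].
rewrite !tsumZ// tKE -!rdotff big_const_seq count_predT iter_addr_0 -(mulr_natr d).
have -> : e = r / 2 * (e ^+ 2 / 16) + (r^-1 / 2 * 4 + (e / 4 + e / 4)).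
  by rewrite /r; field; rewrite gt_eqF.
apply: lerD; first by rewrite ler_wpM2l ?ltW// divr_gt0.
apply: lerD; first by rewrite ler_wpM2l// divr_ge0.
apply: lerD.
  rewrite /s; apply: (@le_trans _ _ (e / (2 * (rdot g g + 1)) / 2 * (rdot g g + 1))).
    by rewrite ler_wpM2l ?lerDl// ltW// divr_gt0.
  rewrite le_eqVlt; apply/orP; left; apply/eqP; field.
  by rewrite gt_eqF// ltr_wpDl.
apply: (@le_trans _ _ (s^-1 / 2 * (d * ((size K)%:R + 1)))).
  by rewrite ler_wpM2l// ?divr_ge0// ler_wpM2l ?(ltW d0)// lerDl.
by rewrite /d le_eqVlt; apply/orP; left; apply/eqP; field; rewrite !gt_eqF.
Qed.

(** Outside a finite set q is small while the sum of the squares is at most 1; on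
    that set the arguments are close. *)
Lemma weak_nbhd_potential f q (e : R) : ell2 f -> vanishing q ->
    (forall x, 0 <= q x) -> 0 < e ->
  exists K, exists2 d : R, 0 < d & forall f', ell2 f' -> rdot f' f' <= 1 ->
    (forall x, x \in K -> sqnorm (f' x - f x) <= d) ->
    tsum (fun x => q x * sqnorm (f' x)) <= tsum (fun x => q x * sqnorm (f x)) + e.
Proof.
move=> lf vq q0 e0; have [Q Q0 qQ] := vanishing_bounded vq.
have qQ' x : q x <= Q by rewrite -(ger0_norm (q0 x)).
have e30 : 0 < e / 3 by rewrite divr_gt0.
have [K' Kq] := vq _ e30; pose K := undup K'.
have {}Kq x : x \notin K -> q x <= e / 3.
  by rewrite mem_undup => /Kq; rewrite ger0_norm.
have sq (h : T -> R[i]) : ell2 h -> summ (fun x => q x * sqnorm (h x)).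
  move=> /ell2P sh; apply: (summ_le (summZ Q sh)) => x.
  rewrite !ger0_norm ?mulr_ge0 ?sqnorm_ge0//.
  by rewrite ler_wpM2r ?sqnorm_ge0.
set P := tsum (fun x => q x * sqnorm (f x)).
have P0 : 0 <= P by apply: tsum_ge0 => x; rewrite mulr_ge0 ?sqnorm_ge0.
have Pp : 0 < P + 1 by rewrite ltr_wpDl.
pose r : R := e / (3 * (P + 1)).
have r0 : 0 < r by rewrite divr_gt0// mulr_gt0.
pose A : R := \sum_(x <- K) q x.
have A0 : 0 <= A by apply: sumr_ge0.
have Ap : 0 < A + 1 by rewrite ltr_wpDl.
have rp : 0 < 1 + r^-1 by rewrite addr_gt0// invr_gt0.
pose d : R := e / (3 * (1 + r^-1) * (A + 1)).
have d0 : 0 < d by apply: divr_gt0 => //; apply: mulr_gt0 => //; apply: mulr_gt0.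
exists K, d => // f' lf' f'1 close.
have [sK tKE] := tsum_fin q (undup_uniq K').
move/ell2P : (lf') => sf'.
pose M x := e / 3 * sqnorm (f' x) + ((1 + r) * (q x * sqnorm (f x)) +
   (1 + r^-1) * d * (if x \in K then q x else 0)).
apply: (@le_trans _ _ (tsum M)).
  apply: le_tsum; first exact: sq.
    by apply: summD; [exact: summZ|apply: summD; apply: summZ => //; exact: sq].
  move=> x; rewrite /M; have [xK|xK] := boolP (x \in K).
    have h1 : 0 <= e / 3 * sqnorm (f' x) by rewrite mulr_ge0 ?sqnorm_ge0 ?ltW.
    have := ler_sqnormD (f x) (f' x - f x) r0; rewrite addrC subrK => h2.
    have h3 : (1 + r^-1) * sqnorm (f' x - f x) <= (1 + r^-1) * d.
      by rewrite ler_wpM2l ?(ltW rp)// close.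
    have h4 : sqnorm (f' x) <= (1 + r) * sqnorm (f x) + (1 + r^-1) * d by lra.
    have := ler_wpM2l (q0 x) h4; lra.
  rewrite mulr0 addr0; apply: (@le_trans _ _ (e / 3 * sqnorm (f' x))).
    by rewrite ler_wpM2r ?sqnorm_ge0// Kq.
  by rewrite lerDl mulr_ge0 ?mulr_ge0 ?sqnorm_ge0// addr_ge0// ltW.
rewrite /M tsumD; [|exact: summZ|apply: summD; apply: summZ => //; exact: sq].
rewrite tsumD; [|apply: summZ; exact: sq|exact: summZ].
rewrite !tsumZ//; [|exact: sq]; rewrite tKE -/P -/A -rdotff.
have h1 : e / 3 * rdot f' f' <= e / 3 by rewrite -[leRHS]mulr1 ler_wpM2l// ltW.
have h2 : r * P <= e / 3.
  apply: (@le_trans _ _ (r * (P + 1))); first by rewrite ler_wpM2l ?lerDl// ltW.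
  by rewrite /r le_eqVlt; apply/orP; left; apply/eqP; field; rewrite gt_eqF.
have h3 : (1 + r^-1) * d * A <= e / 3.
  apply: (@le_trans _ _ ((1 + r^-1) * d * (A + 1))).
    by rewrite ler_wpM2l ?lerDl// mulr_ge0// ltW.
  rewrite /d le_eqVlt; apply/orP; left; apply/eqP; field.
  rewrite !gt_eqF//=; move: rp; rewrite -(ltr_pM2r r0) mul0r mulrDl mul1r mulVf ?gt_eqF//.
by rewrite mulrDl mul1r; lra.
Qed.

(** Finite partial sums pass to the limit. *)
Lemma weak_limit_ball (S : nat -> set (T -> R[i])) f :
  (forall n f, S n f -> ell2 f /\ rdot f f <= 1) -> weak_limit S f ->
  ell2 f /\ rdot f f <= 1.
Proof.
move=> Sball wf.
have fin (K : seq T) : uniq K -> \sum_(x <- K) sqnorm (f x) <= 1.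
  move=> uK; apply/ler_addgt0Pr => e e0.
  pose r : R := e / 2; have r0 : 0 < r by rewrite divr_gt0.
  pose k : R := (size K)%:R + 1; have k0 : 0 < k by rewrite ltr_wpDl.
  have rp : 0 < 1 + r^-1 by rewrite addr_gt0// invr_gt0.
  pose d : R := e / 2 / ((1 + r^-1) * k).
  have d0 : 0 < d by apply: divr_gt0; [exact: divr_gt0|exact: mulr_gt0].
  have [g Sg close] := wf 0%N K _ d0; have [lg g1] := Sball _ _ Sg.
  have h : \sum_(x <- K) sqnorm (f x) <= \sum_(x <- K) ((1 + r) * sqnorm (g x) + (1 + r^-1) * d).
    rewrite big_seq [leRHS]big_seq; apply: ler_sum => x xK.
    have := ler_sqnormD (g x) (f x - g x) r0; rewrite addrC subrK => /le_trans; apply.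
    by rewrite lerD2l ler_wpM2l ?(ltW rp)// -sqnormN opprB close.
  apply: (le_trans h); rewrite big_split /= -mulr_sumr big_const_seq count_predT iter_addr_0 -[X in _ + X <= _]mulr_natr.
  have h1 : \sum_(x <- K) sqnorm (g x) <= 1.
    apply: le_trans g1; rewrite rdotff sum_le_tsum//; first exact/ell2P.
    by move=> x; exact: sqnorm_ge0.
  have h2 : (1 + r) * (\sum_(x <- K) sqnorm (g x)) <= 1 + r.
    by rewrite -[leRHS]mulr1 ler_wpM2l// addr_ge0// ltW.
  have h3 : (1 + r^-1) * d * (size K)%:R <= e / 2.
    apply: (@le_trans _ _ ((1 + r^-1) * d * k)).
      by rewrite ler_wpM2l ?lerDl// mulr_ge0// ltW.
    rewrite /d le_eqVlt; apply/orP; left; apply/eqP; field.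
    by rewrite !gt_eqF//=; move: rp; rewrite -(ltr_pM2r r0) mul0r mulrDl mul1r mulVf ?gt_eqF.
  have rE : r = e / 2 by [].
  lra.
have sf := summ_bounded (fun x => sqnorm_ge0 (f x)) fin.
split; first exact/ell2P.
by rewrite rdotff tsum_le// => x; exact: sqnorm_ge0.
Qed.

End weak_limits.

(** * Bound states of a nonnegative form with a vanishing potential *)

Section symmetric_operators.
Variables (R : realType) (T : choiceType).
Implicit Types (f g : T -> R[i]) (q : T -> R).

Record symmetric_operator (H : (T -> R[i]) -> T -> R[i]) : Prop := {
  op_linear : forall (c : R[i]) f g x,
    H (fun y => c * f y + g y) x = c * H f x + H g x;
  op_ell2 : forall f, ell2 f -> ell2 (H f);
  op_sym : forall f g, ell2 f -> ell2 g -> rdot (H f) g = rdot f (H g) }.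

Definition sub_potential (H : (T -> R[i]) -> T -> R[i]) q f x : R[i] :=
  H f x - (q x)%:C * f x.

Section operator.
Variable H : (T -> R[i]) -> T -> R[i].
Hypothesis opH : symmetric_operator H.

Lemma op0 x : H (fun=> 0) x = 0.
Proof.
have := op_linear opH 1 (fun=> 0) (fun=> 0) x.
rewrite (_ : (fun y : T => 1 * 0 + 0) = fun=> (0 : R[i])).
  by rewrite mul1r => /eqP; rewrite -subr_eq subrr eq_sym => /eqP.
by apply/funext => y; rewrite mulr0 addr0.
Qed.

Lemma opZ (c : R[i]) f x : H (fun y => c * f y) x = c * H f x.
Proof.
have := op_linear opH c f (fun=> 0) x; rewrite op0 addr0 => <-.
by congr H; apply/funext => y; rewrite addr0.
Qed.

Lemma opD f g x : H (fun y => f y + g y) x = H f x + H g x.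
Proof.
have := op_linear opH 1 f g x; rewrite mul1r => <-.
by congr H; apply/funext => y; rewrite mul1r.
Qed.

Lemma sub_potential_operator q (Q : R) : (forall x, `|q x| <= Q) ->
  symmetric_operator (sub_potential H q).
Proof.
move=> qQ.
have lq f : ell2 f -> ell2 (fun x => (q x)%:C * f x).
  move=> lf; apply: (@ell2_le _ _ _ f (Q ^+ 2)) => // x.
  rewrite sqnormM sqnormR ler_wpM2r ?sqnorm_ge0//.
  have := qQ x; rewrite ler_norml !expr2 => /andP[h1 h2].
  by case: (lerP 0 (q x)) => q0; nra.
split.
- by move=> c f g x; rewrite /sub_potential op_linear//; ring.
- by move=> f lf; apply: ell2B; [exact: op_ell2|exact: lq].
- move=> f g lf lg; rewrite rdotBl//; [|exact: op_ell2|exact: lq].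
  rewrite rdotBr//; [|exact: op_ell2|exact: lq].
  rewrite op_sym//; congr (_ - _); apply: eq_tsum => x.
  by rewrite cdotRl cdotRr.
Qed.

Lemma formD f g (t : R) : ell2 f -> ell2 g ->
  rdot (H (fun x => f x + t%:C * g x)) (fun x => f x + t%:C * g x) =
  rdot (H f) f + 2 * t * rdot (H f) g + t ^+ 2 * rdot (H g) g.
Proof.
move=> lf lg; have lHf := op_ell2 opH lf; have lHg := op_ell2 opH lg.
have ltg := ell2Z t%:C lg; have ltHg := ell2Z t%:C lHg.
have -> : H (fun x => f x + t%:C * g x) = fun x => H f x + t%:C * H g x.
  by apply/funext => x; rewrite opD opZ.
rewrite rdotDl//; last exact: ell2D.
rewrite !rdotDr// !rdotRl// !rdotRr// (op_sym opH lg lf) (rdotC g); ring.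
Qed.

(** The form is nonnegative along the line f + t g and vanishes at t = 0, so its
    derivative there is zero. *)
Lemma form_critical f g : ell2 f -> ell2 g -> rdot (H f) f = 0 ->
  (forall t : R, 0 <= rdot (H (fun x => f x + t%:C * g x)) (fun x => f x + t%:C * g x)) ->
  rdot (H f) g = 0.
Proof.
move=> lf lg f0 Hge0.
set a := rdot (H f) g; set b := rdot (H g) g.
have key t : 0 <= 2 * t * a + t ^+ 2 * b.
  by have := Hge0 t; rewrite formD// f0 add0r.
apply/eqP; apply: contraT => a0.
have b1 : 0 < `|b| + 1 by rewrite ltr_wpDl.
have := key (- a / (`|b| + 1)).
rewrite (_ : _ + _ = a ^+ 2 / (`|b| + 1) ^+ 2 * (b - 2 * (`|b| + 1))); last first.
  by field; rewrite gt_eqF.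
rewrite leNgt pmulr_rlt0; last first.
  by apply: divr_gt0; [rewrite exprn_even_gt0|exact: exprn_gt0].
by have := ler_norm b; have := normr_ge0 b; lra.
Qed.

End operator.
End symmetric_operators.

Section bound_states.
Variables (R : realType) (T : choiceType).
Variables (H : (T -> R[i]) -> T -> R[i]) (q : T -> R).
Hypotheses (opH : symmetric_operator H).
Hypothesis H_ge0 : forall f, ell2 f -> 0 <= rdot (H f) f.
Hypotheses (vq : vanishing q) (q0 : forall x, 0 <= q x).
Implicit Types (f g : T -> R[i]).
Let A := sub_potential H q.

Lemma sub_potential_sym : symmetric_operator A.
Proof. by have [Q Q0 qQ] := vanishing_bounded vq; exact: (@sub_potential_operator _ _ _ opH _ Q). Qed.

Lemma form_sub_potential f : ell2 f ->
  summ (fun x => q x * sqnorm (f x)) /\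
  rdot (A f) f = rdot (H f) f - tsum (fun x => q x * sqnorm (f x)).
Proof.
move=> lf; have [Q Q0 qQ] := vanishing_bounded vq.
have sq : summ (fun x => q x * sqnorm (f x)).
  move/ell2P : lf => sf; apply: (summ_le (summZ Q sf)) => x.
  rewrite !normrM ler_wpM2r// ger0_norm// (le_trans _ (ler_norm _))//.
  by rewrite -(ger0_norm (q0 x)).
split=> //; rewrite /rdot -tsumB//; last by apply: summ_cdot => //; exact: op_ell2.
by apply: eq_tsum => x; rewrite /A /sub_potential cdotDl cdotNl cdotRl cdotzz.
Qed.

(** From the form of H at g - f being nonnegative, (H g, g) >= 2 (H f, g) - (H f,
    f), and the right-hand side is weakly continuous in g; so is the form of q. *)
Lemma form_weak_lsc (S : nat -> set (T -> R[i])) f (n : nat) (e : R) :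
  (forall n f, S n f -> ell2 f /\ rdot f f <= 1) -> weak_limit S f -> 0 < e ->
  exists2 g, S n g & rdot (A f) f <= rdot (A g) g + e.
Proof.
move=> Sball wf e0; have [lf f1] := weak_limit_ball Sball wf.
have lHf := op_ell2 opH lf; have e40 : 0 < e / 4 by rewrite divr_gt0.
have e20 : 0 < e / 2 by rewrite divr_gt0.
have [K1 [d1 d10 near1]] := weak_nbhd lf f1 lHf e40.
have [K2 [d2 d20 near2]] := weak_nbhd_potential lf vq q0 e20.
have dm : 0 < Num.min d1 d2 by rewrite lt_min d10.
have [g Sg close] := wf n (K1 ++ K2) _ dm; have [lg g1] := Sball _ _ Sg.
exists g => //.
have [_ ->] := form_sub_potential lf; have [_ ->] := form_sub_potential lg.
have n1 : `|rdot (H f) g - rdot (H f) f| <= e / 4.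
  apply: near1 => // x xK; have := close x; rewrite mem_cat xK => /(_ isT) h.
  by rewrite (le_trans h)// ge_min lexx.
have n2 : tsum (fun x => q x * sqnorm (g x)) <= tsum (fun x => q x * sqnorm (f x)) + e / 2.
  apply: near2 => // x xK; have := close x; rewrite mem_cat xK orbT => /(_ isT) h.
  by rewrite (le_trans h)// ge_min lexx orbT.
have := H_ge0 (ell2D lg (ell2Z (-1)%:C lf)); rewrite formD// => h.
have e1 : rdot (H g) f = rdot (H f) g by rewrite op_sym// rdotC.
move: n1 h; rewrite ler_norml e1 => /andP[h1 h2]; lra.
Qed.

(** The infimum of the form over the unit ball of W is attained by weak compactness.
    The family G stands for the eigenfunctions already found. *)
Lemma exists_bound_state (I : Type) (G : I -> T -> R[i]) :
  let W f := ell2 f /\ forall i, rdot (G i) f = 0 in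
  (forall i, ell2 (G i)) -> (forall f, W f -> W (A f)) ->
  (exists2 f, W f & rdot (A f) f < 0) ->
  exists f, exists mu : R, [/\ W f, mu < 0, rdot f f = 1 &
    forall x, A f x = mu%:C * f x].
Proof.
move=> W lG AW [phi Wphi phi0].
have opA := sub_potential_sym.
have WZ (t : R) f : W f -> W (fun x => t%:C * f x).
  move=> [lf Gf]; split; first exact: ell2Z.
  by move=> i; rewrite rdotRr// Gf mulr0.
have WD f g : W f -> W g -> W (fun x => f x + g x).
  move=> [lf Gf] [lg Gg]; split; first exact: ell2D.
  by move=> i; rewrite rdotDr// Gf Gg addr0.
have formZ (t : R) f : ell2 f -> rdot (A (fun x => t%:C * f x)) (fun x => t%:C * f x) =
    t ^+ 2 * rdot (A f) f.
  move=> lf; have lAf := op_ell2 opA lf.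
  have -> : A (fun x => t%:C * f x) = fun x => t%:C * A f x.
    by apply/funext => x; rewrite opZ.
  by rewrite rdotRl ?rdotRr// ?expr2 ?mulrA//; exact: ell2Z.
have normZ (t : R) f : ell2 f -> rdot (fun x => t%:C * f x) (fun x => t%:C * f x) =
    t ^+ 2 * rdot f f.
  by move=> lf; rewrite rdotRl ?rdotRr// ?expr2 ?mulrA//; exact: ell2Z.
pose ball f := W f /\ rdot f f <= 1.
pose E : set R := [set rdot (A f) f | f in ball].
have [Q Q0 qQ] := vanishing_bounded vq.
have E_lb : lbound E (- Q).
  move=> _ [f [[lf _] f1] <-]; have [sq ->] := form_sub_potential lf.
  have : tsum (fun x => q x * sqnorm (f x)) <= Q * rdot f f.
    move/ell2P : (lf) => sf; rewrite rdotff -tsumZ//; apply: le_tsum => //.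
      exact: summZ.
    by move=> x; rewrite ler_wpM2r ?sqnorm_ge0// -(ger0_norm (q0 x)).
  have := H_ge0 lf; have := rdot_ge0 f; nra.
have [psi Wpsi psi0] : exists2 f, ball f & rdot (A f) f < 0.
  have lphi := Wphi.1; have N0 := rdot_ge0 phi.
  have N1 : 0 < 1 + rdot phi phi by rewrite ltr_wpDr.
  exists (fun x => (1 + rdot phi phi)^-1%:C * phi x); last first.
    by rewrite formZ// pmulr_rlt0// exprn_gt0// invr_gt0.
  split; first exact: WZ.
  rewrite normZ// exprVn ler_pdivrMl ?exprn_gt0// mulr1 expr2; nra.

pose mu := inf E.
have Ene : E !=set0 by exists (rdot (A psi) psi), psi.
have Einf : has_inf E by split=> //; exists (- Q).
have mu_lb f : ball f -> mu <= rdot (A f) f.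
  by move=> bf; apply: ge_inf; [case: Einf|exists f].
have mu0 : mu < 0 by apply: le_lt_trans psi0; exact: mu_lb.
pose S n := [set f | ball f /\ rdot (A f) f < mu + n.+1%:R^-1].
have Sball n f : S n f -> ell2 f /\ rdot f f <= 1 by move=> [[[lf _] f1] _].
have [||f wf] := @weak_compact _ _ S _ _ Sball.
- move=> n; have n0 : 0 < n.+1%:R^-1 :> R by rewrite invr_gt0.
  have [_ [f bf <-] fmu] := inf_adherent n0 Einf.
  by exists f.
- move=> m n mn f [bf fmu]; split=> //; apply: lt_le_trans fmu _.
  by rewrite lerD2l lef_pV2 ?posrE// ler_nat.
have [lf f1] := weak_limit_ball Sball wf.
have Wf : W f.
  split=> // i; apply/eqP; rewrite -normr_eq0 eq_le normr_ge0 andbT.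
  apply/ler_addgt0Pr => e e0; rewrite add0r.
  have [K [d d0 near]] := weak_nbhd lf f1 (lG i) e0.
  have [g Sg close] := wf 0%N K _ d0; have [[[lg Gg] g1] _] := Sg.
  by have := near g lg g1 close; rewrite Gg sub0r normrN.
have Ef : rdot (A f) f = mu.
  apply/eqP; rewrite eq_le mu_lb// andbT; apply/ler_addgt0Pr => e e0.
  have e20 : 0 < e / 2 by rewrite divr_gt0.
  have [n nE] : exists n : nat, n.+1%:R^-1 < e / 2.
    exists (Num.truncn (e / 2)^-1); rewrite invf_plt ?posrE//.
    have p : 0 <= (e / 2)^-1 by rewrite invr_ge0 ltW.
    by have /andP[] := truncn_itv p.
  have [g [_ Sg] h] := form_weak_lsc n Sball wf e20.
  move: nE Sg; rewrite -/A; set z := n.+1%:R^-1 => nE Sg. lra.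
have mu_form g : W g -> mu * rdot g g <= rdot (A g) g.
  move=> Wg; have [lg _] := Wg; have [g0|g0] := eqVneq (rdot g g) 0.
    have gE : g = fun=> 0 by apply/funext; exact: rdot_eq0.
    rewrite g0 mulr0 gE (eq_rdot (op0 opA) (fun=> erefl)) /rdot.
    by rewrite tsum_ge0// => x; rewrite cdot0l.
  have gp : 0 < rdot g g by rewrite lt_neqAle eq_sym g0 rdot_ge0.
  pose t := (Num.sqrt (rdot g g))^-1.
  have tE : t ^+ 2 = (rdot g g)^-1 by rewrite exprVn sqr_sqrtr// ltW.
  have := mu_lb (fun x => t%:C * g x); rewrite formZ// tE ler_pdivlMl// mulrC.
  by apply; split; [exact: WZ|rewrite normZ// tE mulVf].
(* A negative minimum is attained on the sphere, since the form scales
   quadratically. *)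
have f1E : rdot f f = 1.
  apply/eqP; rewrite eq_le f1; have := mu_form f Wf; rewrite Ef; nra.
exists f, mu; split=> //.
(* The form of B = A - mu is nonnegative on W and vanishes at f; as B f lies in W,
   criticality of f makes B f orthogonal to itself. *)
pose B := sub_potential A (fun=> mu).
have opB : symmetric_operator B.
  by apply: (@sub_potential_operator _ _ _ opA _ `|mu|).
have lAf := op_ell2 opA lf; have lBf := op_ell2 opB lf.
have formB g : ell2 g -> rdot (B g) g = rdot (A g) g - mu * rdot g g.
  move=> lg; rewrite /B /sub_potential rdotBl ?rdotRl//; last exact: ell2Z.
  exact: op_ell2.
have WB : W (B f).
  have [_ GAf] := AW f Wf; split=> // i; rewrite /B /sub_potential rdotBr//; last exact: ell2Z.
  by rewrite GAf rdotRr// Wf.2 mulr0 subrr.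
have crit : rdot (B f) (B f) = 0.
  apply: (form_critical opB lf lBf); first by rewrite formB// Ef f1E mulr1 subrr.
  move=> t; rewrite formB; last by apply: ell2D => //; exact: ell2Z.
  by rewrite subr_ge0 mu_form//; apply: WD => //; exact: WZ.
by move=> x; have /eqP := rdot_eq0 lBf crit x; rewrite subr_eq0 => /eqP.
Qed.

End bound_states.

Section counting_bound_states.
Variables (R : realType) (T : choiceType).
Implicit Types (f g : T -> R[i]).

Lemma rdot_i f : rdot f (fun x => 'i%C * f x) = 0.
Proof.
rewrite /rdot -[RHS](tsum0 R T); apply: eq_tsum => x.
by case: (f x) => a b; rewrite /cdot /=; ring.
Qed.

Lemma hdotff f : hdot f f = (rdot f f)%:C.
Proof. by rewrite /hdot rdot_i. Qed.

Lemma hdot_orthoC f g : hdot f g = 0 -> hdot g f = 0.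
Proof.
move=> /hdot_eq0[fg fig]; apply/hdot_eq0; rewrite rdotC; split=> //.
rewrite rdotC rdotMl.
rewrite (_ : (fun x => 'i%C^* * g x) = fun x => - ('i%C * g x)) ?rdotNr ?fig ?oppr0//.
apply/funext => x; rewrite -mulNr; congr (_ * _).
by apply/eqP; rewrite eq_complex /= oppr0 !eqxx.
Qed.

(** The n by k matrix of inner products has a nonzero left kernel. *)
Lemma exists_orthogonal (n k : nat) (phi : 'I_n -> T -> R[i])
    (psi : 'I_k -> T -> R[i]) : (k < n)%N ->
  (forall i, ell2 (phi i)) -> (forall j, ell2 (psi j)) ->
  exists2 c : 'I_n -> R[i], (exists i, c i != 0) &
    forall j, hdot (fun x => \sum_(i < n) c i * phi i x) (psi j) = 0.
Proof.
move=> kn lphi lpsi; pose M := \matrix_(i < n, j < k) hdot (phi i) (psi j).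
have : kermx M != 0.
  by rewrite -mxrank_eq0 mxrank_ker subn_eq0 -ltnNge (leq_ltn_trans (rank_leq_col _)).
move=> /rowV0Pn[v /sub_kermxP vM v0].
exists (fun i => v 0 i).
  by apply/existsP; apply: contraNT v0 => /existsPn v0; apply/eqP/rowP => i;
    rewrite mxE; apply/eqP; have := v0 i; rewrite negbK.
move=> j; rewrite hdot_suml//.
have : (v *m M) 0 j = 0 by rewrite vM mxE.
rewrite mxE => h; rewrite -[RHS]h; apply: eq_bigr => i _. by rewrite mxE.
Qed.

(** The variational principle for negative eigenvalues. With k < n eigenfunctions
    found, the negative space of dimension n contains a vector orthogonal to them,
    so the form is still negative somewhere on their orthogonal complement, which
    the operator preserves. *)
Lemma count_bound_states (H : (T -> R[i]) -> T -> R[i]) (q : T -> R) (n : nat)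
    (phi : 'I_n -> T -> R[i]) :
  symmetric_operator H -> (forall f, ell2 f -> 0 <= rdot (H f) f) ->
  vanishing q -> (forall x, 0 <= q x) -> (forall i, ell2 (phi i)) ->
  (forall c : 'I_n -> R[i], (exists i, c i != 0) ->
    let f x := \sum_(i < n) c i * phi i x in rdot (sub_potential H q f) f < 0) ->
  exists (e : nat -> T -> R[i]) (l : nat -> R), forall i, (i < n)%N ->
    [/\ ell2 (e i), l i < 0, rdot (e i) (e i) = 1,
        forall j, (j < i)%N -> hdot (e i) (e j) = 0 &
        forall x, sub_potential H q (e i) x = (l i)%:C * e i x].
Proof.
move=> opH H_ge0 vq q0 lphi neg.
have opA := sub_potential_sym opH vq; set A := sub_potential H q in opA *.
suff : forall k, (k <= n)%N -> exists (e : nat -> T -> R[i]) (l : nat -> R),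
  forall i, (i < k)%N ->
    [/\ ell2 (e i), l i < 0, rdot (e i) (e i) = 1,
        forall j, (j < i)%N -> hdot (e i) (e j) = 0 &
        forall x, A (e i) x = (l i)%:C * e i x] by exact.
elim=> [_|k ih kn]; first by exists (fun=> fun=> 0), (fun=> 0).
have [e [l el]] := ih (ltnW kn).
have le (i : 'I_k) : ell2 (e i) by have [] := el i (ltn_ord i).
have [c c0 orth] := exists_orthogonal (psi := fun i : 'I_k => e i) kn lphi le.
(* Orthogonality to e i and to its multiple by the imaginary unit, for the real
   inner product, is orthogonality for the complex one. *)
pose G (i : 'I_k * bool) x : R[i] := if i.2 then 'i%C * e i.1 x else e i.1 x.
have lG i : ell2 (G i).
  by case: i => i [] /=; [exact: ell2Z|exact: le].
have AG i x : A (G i) x = (l i.1)%:C * G i x.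
  have [_ _ _ _ Ae] := el i.1 (ltn_ord i.1).
  case: i Ae => i [] /= Ae; last exact: Ae.
  have := opZ opA 'i%C (e i) x; rewrite Ae mulrCA => <-.
  by [].
have GAf f i : ell2 f -> rdot (G i) (A f) = l i.1 * rdot (G i) f.
  move=> lf; rewrite -(op_sym opA)// -rdotRl//.
  by apply: eq_rdot => // x; rewrite AG.
have [|||f [mu [[lf Gf] mu0 f1 Af]]] := exists_bound_state opH H_ge0 vq q0 (G := G).
- exact: lG.
- by move=> f [lf Gf]; split; [exact: (op_ell2 opA)|move=> i; rewrite GAf// Gf mulr0].
- exists (fun x => \sum_(i < n) c i * phi i x); last exact: neg.
  split; first by apply: ell2_sum => i; exact: ell2Z.
  by case=> i b; have /hdot_eq0[h1 h2] := orth i; rewrite rdotC; case: b.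
exists (fun i => if (i < k)%N then e i else f), (fun i => if (i < k)%N then l i else mu).
move=> i; rewrite ltnS leq_eqVlt => /orP[/eqP->|ik].
  rewrite ltnn; split=> // j jk; rewrite jk; apply/hdot_eq0; split.
    by have := Gf (Ordinal jk, false); rewrite rdotC.
  by have := Gf (Ordinal jk, true); rewrite rdotC.
rewrite ik; have [h1 h2 h3 h4 h5] := el i ik; split=> // j ji.
by rewrite (ltn_trans ji ik) h4.
Qed.

End counting_bound_states.

(** * Counting eigenvalues *)

Section eigenvalue_counts.
Variables (R : realType) (T : Type).
Variables (Z : set (T -> R[i])) (Op : (T -> R[i]) -> (T -> R[i]) -> Prop).
Implicit Types (A : set R) (l : R).

Lemma card_le_dim_mod (E : set (T -> R[i])) (I : finType) (P : pred I)
    (e : I -> T -> R[i]) :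
  (forall i, P i -> E (e i)) ->
  (forall c : I -> R[i], Z (fun z => \sum_(i | P i) c i * e i z) ->
     forall i, P i -> c i = 0) ->
  ((#|P|%:R)%:E <= dim_mod Z E)%E.
Proof.
move=> Ee indep; apply: ereal_sup_ubound; exists #|P| => //.
exists (fun k => e (enum_val k)); split=> [k|c Zc k].
  by apply: Ee; have := enum_valP k.
have Pk := enum_valP k.
pose c' i := if insub i is Some u then c (enum_rank_in Pk (val (u : {i | P i}))) else 0.
have cE j : c' (enum_val j) = c j.
  rewrite /c'; case: insubP => [u _ uE|]; last by have := enum_valP j; rewrite unfold_in => ->.
  by rewrite uE enum_valK_in.
rewrite -cE; apply: (indep c'); last exact: Pk.
congr (Z _): Zc; apply/funext => z.
transitivity (\sum_(i in P) c' i * e i z); last exact: eq_bigl.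
by rewrite [RHS]big_enum_val; apply: eq_bigr => j _; rewrite cE.
Qed.

Lemma card_le_num_eigenvalues A (I : finType) (l : I -> R) (e : I -> T -> R[i]) :
  (forall i, A (l i)) -> (forall i, Defs.eigenspace Op (l i) (e i)) ->
  (forall c : I -> R[i], Z (fun z => \sum_i c i * e i z) -> forall i, c i = 0) ->
  ((#|I|%:R)%:E <= num_eigenvalues Z Op A)%E.
Proof.
move=> Al el indep; pose s := undup [seq l i | i : I].
apply: esum_ge; exists [set` s].
  by split; [exact: finite_seq|move=> x /=; rewrite mem_undup => /mapP[i _ ->]].
rewrite -fsbig_seq ?undup_uniq//=.
have -> : (#|I|%:R)%:E = (\sum_(x <- s) (#|[pred i | l i == x]|%:R)%:E)%E :> \bar R.
  rewrite sumEFin -natr_sum; congr (_%:R%:E).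
  rewrite -sum1_card (eq_bigr (fun i => \sum_(x <- s | l i == x) 1)%N); last first.
    move=> i _; rewrite -big_filter sum1_size size_filter /= (eq_count (a2 := pred1 (l i))).
      by rewrite count_uniq_mem ?undup_uniq// mem_undup map_f ?mem_enum.
    by move=> x /=; rewrite eq_sym.
  rewrite (exchange_big_dep xpredT)//=; apply: eq_bigr => x _.
  by rewrite sum1_card.
apply: lee_sum => x _.
apply: (@card_le_dim_mod _ _ _ e) => [i /eqP <-|]; first exact: el.
move=> c Zc i ix; have := indep (fun i => if l i == x then c i else 0).
move=> /(_ _ i); rewrite (eqP ix) eqxx; apply.
congr (Z _): Zc; apply/funext => z; rewrite big_mkcond; apply: eq_bigr => j _ /=.
by case: ifP => //; rewrite mul0r.
Qed.

(** A supremum of a bounded set of natural numbers is attained. *)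
Lemma dim_modP (E : set (T -> R[i])) :
  (forall N : nat, exists n : nat, (N <= n)%N /\
    exists e : 'I_n -> T -> R[i], (forall i, E (e i)) /\ lin_indep_mod Z e) \/
  (exists n : nat, dim_mod Z E = (n%:R)%:E /\
    exists e : 'I_n -> T -> R[i], (forall i, E (e i)) /\ lin_indep_mod Z e).
Proof.
set P := fun n : nat => exists e : 'I_n -> T -> R[i], (forall i, E (e i)) /\ lin_indep_mod Z e.
have [[N NP]|/forallNP unb] := pselect (exists N : nat, forall n, P n -> (n <= N)%N); last first.
  left=> N; have /existsNP[n /not_implyP[Pn /negP]] := unb N.
  by rewrite -ltnNge => Nn; exists n; split=> //; exact: ltnW.
right; have P0 : P 0%N.
  by exists (fun=> fun=> 0); split=> [[]//|c _ []//].
have ex : exists n, `[<P n>] by exists 0%N; exact/asboolP.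
have ub n : `[<P n>] -> (n <= N)%N by move=> /asboolP; exact: NP.
case: (ex_maxnP ex ub) => n /asboolP Pn nmax.
exists n; split=> //; apply/eqP; rewrite eq_le; apply/andP; split.
  apply: ge_ereal_sup => _ [m Pm <-]; rewrite lee_fin ler_nat.
  by apply: nmax; exact/asboolP.
by apply: ereal_sup_ubound; exists n.
Qed.

(** A finite part of the sum of dimensions is the size of one family, the union of
    independent families of the eigenspaces involved; if some eigenspace is
    infinite-dimensional, it contains families of every size. Independence is only
    asked within each eigenspace. *)
Lemma num_eigenvalues_le A (X : \bar R) :
  (forall (I : finType) (l : I -> R) (e : I -> T -> R[i]),
    (forall i, A (l i)) -> (forall i, Defs.eigenspace Op (l i) (e i)) ->
    (forall x (c : I -> R[i]), Z (fun z => \sum_(i | l i == x) c i * e i z) ->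
      forall i, l i = x -> c i = 0) -> ((#|I|%:R)%:E <= X)%E) ->
  (num_eigenvalues Z Op A <= X)%E.
Proof.
move=> fam; apply: ge_ereal_sup => _ [S [finS SA] <-].
rewrite fsbig_finite//=; set s := fset_set S.
have sA x : x \in (s : seq R) -> A x.
  by rewrite in_fset_set// inE => /SA.
have [[x [xs xinf]]|allfin] := pselect (exists x, x \in (s : seq R) /\
    forall N : nat, exists n : nat, (N <= n)%N /\
    exists e : 'I_n -> T -> R[i], (forall i, Defs.eigenspace Op x (e i)) /\ lin_indep_mod Z e).
  suff -> : X = +oo%E by rewrite leey.
  apply/eqyP => r r0; have [n [rn [e [ee indep]]]] := xinf (Num.truncn r).+1.
  apply: (@le_trans _ _ (n%:R)%:E).
    rewrite lee_fin; apply: (@le_trans _ _ (Num.truncn r).+1%:R); last by rewrite ler_nat.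
    by have /andP[_ /ltW] := truncn_itv (ltW r0).
  have := fam _ (fun=> x) e (fun=> sA x xs) ee; rewrite card_ord; apply.
  move=> y c Zc i xy; apply: indep i.
  by congr (Z _): Zc; apply/funext => z; apply: eq_bigl => j; exact/eqP.
have fin x : exists n : nat, x \in (s : seq R) -> dim_mod Z (Defs.eigenspace Op x) = (n%:R)%:E /\
    exists e : 'I_n -> T -> R[i], (forall i, Defs.eigenspace Op x (e i)) /\ lin_indep_mod Z e.
  have [xs|] := boolP (x \in (s : seq R)); last by exists 0%N.
  have [inf|[n h]] := dim_modP (Defs.eigenspace Op x); last by exists n.
  by exfalso; apply: allfin; exists x.
have [m mP] := choice fin.
have exe x : exists e : 'I_(m x) -> T -> R[i], x \in (s : seq R) ->
    (forall i, Defs.eigenspace Op x (e i)) /\ lin_indep_mod Z e.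
  have [xs|] := boolP (x \in (s : seq R)); last by exists (fun=> fun=> 0).
  by have [_ [e h]] := mP x xs; exists e.
pose e x := projT1 (cid (exe x)).
have eP x : x \in (s : seq R) ->
    (forall i, Defs.eigenspace Op x (e x i)) /\ lin_indep_mod Z (e x).
  by rewrite /e; case: cid.
pose K := 'I_(size (s : seq R)); pose v (k : K) := (s : seq R)`_k.
have vs k : v k \in (s : seq R) by apply: mem_nth.
have v_inj : injective v.
  by move=> i j /eqP; rewrite /v nth_uniq ?fset_uniq// => /eqP/val_inj.
pose I : finType := {k : K & 'I_(m (v k))}.
apply: le_trans (fam I (fun i => v (tag i)) (fun i => e (v (tag i)) (tagged i)) _ _ _).
- rewrite big_seq (eq_bigr (fun x => ((m x)%:R)%:E)); last by move=> x /mP[-> _].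
  rewrite -big_seq sumEFin -natr_sum lee_fin ler_nat card_tagged sumnE big_map.
  rewrite big_enum /= (big_nth 0) big_mkord leq_sum// => k _.
  by rewrite card_ord.
- by move=> i; exact/sA/vs.
- by move=> i; have [] := eP _ (vs (tag i)).
move=> x c Zc [k j] /= kx.
have [_ /(_ (fun u => c (Tagged _ u))) ind] := eP _ (vs k); apply: ind.
congr (Z _): Zc; apply/funext => z.
pose F (i : K) (u : 'I_(m (v i))) := c (Tagged (fun k : K => 'I_(m (v k))) u) * e (v i) u z.
transitivity (\sum_(p : I | (tag p == k) && true) F (tag p) (tagged p)).
  rewrite -kx; apply: eq_big => [i|[i u] _ //].
  by rewrite andbT /= (inj_eq v_inj).
by rewrite -(sig_big_dep (pred1 k) (fun=> xpredT) F) big_pred1_eq.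
Qed.
End eigenvalue_counts.

Section spectral_counting.
Variables (R : realType) (T : Type).
Implicit Types (Z : set (T -> R[i])) (Op : (T -> R[i]) -> (T -> R[i]) -> Prop).

Lemma dim_mod_ge0 Z E : (0 <= dim_mod Z E)%E.
Proof.
apply: ereal_sup_ubound; exists 0%N => //.
by exists (fun (_ : 'I_0) _ => 0); split; [case|move=> c _; case].
Qed.

Lemma dim_mod_eq0 Z E : (forall f, E f -> Z (fun z => 1 * f z)) -> dim_mod Z E = 0%E.
Proof.
move=> EZ; apply/eqP; rewrite eq_le dim_mod_ge0 andbT; apply: ge_ereal_sup => _ [n [e [Ee indep]] <-].
case: n e Ee indep => [//|n] e Ee indep; exfalso.
have := indep (fun i => if i == ord0 then 1 else 0) _ ord0; rewrite eqxx => h.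
suff /h/eqP : Z (fun z => \sum_(i < n.+1) (if i == ord0 then 1 else 0) * e i z).
  by rewrite oner_eq0.
have := EZ _ (Ee ord0); congr Z; apply/funext => z.
by rewrite (bigD1 ord0)//= big1 ?addr0// => i /negbTE ->; rewrite mul0r.
Qed.

Lemma num_eigenvalues_leU Z Op (A A1 A2 : set R) :
  (forall l, A l -> [\/ A1 l, A2 l | dim_mod Z (Defs.eigenspace Op l) = 0%E]) ->
  (num_eigenvalues Z Op A <= num_eigenvalues Z Op A1 + num_eigenvalues Z Op A2)%E.
Proof.
move=> cover; have dim0 l := dim_mod_ge0 Z (Defs.eigenspace Op l).
have if0 (B : set R) l : (0 <= if l \in B then dim_mod Z (Defs.eigenspace Op l) else 0)%E.
  by case: ifP.
rewrite /num_eigenvalues !(esum_mkcond _ (fun l => dim_mod Z (Defs.eigenspace Op l))).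
rewrite -esumD; [|by move=> l _; exact: if0..].
apply: le_esum => l _; case: ifPn => [|_]; last by apply: adde_ge0; exact: if0.
rewrite inE => /cover[A1l|A2l|->]; last by case: ifP; case: ifP; rewrite addr0.
  by rewrite (mem_set A1l) leeDl ?if0.
by rewrite (mem_set A2l) leeDr ?if0.
Qed.

End spectral_counting.

(** * The form of the periodic operator *)

Section form_bounds_from_spectrum.
Variables (R : realType) (T : choiceType).
Variable H : (T -> R[i]) -> T -> R[i].
Hypothesis opH : symmetric_operator H.
Variable K : R.
Hypothesis H_bounded : forall f, ell2 f -> rdot (H f) (H f) <= K * rdot f f.
Implicit Types f g : T -> R[i].

Lemma ler_rdot f g : ell2 f -> ell2 g -> `|rdot f g| <= (rdot f f + rdot g g) / 2.
Proof.
move=> lf lg; have := ler_rdot_weighted lf lg ltr01; rewrite invr1 !mul1r.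
by rewrite ler_pdivlMr// mulrC.
Qed.

(** If the form went below m0, its infimum m over the unit sphere would be an
    approximate eigenvalue: with B = H - m nonnegative and bounded, |B g|^2 is at
    most a multiple of (B g, g), which comes arbitrarily close to 0, against the
    lower bound for H - m. *)
Lemma form_ge (m0 : R) :
  (forall m : R, m < m0 -> exists M : R, forall f, ell2 f ->
     (ell2_sqnorm f <= M%:E * ell2_sqnorm (fun x => H f x - m%:C * f x)%R)%E) ->
  forall f, ell2 f -> m0 * rdot f f <= rdot (H f) f.
Proof.
move=> res f lf; rewrite leNgt; apply/negP => fm0.
pose E : set R := [set rdot (H g) g | g in [set g | ell2 g /\ rdot g g = 1]].
have f0 : 0 < rdot f f.
  rewrite lt_neqAle rdot_ge0 andbT; apply/eqP => /esym f0.
  have fE : f = fun=> 0 by apply/funext; exact: rdot_eq0.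
  move: fm0; rewrite f0 mulr0 fE (eq_rdot (op0 opH) (fun=> erefl)) /rdot.
  by under eq_tsum do rewrite cdot0l; rewrite tsum0 ltxx.
pose t := (Num.sqrt (rdot f f))^-1.
have tE : t ^+ 2 = (rdot f f)^-1 by rewrite exprVn sqr_sqrtr// ltW.
have lHf := op_ell2 opH lf.
have Ef : E (rdot (H f) f / rdot f f).
  exists (fun x => t%:C * f x); first split; first exact: ell2Z.
    by rewrite rdotRl ?rdotRr// ?mulrA -?expr2 ?tE ?mulVf ?gt_eqF//; exact: ell2Z.
  rewrite (eq_rdot (opZ opH t%:C f) (fun=> erefl)).
  rewrite rdotRl//; last exact: ell2Z.
  by rewrite rdotRr// mulrA -expr2 tE mulrC.
have Einf : has_inf E.
  split; first by exists (rdot (H f) f / rdot f f).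
  exists (- ((K + 1) / 2)) => _ [g [lg g1] <-].
  have := ler_rdot (op_ell2 opH lg) lg; have := H_bounded lg.
  by rewrite g1 ler_norml => h1 /andP[h2 _]; lra.
pose m := inf E.
have mm0 : m < m0.
  by apply: (@le_lt_trans _ _ (rdot (H f) f / rdot f f)); [apply: ge_inf; [case: Einf|]|rewrite ltr_pdivrMr].
have m_form g : ell2 g -> m * rdot g g <= rdot (H g) g.
  move=> lg; have [g0|g0] := eqVneq (rdot g g) 0.
    have gE : g = fun=> 0 by apply/funext; exact: rdot_eq0.
    rewrite g0 mulr0 gE (eq_rdot (op0 opH) (fun=> erefl)) /rdot.
    by rewrite tsum_ge0// => x; rewrite cdot0l.
  have gp : 0 < rdot g g by rewrite lt_neqAle eq_sym g0 rdot_ge0.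
  pose u := (Num.sqrt (rdot g g))^-1.
  have uE : u ^+ 2 = (rdot g g)^-1 by rewrite exprVn sqr_sqrtr// ltW.
  have : m <= u ^+ 2 * rdot (H g) g.
    apply: ge_inf; first by case: Einf.
    exists (fun x => u%:C * g x); first split; first exact: ell2Z.
      by rewrite rdotRl ?rdotRr// ?mulrA -?expr2 ?uE ?mulVf//; exact: ell2Z.
    rewrite (eq_rdot (opZ opH u%:C g) (fun=> erefl)).
    have lHg := op_ell2 opH lg; rewrite rdotRl//; last exact: ell2Z.
    by rewrite rdotRr// mulrA -expr2.
  by rewrite uE ler_pdivlMl// mulrC.
pose B := sub_potential H (fun=> m).
have opB : symmetric_operator B by apply: (@sub_potential_operator _ _ _ opH _ `|m|).
have formB g : ell2 g -> rdot (B g) g = rdot (H g) g - m * rdot g g.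
  move=> lg; rewrite /B /sub_potential rdotBl ?rdotRl//; last exact: ell2Z.
  exact: op_ell2.
have B_ge0 g : ell2 g -> 0 <= rdot (B g) g.
  by move=> lg; rewrite formB// subr_ge0 m_form.
have B_le g : ell2 g -> rdot (B g) g <= ((K + 1) / 2 + `|m|) * rdot g g.
  move=> lg; rewrite formB//.
  have := ler_rdot (op_ell2 opH lg) lg; have := H_bounded lg; have := rdot_ge0 g.
  have := ler_norm (- m); rewrite normrN ler_norml => h1 h0 h2 /andP[_ h3]; nra.
pose K' := `|(K + 1) / 2 + `|m| | + 1.
have K'0 : 0 < K' by rewrite ltr_wpDl.
have B_le' g : ell2 g -> rdot (B g) g <= K' * rdot g g.
  move=> lg; apply: le_trans (B_le g lg) _; rewrite ler_wpM2r ?rdot_ge0//.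
  by rewrite (le_trans (ler_norm _))// lerDl.
(* Nonnegativity of the form of B at g - B g / K', where K' bounds B. *)
have B_sq g : ell2 g -> rdot (B g) (B g) <= K' * rdot (B g) g.
  move=> lg; have lBg := op_ell2 opB lg.
  have := B_ge0 _ (ell2D lg (ell2Z (- K'^-1)%:C lBg)).
  rewrite formD//; have := B_le' _ lBg.
  set a := rdot (B g) (B g); set b := rdot (B g) g => h1 h2.
  have h3 : K'^-1 ^+ 2 * rdot (B (B g)) (B g) <= K'^-1 * a.
    rewrite expr2 -mulrA ler_wpM2l ?invr_ge0 ?(ltW K'0)//.
    by rewrite ler_pdivrMl.
  have : K'^-1 * a <= b by move: h2; rewrite sqrrN; lra.
  by rewrite ler_pdivrMl.
have [M resM] := res m mm0.
have {}resM g : ell2 g -> rdot g g <= M * rdot (B g) (B g).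
  move=> lg; have lBg := op_ell2 opB lg; have := resM g lg.
  rewrite ell2_sqnormE// (_ : ell2_sqnorm _ = (rdot (B g) (B g))%:E); first by rewrite lee_fin.
  by rewrite -ell2_sqnormE.
pose M' := `|M| + 1; have M'0 : 0 < M' by rewrite ltr_wpDl.
have d0 : 0 < (M' * K')^-1 by rewrite invr_gt0 mulr_gt0.
have [_ [g [lg g1] <-] gm] := inf_adherent d0 Einf.
have h1 := resM g lg; have h2 := B_sq g lg; rewrite g1 in h1.
have h3 : 1 <= M' * rdot (B g) (B g).
  apply: (le_trans h1); rewrite ler_wpM2r ?rdot_ge0//.
  by rewrite (le_trans (ler_norm _))// lerDl.
have h4 : 1 <= M' * K' * rdot (B g) g.
  by rewrite (le_trans h3)// -mulrA ler_wpM2l// ltW.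
have : (M' * K')^-1 <= rdot (B g) g.
  by rewrite -[leLHS]mulr1 ler_pdivrMl// mulr_gt0.
rewrite formB// g1 mulr1; move: gm; rewrite -/m; lra.
Qed.

End form_bounds_from_spectrum.

Section sums_over_fibres.
Variables (R : realType) (E T : choiceType) (pi : E -> T).
Hypothesis fin_fibre : forall x, finite_set [set e | pi e = x].
Implicit Types F : E -> R.

(** Sums over edges are grouped by the source of the edge. *)
Definition fibre x : seq E := fset_set [set e | pi e = x].

Lemma mem_fibre x e : (e \in fibre x) = (pi e == x).
Proof.
rewrite /fibre in_fset_set//.
by apply/idP/eqP => [|h]; rewrite ?inE//= mem_setE.
Qed.

Lemma esum_fibre F : (forall e, 0 <= F e) ->
  (\esum_(e in [set: E]) (F e)%:E =
   \esum_(x in [set: T]) (\sum_(e <- fibre x) F e)%:E)%E.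
Proof.
move=> F0.
transitivity (\esum_(x in [set: T]) \esum_(e in [set e | pi e = x]) (F e)%:E)%E.
  rewrite (@esum_esum _ _ _ _ _ (fun _ e => (F e)%:E)); last by move=> x e _ _; rewrite lee_fin.
  rewrite (reindex_esum [set: E] _ (fun e => (pi e, e)))//; split=> [e _ //|e e' _ _ [_ //]|].
  by move=> [x e] /= [_ <-]; exists e.
apply: eq_esum => x _; rewrite esum_fset//; last by move=> e _; rewrite lee_fin.
by rewrite fsbig_finite//= sumEFin.
Qed.

Lemma summ_fibre F : summ F -> summ (fun x => \sum_(e <- fibre x) F e).
Proof.
move=> sF; rewrite /summ; apply: le_lt_trans sF.
rewrite esum_fibre; last by move=> e; exact: normr_ge0.
by apply: le_esum => x _; rewrite lee_fin ler_norm_sum.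
Qed.

Lemma tsum_fibre F : summ F ->
  tsum F = tsum (fun x => \sum_(e <- fibre x) F e).
Proof.
move=> sF.
pose P e := Num.max (F e) 0; pose N e := Num.max (- F e) 0.
have P0 e : 0 <= P e by rewrite le_max lexx orbT.
have N0 e : 0 <= N e by rewrite le_max lexx orbT.
have sP : summ P.
  by apply: (summ_le sF) => x; rewrite ger0_norm// ge_max normr_ge0 ler_norm.
have sN : summ N.
  by apply: (summ_le sF) => x; rewrite ger0_norm// ge_max normr_ge0 -normrN ler_norm.
rewrite (@tsum_diff _ _ _ (fun x => \sum_(e <- fibre x) P e) (fun x => \sum_(e <- fibre x) N e)).
- by rewrite -!esum_fibre.
- exact: summ_fibre.
- exact: summ_fibre.
- by move=> x; apply: sumr_ge0.
- by move=> x; apply: sumr_ge0.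
move=> x; rewrite -sumrB; apply: eq_bigr => e _.
by rewrite /P /N; case: (lerP (F e) 0); case: (lerP (- F e) 0); lra.
Qed.

Lemma tsum_reindex (h : E -> E) F : bijective h ->
  tsum (fun e => F (h e)) = tsum F.
Proof.
move=> bh; have sh : set_bij [set: E] [set: E] h.
  by rewrite setTT_bijective.
by congr (fine _ - fine _); rewrite [RHS](@reindex_esum R E E _ _ h _ sh).
Qed.

Lemma summ_pullback (D : nat) (a : T -> R) : (forall x, (size (fibre x) <= D)%N) ->
  (forall x, 0 <= a x) -> summ a ->
  summ (fun e => a (pi e)) /\ tsum (fun e => a (pi e)) <= D%:R * tsum a.
Proof.
move=> szD a0 sa.
have E1 : (\esum_(e in [set: E]) (a (pi e))%:E = \esum_(x in [set: T]) ((size (fibre x))%:R * a x)%:E)%E.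
  rewrite (esum_fibre (F := fun e => a (pi e)))//; apply: eq_esum => x _.
  congr EFin; rewrite big_seq (eq_bigr (fun=> a x)); last first.
    by move=> e; rewrite mem_fibre => /eqP ->.
  by rewrite -big_seq big_const_seq count_predT iter_addr_0 mulr_natl.
have s1 : summ (fun x => (size (fibre x))%:R * a x).
  apply: (summ_le (summZ D%:R sa)) => x; rewrite !ger0_norm ?mulr_ge0//.
  by rewrite ler_wpM2r// ler_nat.
have s2 : summ (fun e => a (pi e)).
  move: s1; rewrite /summ; under eq_esum do rewrite ger0_norm ?mulr_ge0//.
  by rewrite -E1; under [in X in _ -> X]eq_esum do rewrite ger0_norm//.
split=> //; rewrite tsum_ge0E// E1 -tsum_ge0E//; last by move=> x; rewrite mulr_ge0.
rewrite -tsumZ//; apply: le_tsum => //; first exact: summZ.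
by move=> x; rewrite ler_wpM2r// ler_nat.
Qed.

End sums_over_fibres.

Lemma sqnorm_sum (R : realType) (I : Type) (s : seq I) (F : I -> R[i]) :
  sqnorm (\sum_(i <- s) F i) <= (size s)%:R * \sum_(i <- s) sqnorm (F i).
Proof.
elim: s => [|i s ih]; first by rewrite !big_nil sqnorm0 mulr0.
rewrite !big_cons /=; have [s0|s0] := posnP (size s).
  by rewrite (size0nil s0) !big_nil !addr0 /= mul1r.
have n0 : 0 < (size s)%:R :> R by rewrite ltr0n.
apply: le_trans (ler_sqnormD _ _ n0) _.
rewrite -natr1 [leRHS]mulrDr; apply: lerD; first by rewrite addrC.
rewrite (_ : 1 + (size s)%:R^-1 = ((size s)%:R + 1) / (size s)%:R); last first.
  by field; rewrite gt_eqF.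
rewrite -mulrA ler_wpM2l ?addr_ge0//.
by rewrite ler_pdivrMl.
Qed.

Section periodic_graph_operator.
Variables (R : realType) (d : nat) (G : periodic_graph R d).
Variable p : vertex G -> R.
Hypothesis p_periodic : periodic_potential p.
Local Notation V := (vertex G).
Implicit Types f g : V -> R[i].

Let star (x : V) := fibre (@src R d G) x.

Lemma laplacianE f x : laplacian f x = \sum_(e <- star x) (f x - f (tgt e)).
Proof. by rewrite /laplacian fsbig_finite//; exact: locally_finite. Qed.

Lemma vtransK m (y : V) : vtrans (- m) (vtrans m y) = y.
Proof.
apply: pos_inj; rewrite !pos_vtrans -addrA -mulmxDl.
rewrite [X in X *m _](_ : _ = 0) ?mul0mx ?addr0//.
by apply/matrixP => i j; rewrite !mxE mulrNz addrN.
Qed.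

(** Translations carry the edges at a vertex to those at its translate, and there
    are finitely many classes of vertices. *)
Lemma bounded_degree : exists D : nat, forall x, (size (star x) <= D)%N.
Proof.
have [F [finF FV]] := finite_vertex_quotient G.
exists (\max_(y <- fset_set F) size (star y)) => x.
have [y Fy [m ->]] := FV x.
apply: (@leq_trans (size (star y))); last first.
  by apply: leq_bigmax_seq => //; rewrite in_fset_set ?inE.
rewrite -(size_map (Defs.etrans m) (star y)); apply: uniq_leq_size => [|e].
  exact: fset_uniq.
rewrite mem_fibre; last exact: locally_finite.
move=> /eqP se; apply/mapP; exists (Defs.etrans (- m) e); last first.
  by rewrite -etransD addrN etrans0.
by rewrite mem_fibre ?src_etrans ?se ?vtransK//; exact: locally_finite.
Qed.

Lemma bounded_potential : exists P : R, forall x, `|p x| <= P.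
Proof.
have [F [finF FV]] := finite_vertex_quotient G.
exists (\sum_(y <- fset_set F) `|p y|) => x.
have [y Fy [m ->]] := FV x; rewrite p_periodic.
have yF : y \in fset_set F by rewrite in_fset_set ?inE.
rewrite (bigD1_seq y) ?fset_uniq//= lerDl; exact: sumr_ge0.
Qed.

(** Both the symmetry and the bound come from writing sums over vertices as sums
    over oriented edges, on which reversal acts as a bijection exchanging source and
    target. *)
Lemma laplacian_operator : symmetric_operator (@laplacian R d G) /\
  exists K : R, forall f, ell2 f -> rdot (laplacian f) (laplacian f) <= K * rdot f f.
Proof.
have lf := @locally_finite R d G; have [D szD] := bounded_degree.
have rev_bij : bijective (@reverse R d G) by exists (@reverse _ _ G); exact: reverseK.
have pull (a : V -> R) : (forall x, 0 <= a x) -> summ a ->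
   [/\ summ (fun e : edge G => a (src e)), summ (fun e : edge G => a (tgt e)),
       tsum (fun e : edge G => a (src e)) <= D%:R * tsum a &
       tsum (fun e : edge G => a (tgt e)) <= D%:R * tsum a].
  move=> a0 sa; have [s1 t1] := summ_pullback lf szD a0 sa.
  have t2 := tsum_reindex (fun e => a (src e)) rev_bij.
  split=> //; last by rewrite [leLHS]t2.
  have sh : set_bij [set: edge G] [set: edge G] (@reverse R d G) by rewrite setTT_bijective.
  by rewrite /summ -(@reindex_esum R _ _ _ _ _ (fun e => `|a (src e)|%:E)%E sh).
have sq2 f : ell2 f -> summ (fun e : edge G => sqnorm (f (src e) - f (tgt e))) /\
    tsum (fun e : edge G => sqnorm (f (src e) - f (tgt e))) <= 4 * D%:R * rdot f f.
  move=> /ell2P sf; have [s1 s2 t1 t2] := pull _ (fun x => sqnorm_ge0 (f x)) sf.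
  have b e : sqnorm (f (src e) - f (tgt e)) <= 2 * (sqnorm (f (src e)) + sqnorm (f (tgt e))).
    by rewrite -(sqnormN (f (tgt e))) ler_sqnormD2.
  have s3 := summZ 2 (summD s1 s2).
  have s4 : summ (fun e : edge G => sqnorm (f (src e) - f (tgt e))).
    apply: (summ_le s3) => e; rewrite ger0_norm ?sqnorm_ge0// (le_trans (b e))//.
    exact: ler_norm.
  split=> //; apply: (le_trans (le_tsum s4 s3 b)).
  rewrite tsumZ; last exact: summD.
  by rewrite tsumD// rdotff; lra.
have sqlap f : ell2 f -> forall x, sqnorm (laplacian f x) <=
    D%:R * \sum_(e <- star x) sqnorm (f (src e) - f (tgt e)).
  move=> _ x; rewrite laplacianE (le_trans (sqnorm_sum _ _))//.
  rewrite big_seq [X in _ <= _ * X]big_seq (eq_bigr (fun e => sqnorm (f (src e) - f (tgt e)))); last first.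
    by move=> e; rewrite mem_fibre// => /eqP ->.
  by rewrite ler_wpM2r ?ler_nat// sumr_ge0// => e _; exact: sqnorm_ge0.
have lap_ell2 f : ell2 f -> ell2 (laplacian f).
  move=> l2f; have [s _] := sq2 f l2f; apply/ell2P.
  apply: (summ_le (summZ D%:R (summ_fibre lf s))) => x.
  by rewrite ger0_norm ?sqnorm_ge0// (le_trans (sqlap f l2f x))// ler_norm.
split; last first.
  exists (4 * D%:R ^+ 2) => f l2f; have [s t] := sq2 f l2f.
  rewrite rdotff; apply: (@le_trans _ _ (D%:R * tsum (fun e : edge G => sqnorm (f (src e) - f (tgt e))))).
    rewrite (tsum_fibre lf s) -tsumZ; last exact: summ_fibre.
    by apply: le_tsum; [exact/ell2P/lap_ell2|exact/summZ/summ_fibre|exact: sqlap].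
  by rewrite (_ : 4 * _ * _ = D%:R * (4 * D%:R * rdot f f)) ?ler_wpM2l//; ring.
split=> //.
- move=> c f g x; rewrite !laplacianE mulr_sumr -big_split; apply: eq_bigr => e _ /=.
  by ring.
- move=> f g l2f l2g.
  have scross (f' g' : V -> R[i]) : ell2 f' -> ell2 g' ->
      summ (fun e : edge G => cdot (f' (src e)) (g' (src e))) /\
      summ (fun e : edge G => cdot (f' (src e)) (g' (tgt e))).
    move=> /ell2P sf /ell2P sg.
    have [s1 s2 _ _] := pull _ (fun x => sqnorm_ge0 (f' x)) sf.
    have [s3 s4 _ _] := pull _ (fun x => sqnorm_ge0 (g' x)) sg.
    split.
      apply: (summ_le (summD s1 s3)) => e; apply: le_trans (ler_cdot1 _ _) _.
      rewrite ger0_norm; last by rewrite addr_ge0// sqnorm_ge0.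
      by have := sqnorm_ge0 (f' (src e)); have := sqnorm_ge0 (g' (src e)); lra.
    apply: (summ_le (summD s1 s4)) => e; apply: le_trans (ler_cdot1 _ _) _.
    rewrite ger0_norm; last by rewrite addr_ge0// sqnorm_ge0.
    by have := sqnorm_ge0 (f' (src e)); have := sqnorm_ge0 (g' (tgt e)); lra.
  have key (f' g' : V -> R[i]) : ell2 f' -> ell2 g' -> rdot (laplacian f') g' =
      tsum (fun e : edge G => cdot (f' (src e)) (g' (src e))) -
      tsum (fun e : edge G => cdot (g' (src e)) (f' (tgt e))).
    move=> l2f' l2g'; have [s1 _] := scross _ _ l2f' l2g'; have [_ s2] := scross _ _ l2g' l2f'.
    rewrite -tsumB// (tsum_fibre lf); last exact: summB.
    apply: eq_tsum => x; rewrite laplacianE cdot_suml big_seq [RHS]big_seq.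
    apply: eq_bigr => e; rewrite mem_fibre// => /eqP ->.
    by rewrite cdotDl cdotNl; congr (_ - _); exact: cdotC.
  rewrite (rdotC f) !key//; congr (_ - _).
    by apply: eq_tsum => e; rewrite cdotC.
  rewrite -(tsum_reindex _ rev_bij); apply: eq_tsum => e.
  by rewrite /tgt reverseK cdotC.
Qed.

Lemma h_o_operator : symmetric_operator (@h_o R d G p) /\
  exists K : R, forall f, ell2 f -> rdot (h_o p f) (h_o p f) <= K * rdot f f.
Proof.
have [opL [K LK]] := laplacian_operator; have [P pP] := bounded_potential.
have hE : h_o p = sub_potential (@laplacian R d G) (fun x => - p x).
  by apply/funext => f; apply/funext => x; rewrite /h_o /sub_potential raddfN mulNr opprK.
split.
  rewrite hE; apply: (@sub_potential_operator _ _ _ opL _ P) => x.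
  by rewrite normrN.
exists (2 * (K + P ^+ 2)) => f lf.
have lL := op_ell2 opL lf; move/ell2P : (lL) => sL; move/ell2P : (lf) => sf.
have lh : ell2 (h_o p f).
  rewrite hE; apply: op_ell2 lf; apply: (@sub_potential_operator _ _ _ opL _ P) => x.
  by rewrite normrN.
move/ell2P : (lh) => sh.
have s1 := summZ 2 (summD sL (summZ (P ^+ 2) sf)).
rewrite rdotff; apply: le_trans (le_tsum sh s1 _) _.
  move=> x; apply: le_trans (ler_sqnormD2 _ _) _.
  rewrite ler_wpM2l// lerD2l sqnormM sqnormR ler_wpM2r ?sqnorm_ge0//.
  have := pP x; rewrite ler_norml !expr2 => /andP[h1 h2].
  by case: (lerP 0 (p x)) => q0; nra.
rewrite tsumZ; last exact: summD (summZ _ _).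
rewrite tsumD//; last exact: summZ.
by rewrite tsumZ// -!rdotff; have := LK f lf; nra.
Qed.

(** The lower bound is applied to h_o, and to - h_o for the upper bound. *)
Lemma h_o_form_bounds (s : R) :
  (forall z, spectrum (h_o p) z -> 0 <= z <= s%:C) ->
  forall f, ell2 f -> 0 <= rdot (h_o p f) f /\ rdot (h_o p f) f <= s * rdot f f.
Proof.
move=> hspec f lf; have [opH [K HK]] := h_o_operator.
have res (m : R) : ~ (0 <= m%:C <= s%:C) -> exists M : R, forall f, ell2 f ->
    (ell2_sqnorm f <= M%:E * ell2_sqnorm (fun x => h_o p f x - m%:C * f x)%R)%E.
  move=> ms; have : ~ spectrum (h_o p) m%:C by move=> /hspec.
  by rewrite /spectrum /setC /= notK => -[_].
split.
  rewrite -[leLHS](mul0r (rdot f f)); apply: (form_ge opH HK) => // m m0.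
  by apply: res => /andP[]; rewrite lecR leNgt m0.
pose H' g x := - h_o p g x.
have opH' : symmetric_operator H'.
  split=> [c g g' x|g lg|g g' lg lg'].
  - by rewrite /H' op_linear//; ring.
  - exact/ell2N/op_ell2.
  - by rewrite /H' rdotNl rdotNr op_sym.
have := @form_ge R _ H' opH' K _ (- s) _ f lf.
rewrite /H' rdotNl mulNr lerN2; apply.
  by move=> g lg; rewrite rdotNl rdotNr opprK HK.
move=> m ms; have [|M HM] := res (- m).
  by move=> /andP[_]; rewrite lecR; lra.
exists M => g lg; apply: (le_trans (HM g lg)).
rewrite le_eqVlt; apply/orP; left; apply/eqP; congr (_ * _)%E.
apply: eq_esum => x _; rewrite -sqnormN; congr (_%:E); congr sqnorm.
by rewrite raddfN; ring.
Qed.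

End periodic_graph_operator.

(** * Bounded measurable functions on an interval *)

Section bounded_measurable.
Variables (R : realType) (a b : R).
Hypothesis ab : a <= b.
Local Notation mu := (@lebesgue_measure R).
Let D : set R := `[a, b]%classic.
Implicit Types (f g : R -> R).

Let muD : mu D = (b - a)%:E.
Proof.
rewrite -[LHS]/(lebesgue_measure (`[a, b]%classic : set R)) lebesgue_measure_itv /=.
rewrite lte_fin; case: ltP => //= ba; congr EFin.
by apply/esym/eqP; rewrite subr_eq0 eq_le ba.
Qed.

Definition bounded_measurable f : Prop :=
  measurable_fun D f /\ exists M : R, forall t, a <= t <= b -> `|f t| <= M.

Let mD : measurable D. Proof. exact: measurable_itv. Qed.

Let inD t : D t = (a <= t <= b).
Proof. by rewrite /D /= in_itv. Qed.

Lemma eq_bounded_measurable f g : (forall t, a <= t <= b -> f t = g t) ->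
  bounded_measurable f -> bounded_measurable g.
Proof.
move=> fg [mf [M fM]]; split.
  by apply: eq_measurable_fun mf => t; rewrite inE inD => /fg.
by exists M => t Dt; rewrite -fg// fM.
Qed.

Lemma bmD f g : bounded_measurable f -> bounded_measurable g ->
  bounded_measurable (fun t => f t + g t).
Proof.
move=> [mf [M fM]] [mg [N gN]]; split; first exact: measurable_funD.
by exists (M + N) => t Dt; rewrite (le_trans (ler_normD _ _))// lerD ?fM ?gN.
Qed.

Lemma bmM f g : bounded_measurable f -> bounded_measurable g ->
  bounded_measurable (fun t => f t * g t).
Proof.
move=> [mf [M fM]] [mg [N gN]]; split; first exact: measurable_funM.
by exists (M * N) => t Dt; rewrite normrM ler_pM ?fM ?gN.
Qed.

Lemma bm_cst (c : R) : bounded_measurable (fun=> c).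
Proof. by split; [exact: measurable_cst|exists `|c|]. Qed.

Lemma bmZ (c : R) f : bounded_measurable f -> bounded_measurable (fun t => c * f t).
Proof. by move=> bf; apply: bmM => //; exact: bm_cst. Qed.

Lemma bmN f : bounded_measurable f -> bounded_measurable (fun t => - f t).
Proof.
by move=> /bmZ -/(_ (-1)); apply: eq_bounded_measurable => t _; rewrite mulN1r.
Qed.

Lemma bmB f g : bounded_measurable f -> bounded_measurable g ->
  bounded_measurable (fun t => f t - g t).
Proof. by move=> bf bg; apply: bmD => //; exact: bmN. Qed.

Lemma bm_sum (I : Type) (s : seq I) (F : I -> R -> R) :
  (forall i, bounded_measurable (F i)) ->
  bounded_measurable (fun t => \sum_(i <- s) F i t).
Proof.
move=> bF; elim: s => [|i s ih].
  by apply: eq_bounded_measurable (bm_cst 0) => t _; rewrite big_nil.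
by apply: eq_bounded_measurable (bmD (bF i) ih) => t _; rewrite big_cons.
Qed.

Lemma bm_integrable f : bounded_measurable f -> mu.-integrable D (EFin \o f).
Proof.
move=> [mf [M fM]]; apply: measurable_bounded_integrable => //.
  by apply: (@le_lt_trans _ _ (b - a)%:E); [rewrite -muD|exact: ltry].
exists M; split; first exact: num_real.
by move=> x Mx t; rewrite inD => Dt; exact: le_trans (fM t Dt) (ltW Mx).
Qed.

Definition integ f : R := \int[mu]_(t in D) f t.

Lemma integD f g : bounded_measurable f -> bounded_measurable g ->
  integ (fun t => f t + g t) = integ f + integ g.
Proof. by move=> bf bg; apply: RintegralD => //; exact: bm_integrable. Qed.

Lemma integZ (c : R) f : bounded_measurable f ->
  integ (fun t => c * f t) = c * integ f.
Proof. by move=> bf; apply: RintegralZl => //; exact: bm_integrable. Qed.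

Lemma integ_cst (c : R) : integ (fun=> c) = c * (b - a).
Proof.
rewrite /integ Rintegral_cst//; congr (_ * _).
exact: (congr1 fine muD).
Qed.

Lemma le_integ f g : bounded_measurable f -> bounded_measurable g ->
  (forall t, a <= t <= b -> f t <= g t) -> integ f <= integ g.
Proof.
by move=> bf bg fg; apply: le_Rintegral => //; exact: bm_integrable.
Qed.

Lemma eq_integ f g : (forall t, a <= t <= b -> f t = g t) -> integ f = integ g.
Proof. by move=> fg; apply: eq_Rintegral => t; rewrite inE inD => /fg. Qed.

Lemma ler_norm_integ f (M : R) : bounded_measurable f ->
  (forall t, a <= t <= b -> `|f t| <= M) -> `|integ f| <= M * (b - a).
Proof.
move=> bf fM; rewrite -integ_cst ler_norml.
have bM := bm_cst M; have bNM := bm_cst (- M).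
apply/andP; split; last first.
  by apply: le_integ => // t /fM; rewrite ler_norml => /andP[].
rewrite -mulN1r -integZ//.
apply: le_integ => //; first exact: bmZ.
by move=> t /fM; rewrite mulN1r ler_norml => /andP[].
Qed.

End bounded_measurable.

Section subintervals.
Variables (R : realType) (a b : R).
Local Notation mu := (@lebesgue_measure R).
Implicit Types (f g : R -> R).

Lemma bounded_measurableS f c e : a <= c -> e <= b ->
  bounded_measurable a b f -> bounded_measurable c e f.
Proof.
move=> ac eb [mf [M fM]]; split.
  apply: measurable_funS mf; first exact: measurable_itv.
  by move=> t /=; rewrite !in_itv /= => /andP[ct te]; rewrite (le_trans ac)// (le_trans te).
by exists M => t /andP[ct te]; apply: fM; rewrite (le_trans ac)// (le_trans te).
Qed.

Lemma integ_chasles f s t : a <= s -> s <= t -> t <= b ->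
  bounded_measurable a b f -> integ a t f = integ a s f + integ s t f.
Proof.
move=> as_ st tb bf.
have bat : bounded_measurable a t f by apply: bounded_measurableS bf.
have bst : bounded_measurable s t f by apply: bounded_measurableS bf.
have iat := bm_integrable (le_trans as_ st) bat.
have := @Rintegral_itvB _ f (BLeft a) (BRight t) s iat _ _.
rewrite !bnd_simp as_ st => /(_ isT isT).
rewrite Rintegral_itv_obnd_cbnd; last first.
  apply: integrableS (bm_integrable st bst) => //.
  by move=> x /=; rewrite !in_itv /= => /andP[/ltW -> ->].
by rewrite /integ => <-; rewrite addrC subrK.
Qed.

(** Cutting the interval into N pieces bounds the increment by C (b - a)^2 / N. *)
Lemma quadratic_increment_constant f (C : R) : a <= b ->
  (forall s t, a <= s -> s <= t -> t <= b -> `|f t - f s| <= C * (t - s) ^+ 2) ->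
  f b = f a.
Proof.
move=> ab fC; apply/eqP; rewrite -subr_eq0 -normr_eq0 eq_le normr_ge0 andbT.
apply/ler_addgt0Pr => e e0; rewrite add0r.
have C0 : 0 <= C * (b - a) ^+ 2.
  by have := fC a b (lexx a) ab (lexx b); apply: le_trans.
pose N := (Num.truncn (C * (b - a) ^+ 2 / e)).+1.
have N0 : 0 < N%:R :> R by rewrite ltr0n.
have CN : C * (b - a) ^+ 2 / N%:R <= e.
  rewrite ler_pdivrMr// [leRHS]mulrC -ler_pdivrMr//.
  have p : 0 <= C * (b - a) ^+ 2 / e by rewrite divr_ge0// ltW.
  by have /andP[_ /ltW] := truncn_itv p.
pose x (k : nat) := a + k%:R * ((b - a) / N%:R).
have d0 : 0 <= (b - a) / N%:R by rewrite divr_ge0 ?subr_ge0.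
have xN : x N = b by rewrite /x mulrC divfK ?gt_eqF// addrC subrK.
have step k : (k < N)%N -> `|f (x k.+1) - f (x k)| <= C * ((b - a) / N%:R) ^+ 2.
  move=> kN; have -> : (b - a) / N%:R = x k.+1 - x k by rewrite /x -natr1; ring.
  apply: fC; first by rewrite /x lerDl mulr_ge0.
    by rewrite /x lerD2l ler_wpM2r// ler_nat leqnSn.
  rewrite -xN /x lerD2l ler_wpM2r// ler_nat//.
have sum k : (k <= N)%N -> `|f (x k) - f (x 0%N)| <= k%:R * (C * ((b - a) / N%:R) ^+ 2).
  elim: k => [_|k ih kN]; first by rewrite subrr normr0 mul0r.
  rewrite -natr1 mulrDl mul1r.
  rewrite (_ : f (x k.+1) - f (x 0%N) = (f (x k) - f (x 0%N)) + (f (x k.+1) - f (x k))); last by ring.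
  by rewrite (le_trans (ler_normD _ _))// lerD ?ih ?step// ltnW.
have := sum N (leqnn N); rewrite xN /x mul0r addr0 => /le_trans; apply.
apply: le_trans CN; rewrite le_eqVlt; apply/orP; left; apply/eqP; field.
by rewrite gt_eqF.
Qed.

Lemma bm_primitive f : a <= b -> bounded_measurable a b f ->
  bounded_measurable a b (fun t => integ a t f).
Proof.
move=> ab bf; have [_ [M fM]] := bf; split.
  apply: subspace_continuous_measurable_fun; first exact: measurable_itv.
  apply: parameterized_integral_continuous => //.
  exact: bm_integrable.
exists (`|M| * (b - a)) => t /andP[at_ tb].
apply: (@le_trans _ _ (`|M| * (t - a))).
  apply: ler_norm_integ => //; first exact: bounded_measurableS bf.
  by move=> r /andP[ar rt]; rewrite (le_trans (fM r _))// ?ler_norm// ar (le_trans rt).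
by rewrite ler_wpM2l// lerD2r.
Qed.

(** Here p is Lipschitz with a derivative g that is merely bounded, so the product
    rule is not available pointwise. The two sides, as functions of the upper limit,
    differ by a function with quadratically small increments. *)
Lemma integration_by_parts_bounded (p g u u' : R -> R) (C : R) : a <= b ->
  bounded_measurable a b g ->
  (forall t, a <= t <= b -> p t = p a + integ a t g) ->
  bounded_measurable a b u -> bounded_measurable a b u' ->
  (forall s t, `|u t - u s| <= C * `|t - s|) ->
  (forall s t, `|u' t - u' s| <= C * `|t - s|) ->
  (forall s t, `|u t - u s - u' s * (t - s)| <= C * (t - s) ^+ 2) ->
  integ a b (fun t => g t * u t) + integ a b (fun t => p t * u' t) =
  p b * u b - p a * u a.
Proof.
move=> ab bg pE bu bu' lu lu' qu.
have bp : bounded_measurable a b p.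
  apply: eq_bounded_measurable (bmD (bm_cst _ _ (p a)) (bm_primitive ab bg)).
  by move=> t /pE ->.
have [_ [M gM]] := bg; have [_ [P pP]] := bp; have [_ [U uU]] := bu'.
have M0 : 0 <= M by apply: le_trans (gM a _); rewrite ?lexx.
have P0 : 0 <= P by apply: le_trans (pP a _); rewrite ?lexx.
have U0 : 0 <= U by apply: le_trans (uU a _); rewrite ?lexx.
have C0 : 0 <= C.
  by have := lu 0 1; rewrite subr0 normr1 mulr1; apply: le_trans.
have bgu := bmM bg bu; have bpu' := bmM bp bu'.
have bs := bmD bgu bpu'.
pose Psi t := p t * u t - integ a t (fun r => g r * u r + p r * u' r).
suff h : Psi b = Psi a.
  have -> : p b * u b = Psi b + (integ a b (fun t => g t * u t) + integ a b (fun t => p t * u' t)).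
    by rewrite /Psi integD// subrK.
  rewrite h /Psi (_ : integ a a _ = 0); first by ring.
  by rewrite /integ set_itv1 Rintegral_set1.
pose K := M * C + (M * U + P * C) + P * C.
apply: (@quadratic_increment_constant _ K) => // s t as_ st tb.
have sub h : bounded_measurable a b h -> bounded_measurable s t h.
  exact: bounded_measurableS.
have ts0 : 0 <= t - s by rewrite subr_ge0.
have in_ab r : s <= r <= t -> a <= r <= b.
  by move=> /andP[sr rt]; rewrite (le_trans as_)// (le_trans rt).
have pC r v : a <= r -> r <= v -> v <= b -> p v = p r + integ r v g.
  move=> ar rv vb; rewrite (pE v) ?(le_trans ar rv)// (pE r); last first.
    by rewrite ar (le_trans rv).
  by rewrite (@integ_chasles g r v)// addrA.
have pL r : s <= r <= t -> `|p r - p s| <= M * (r - s).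
  move=> /andP[sr rt]; have rb := le_trans rt tb.
  rewrite (pC s r)// addrAC subrr add0r.
  apply: ler_norm_integ => //; first exact: bounded_measurableS bg.
  move=> v /andP[sv vr]; apply: gM.
  by rewrite (le_trans as_ sv) (le_trans vr rb).
(* The increment of Psi over [s, t] is the integral of th, which is of order t - s
   there, up to a Taylor remainder of u. *)
pose th r := g r * (u t - u r) + (p s * u' s - p r * u' r).
have bth : bounded_measurable s t th.
  apply: bmD; last by apply: bmB; [exact: bm_cst|exact: sub].
  by apply: bmM; [exact: sub|apply: bmB; [exact: bm_cst|exact: sub]].
have -> : Psi t - Psi s = integ s t th + p s * (u t - u s - u' s * (t - s)).
  have h1 : integ s t th = u t * integ s t g - integ s t (fun r => g r * u r) +
      (p s * u' s * (t - s) - integ s t (fun r => p r * u' r)).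
    rewrite /th integD//; last 2 first.
    - by apply: bmM; [exact: sub|apply: bmB; [exact: bm_cst|exact: sub]].
    - by apply: bmB; [exact: bm_cst|exact: sub].
    congr (_ + _).
      rewrite (@eq_integ _ _ _ _ (fun r => u t * g r + (-1) * (g r * u r))); last first.
        by move=> r _; ring.
      rewrite integD ?integZ ?mulN1r//; try exact: sub.
        by apply: bmZ; exact: sub.
      by apply: bmZ; exact: sub.
    rewrite (@eq_integ _ _ _ _ (fun r => p s * u' s + (-1) * (p r * u' r))); last first.
      by move=> r _; ring.
    rewrite integD//; [|exact: bm_cst|by apply: bmZ; exact: sub].
    by rewrite integ_cst// integZ ?mulN1r//; exact: sub.
  have h2 := integ_chasles as_ st tb bs.
  rewrite /Psi h2 h1 (@integD _ s t)//; [|exact: sub..].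
  by rewrite (pC s t)//; ring.
have thL r : s <= r <= t -> `|th r| <= (M * C + (M * U + P * C)) * (t - s).
  move=> rst; have /andP[sr rt] := rst.
  have rs : 0 <= r - s by rewrite subr_ge0.
  have t1 : `|g r * (u t - u r)| <= M * C * (t - s).
    rewrite normrM -mulrA ler_pM ?gM ?in_ab//.
    rewrite (le_trans (lu _ _))// ler_wpM2l// ger0_norm ?subr_ge0//.
    by rewrite lerD2l lerN2.
  have t2 : `|p s * u' s - p r * u' r| <= (M * U + P * C) * (t - s).
    rewrite (_ : _ - _ = - ((p r - p s) * u' r + p s * (u' r - u' s))); last by ring.
    rewrite normrN (le_trans (ler_normD _ _))// [leRHS]mulrDl lerD// normrM.
      rewrite -mulrA (mulrC U) mulrA ler_pM ?uU ?in_ab//.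
      by rewrite (le_trans (pL r rst))// ler_wpM2l// lerD2r.
    rewrite -mulrA ler_pM ?pP ?in_ab ?lexx//.
    by rewrite (le_trans (lu' _ _))// ler_wpM2l// ger0_norm// lerD2r.
  by rewrite (le_trans (ler_normD _ _))// [leRHS]mulrDl lerD.
rewrite (le_trans (ler_normD _ _))// /K [leRHS]mulrDl lerD//.
  by rewrite expr2 mulrA; apply: ler_norm_integ.
by rewrite normrM -mulrA ler_pM ?pP ?in_ab ?lexx// (le_trans (qu _ _)).
Qed.

End subintervals.

(** * Fourier series in time *)

Section trigonometric_estimates.
Variable R : realType.
Implicit Types (f df : R -> R) (s t x : R).

Lemma mean_value f df : (forall x, is_derive x 1 f (df x)) ->
  forall s t, exists2 c, `|c - s| <= `|t - s| & f t - f s = df c * (t - s).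
Proof.
move=> fdf s t.
have cont (a b : R) : {within `[a, b], continuous f}.
  apply: continuous_subspaceT => x; apply: differentiable_continuous.
  by apply/derivable1_diffP; apply: ex_derive.
case: (leP s t) => [st|/ltW ts].
  have [c] := MVT_segment st (fun x _ => fdf x) (cont s t).
  rewrite in_itv /= => /andP[sc ct] E; exists c => //.
  by rewrite !ger0_norm ?subr_ge0// lerD2r.
have [c] := MVT_segment ts (fun x _ => fdf x) (cont t s).
rewrite in_itv /= => /andP[tc cs] E; exists c.
  by rewrite !(distrC _ s) !ger0_norm ?subr_ge0// lerD2l lerN2.
by rewrite -opprB E -mulrN opprB.
Qed.

Lemma ler_sinB s t : `|sin t - sin s| <= `|t - s|.
Proof.
have [c _ ->] := mean_value (@is_derive_sin R) s t.
rewrite normrM ler_piMl// ler_norml.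
by have := cos_max c; rewrite ler_norml.
Qed.

Lemma ler_cosB s t : `|cos t - cos s| <= `|t - s|.
Proof.
have [c _ ->] := mean_value (@is_derive_cos R) s t.
rewrite normrM normrN ler_piMl// ler_norml.
by have := sin_max c; rewrite ler_norml.
Qed.

Lemma sin_taylor s t : `|sin t - sin s - cos s * (t - s)| <= (t - s) ^+ 2.
Proof.
have [c cs ->] := mean_value (@is_derive_sin R) s t.
rewrite -mulrBl normrM -(real_normK (num_real (t - s))) expr2 ler_wpM2r//.
exact: le_trans (ler_cosB _ _) cs.
Qed.

Lemma cos_taylor s t : `|cos t - cos s - (- sin s) * (t - s)| <= (t - s) ^+ 2.
Proof.
have [c cs ->] := mean_value (@is_derive_cos R) s t.
rewrite -mulrBl normrM -(real_normK (num_real (t - s))) expr2 ler_wpM2r//.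
rewrite -opprD normrN; exact: le_trans (ler_sinB _ _) cs.
Qed.

(** The constant is not sharp; it only matters that sin x is comparable to x. *)
Lemma ler_norm_sin x : `|x| <= pi / 2 -> `|x| <= 8 * `|sin x|.
Proof.
wlog x0 : x / 0 <= x => [H|].
  case: (leP 0 x) => [|/ltW x0]; first exact: H.
  by rewrite -(normrN x) -(normrN (sin x)) -sinN; apply: H; rewrite oppr_ge0.
rewrite ger0_norm// => xpi.
have p2 := @pihalf_lt2 R; have p0 := @pi_gt0 R; have p1 := @pihalf_ge1 R.
have half (y : R) : 0 <= y -> y <= 2^-1 -> y / 2 <= sin y.
  move=> y0 y1; have := sin_taylor 0 y.
  rewrite sin0 cos0 !subr0 mul1r ler_norml expr2 => /andP[h _]; nra.
case: (leP x 2^-1) => x1.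
  have := half x x0 x1; have := ler_norm (sin x); lra.
have h : sin (2^-1) <= sin x.
  rewrite ltW// ltr_sin//; rewrite in_itv /=; apply/andP; split; lra.
have := half 2^-1 _ (lexx _); rewrite invr_ge0 => /(_ (ler0n _ _)).
have := ler_norm (sin x); lra.
Qed.

Lemma expiD s t : expi (s + t) = expi s * expi t :> R[i].
Proof.
rewrite /expi cosD sinD; apply/eqP; rewrite eq_complex /= eqxx /=.
by rewrite addrC (mulrC (sin s)) eqxx.
Qed.

Lemma expi0 : expi 0 = 1 :> R[i].
Proof. by rewrite /expi cos0 sin0. Qed.

Lemma expiN s : expi (- s) = (expi s)^* :> R[i].
Proof. by rewrite /expi cosN sinN. Qed.

Lemma sqnorm_expi s : sqnorm (expi s : R[i]) = 1.
Proof. by rewrite /sqnorm /= cos2Dsin2. Qed.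

Lemma expi_period (n : int) : expi (n%:~R * (2 * pi)) = 1 :> R[i].
Proof.
have nat (m : nat) : expi (m%:R * (2 * pi)) = 1 :> R[i].
  elim: m => [|m ih]; first by rewrite mul0r expi0.
  rewrite -natr1 mulrDl mul1r expiD ih mul1r /expi.
  by rewrite mulr_natl cos2pi sin2pi.
case: n => n; first exact: nat.
rewrite NegzE mulrNz mulNr expiN nat.
by apply/eqP; rewrite eq_complex /= oppr0 !eqxx.
Qed.

End trigonometric_estimates.

Section fourier.
Variables (R : realType) (tau : R).
Hypothesis tau0 : 0 < tau.
Let omega : R := 2 * pi / tau.
Local Notation bm := (bounded_measurable 0 tau).
Implicit Types (f g : R -> R) (phi psi : R -> R[i]) (n m : int) (c d w : R[i]).

Let le0tau : 0 <= tau. Proof. exact: ltW. Qed.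

Let omega_gt0 : 0 < omega.
Proof. by rewrite divr_gt0// mulr_gt0// pi_gt0. Qed.

Let omega_tau : omega * tau = 2 * pi.
Proof. by rewrite /omega divfK// gt_eqF. Qed.

(** Normalised so that the modes are orthonormal. *)
Definition mean f : R := tau^-1 * integ 0 tau f.

Lemma eq_mean f g : (forall t, 0 <= t <= tau -> f t = g t) -> mean f = mean g.
Proof. by move=> fg; congr (_ * _); exact: eq_integ. Qed.

Lemma meanD f g : bm f -> bm g -> mean (fun t => f t + g t) = mean f + mean g.
Proof. by move=> bf bg; rewrite /mean integD// mulrDr. Qed.

Lemma meanZ (c : R) f : bm f -> mean (fun t => c * f t) = c * mean f.
Proof. by move=> bf; rewrite /mean integZ// mulrCA. Qed.

Lemma meanN f : bm f -> mean (fun t => - f t) = - mean f.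
Proof.
by move=> bf; rewrite -mulN1r -meanZ//; apply: eq_mean => t _; rewrite mulN1r.
Qed.

Lemma mean_cst (c : R) : mean (fun=> c) = c.
Proof. by rewrite /mean integ_cst// subr0 mulrC mulfK// gt_eqF. Qed.

Lemma le_mean f g : bm f -> bm g -> (forall t, 0 <= t <= tau -> f t <= g t) ->
  mean f <= mean g.
Proof. by move=> bf bg fg; rewrite ler_wpM2l ?invr_ge0//; exact: le_integ. Qed.

Lemma mean_sum (I : Type) (s : seq I) (F : I -> R -> R) : (forall i, bm (F i)) ->
  mean (fun t => \sum_(i <- s) F i t) = \sum_(i <- s) mean (F i).
Proof.
move=> bF; elim: s => [|i s ih].
  by rewrite big_nil -[RHS](mean_cst 0); apply: eq_mean => t _; rewrite big_nil.
rewrite big_cons -ih -meanD//; last exact: bm_sum.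
by apply: eq_mean => t _; rewrite big_cons.
Qed.

Lemma ler_norm_mean f : bm f -> `|mean f| <= mean (fun t => `|f t|).
Proof.
move=> bf; have ba : bm (fun t => `|f t|).
  have [mf [M fM]] := bf; split; first exact: measurableT_comp.
  by exists M => t /fM; rewrite normr_id.
rewrite ler_norml; apply/andP; split.
  rewrite -meanN//; apply: le_mean => //; first exact: bmN.
  by move=> t _; rewrite lerNl -normrN ler_norm.
by apply: le_mean => // t _; exact: ler_norm.
Qed.

Definition cbm phi : Prop :=
  bm (fun t => complex.Re (phi t)) /\ bm (fun t => complex.Im (phi t)).

Lemma eq_cbm phi psi : (forall t, 0 <= t <= tau -> phi t = psi t) -> cbm phi -> cbm psi.
Proof.
by move=> E [b1 b2]; split; [apply: eq_bounded_measurable b1|apply: eq_bounded_measurable b2] => t /E ->.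
Qed.

Lemma cbm_cst c : cbm (fun=> c).
Proof. by split; exact: bm_cst. Qed.

Lemma cbmD phi psi : cbm phi -> cbm psi -> cbm (fun t => phi t + psi t).
Proof.
move=> [a1 a2] [b1 b2]; split.
  by apply: eq_bounded_measurable (bmD a1 b1) => t _; case: (phi t) (psi t) => [? ?] [].
by apply: eq_bounded_measurable (bmD a2 b2) => t _; case: (phi t) (psi t) => [? ?] [].
Qed.

Lemma cbmM phi psi : cbm phi -> cbm psi -> cbm (fun t => phi t * psi t).
Proof.
move=> [a1 a2] [b1 b2]; split.
  by apply: eq_bounded_measurable (bmB (bmM a1 b1) (bmM a2 b2)) => t _; case: (phi t) (psi t) => [? ?] [].
by apply: eq_bounded_measurable (bmD (bmM a1 b2) (bmM a2 b1)) => t _; case: (phi t) (psi t) => [? ?] [].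
Qed.

Lemma cbmZ c phi : cbm phi -> cbm (fun t => c * phi t).
Proof. by move=> bp; apply: cbmM => //; exact: cbm_cst. Qed.

Lemma cbmB phi psi : cbm phi -> cbm psi -> cbm (fun t => phi t - psi t).
Proof.
move=> bp bq; apply: cbmD => //.
by apply: eq_cbm (cbmZ (-1) bq) => t _; rewrite mulN1r.
Qed.

Lemma cbm_sum (I : Type) (s : seq I) (F : I -> R -> R[i]) :
  (forall i, cbm (F i)) -> cbm (fun t => \sum_(i <- s) F i t).
Proof.
move=> bF; elim: s => [|i s ih].
  by apply: eq_cbm (cbm_cst 0) => t _; rewrite big_nil.
by apply: eq_cbm (cbmD (bF i) ih) => t _; rewrite big_cons.
Qed.

Lemma bm_cdot phi psi : cbm phi -> cbm psi -> bm (fun t => cdot (phi t) (psi t)).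
Proof. by move=> [a1 a2] [b1 b2]; apply: bmD; exact: bmM. Qed.

Lemma bm_sqnorm phi : cbm phi -> bm (fun t => sqnorm (phi t)).
Proof.
by move=> bp; apply: eq_bounded_measurable (bm_cdot bp bp) => t _; rewrite cdotzz.
Qed.

Definition mode n (t : R) : R[i] := expi (n%:~R * omega * t).

Lemma mode0 t : mode 0 t = 1.
Proof. by rewrite /mode !mul0r expi0. Qed.

Lemma modeD n m t : mode (n + m) t = mode n t * mode m t.
Proof. by rewrite /mode intrD !mulrDl expiD. Qed.

Lemma modeN n t : mode (- n) t = (mode n t)^*.
Proof. by rewrite /mode mulrNz !mulNr expiN. Qed.

Lemma sqnorm_mode n t : sqnorm (mode n t) = 1.
Proof. exact: sqnorm_expi. Qed.

Lemma mode_tau n : mode n tau = 1.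
Proof. by rewrite /mode -mulrA omega_tau expi_period. Qed.

Lemma cbm_mode n : cbm (mode n).
Proof.
have mlin : measurable_fun `[0, tau]%classic (fun t : R => n%:~R * omega * t).
  by apply: measurable_funM => //; exact: measurable_cst.
split; split.
- apply: (measurableT_comp (f := @cos R)) => //.
  by apply: continuous_measurable_fun; exact: continuous_cos.
- by exists 1 => t _; rewrite /= cos_max.
- apply: (measurableT_comp (f := @sin R)) => //.
  by apply: continuous_measurable_fun; exact: continuous_sin.
- by exists 1 => t _; rewrite /= sin_max.
Qed.

Lemma cbm_cmode c n : cbm (fun t => c * mode n t).
Proof. by apply: cbmZ; exact: cbm_mode. Qed.

Definition fcoef phi n : R[i] :=
  mean (fun t => cdot (phi t) (mode n t)) +i*
  mean (fun t => cdot (phi t) ('i%C * mode n t)).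

(** Testing against an arbitrary constant c treats the two real coordinates at once;
    together with [cdot_inj] it reduces identities between coefficients to
    identities between real means. *)
Lemma cdot_fcoef phi n c : cbm phi ->
  cdot (fcoef phi n) c = mean (fun t => cdot (phi t) (c * mode n t)).
Proof.
move=> bp; have im n' : cbm (fun t => 'i%C * mode n' t) by exact: cbm_cmode.
have b1 := bm_cdot bp (cbm_mode n); have b2 := bm_cdot bp (im n).
rewrite {1}/cdot /= mulrC -meanZ// [X in _ + X]mulrC -meanZ// -meanD; [|exact: bmZ..].
apply: eq_mean => t _; case: c (phi t) (mode n t) => [? ?] [? ?] [? ?].
by rewrite /cdot /=; ring.
Qed.

Lemma cdot_inj z w : (forall c, cdot z c = cdot w c) -> z = w.
Proof.
move=> h; apply/eqP; rewrite eq_complex; have := h 1; have := h 'i%C.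
by rewrite /cdot /= !mulr1 !mulr0 !addr0 !add0r => -> ->; rewrite !eqxx.
Qed.

Lemma eq_fcoef phi psi n : (forall t, 0 <= t <= tau -> phi t = psi t) ->
  fcoef phi n = fcoef psi n.
Proof.
by move=> E; rewrite /fcoef; congr (_ +i* _); apply: eq_mean => t /E ->.
Qed.

Lemma fcoefD phi psi n : cbm phi -> cbm psi ->
  fcoef (fun t => phi t + psi t) n = fcoef phi n + fcoef psi n.
Proof.
move=> bp bq; apply: cdot_inj => c; rewrite cdotDl !cdot_fcoef//; last exact: cbmD.
have bc := cbm_cmode c n.
rewrite -meanD; [|exact: bm_cdot..].
by apply: eq_mean => t _; rewrite cdotDl.
Qed.

Lemma fcoefZ d phi n : cbm phi -> fcoef (fun t => d * phi t) n = d * fcoef phi n.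
Proof.
move=> bp; apply: cdot_inj => c; rewrite cdotMl !cdot_fcoef//; last exact: cbmZ.
by apply: eq_mean => t _; rewrite cdotMl mulrA.
Qed.

Lemma fcoefB phi psi n : cbm phi -> cbm psi ->
  fcoef (fun t => phi t - psi t) n = fcoef phi n - fcoef psi n.
Proof.
move=> bp bq; rewrite -mulN1r -fcoefZ// -fcoefD//; last exact: cbmZ.
by apply: eq_fcoef => t _; rewrite mulN1r.
Qed.

Lemma fcoef_sum (I : Type) (s : seq I) (F : I -> R -> R[i]) n :
  (forall i, cbm (F i)) ->
  fcoef (fun t => \sum_(i <- s) F i t) n = \sum_(i <- s) fcoef (F i) n.
Proof.
move=> bF; elim: s => [|i s ih].
  rewrite big_nil; apply: cdot_inj => c; rewrite cdot_fcoef//.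
    by rewrite cdot0l -[RHS]mean_cst; apply: eq_mean => t _; rewrite big_nil cdot0l.
  by apply: eq_cbm (cbm_cst 0) => t _; rewrite big_nil.
rewrite big_cons -ih -fcoefD//; last exact: cbm_sum.
by apply: eq_fcoef => t _; rewrite big_cons.
Qed.

Lemma fcoef_modeM phi n m : cbm phi ->
  fcoef (fun t => mode m t * phi t) n = fcoef phi (n - m).
Proof.
move=> bp; apply: cdot_inj => c; rewrite !cdot_fcoef//; last first.
  by apply: cbmM => //; exact: cbm_mode.
by apply: eq_mean => t _; rewrite cdotMl modeD modeN; congr cdot; ring.
Qed.

(** Integration by parts; the boundary terms cancel by periodicity. *)
Lemma fcoef_derivative phi (g : R -> R[i]) n : cbm g ->
  (forall t, 0 <= t <= tau ->
     phi t = phi 0 + (0 +i* 1) * cintegral `[0%R, t]%classic g) ->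
  phi tau = phi 0 ->
  cbm phi /\ fcoef g n = (n%:~R * omega)%:C * fcoef phi n.
Proof.
move=> [bg1 bg2] phiE phiT.
have reE t : 0 <= t <= tau -> complex.Re (phi t) =
    complex.Re (phi 0) - integ 0 t (fun r => complex.Im (g r)).
  by move=> /phiE ->; case: (phi 0) => ? ?; rewrite /cintegral /integ /=; ring.
have imE t : 0 <= t <= tau -> complex.Im (phi t) =
    complex.Im (phi 0) + integ 0 t (fun r => complex.Re (g r)).
  by move=> /phiE ->; case: (phi 0) => ? ?; rewrite /cintegral /integ /=; ring.
have bphi : cbm phi.
  split.
    apply: eq_bounded_measurable (bmB (bm_cst _ _ (complex.Re (phi 0))) (bm_primitive le0tau bg2)) => t /reE ->//.
  by apply: eq_bounded_measurable (bmD (bm_cst _ _ (complex.Im (phi 0))) (bm_primitive le0tau bg1)) => t /imE ->.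
split=> //; apply: cdot_inj => c; rewrite cdotRl !cdot_fcoef//.
pose k : R := n%:~R * omega.
have bms : bm (fun t => sin (k * t)) by have [] := cbm_mode n.
have bmc : bm (fun t => cos (k * t)) by have [] := cbm_mode n.
(* u A B runs through the two real coordinates of c * mode n. *)
pose u (A B : R) (t : R) := A * cos (k * t) + B * sin (k * t).
have bu A B : bm (u A B) by apply: bmD; exact: bmZ.
have bu' A B : bm (fun t => k * u B (- A) t) by exact: bmZ.
pose C (A B : R) := (`|A| + `|B|) * (`|k| + k ^+ 2).
have C1 A B : (`|A| + `|B|) * `|k| <= C A B by rewrite ler_wpM2l ?addr_ge0// lerDl sqr_ge0.
have C2 A B : (`|A| + `|B|) * k ^+ 2 <= C A B by rewrite ler_wpM2l ?addr_ge0// lerDr.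
have lip A B s t : `|u A B t - u A B s| <= (`|A| + `|B|) * `|k| * `|t - s|.
  rewrite /u (_ : _ - _ = A * (cos (k * t) - cos (k * s)) + B * (sin (k * t) - sin (k * s))); last by ring.
  rewrite (_ : _ * `|t - s| = (`|A| + `|B|) * `|k * t - k * s|); last first.
    by rewrite -mulrA -normrM mulrBr.
  rewrite (le_trans (ler_normD _ _))// !normrM [leRHS]mulrDl.
  by apply: lerD; apply: ler_wpM2l => //; [exact: ler_cosB|exact: ler_sinB].
have L1 A B s t : `|u A B t - u A B s| <= C A B * `|t - s|.
  by rewrite (le_trans (lip _ _ _ _))// ler_wpM2r.
have L2 A B s t : `|k * u B (- A) t - k * u B (- A) s| <= C A B * `|t - s|.
  rewrite -mulrBr normrM; apply: (@le_trans _ _ (`|k| * ((`|B| + `|- A|) * `|k| * `|t - s|))).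
    by rewrite ler_wpM2l.
  rewrite normrN (_ : _ * _ = (`|A| + `|B|) * (`|k| ^+ 2) * `|t - s|); last by ring.
  by rewrite real_normK ?num_real// ler_wpM2r.
have L3 A B s t : `|u A B t - u A B s - k * u B (- A) s * (t - s)| <= C A B * (t - s) ^+ 2.
  rewrite /u (_ : _ - _ - _ = A * (cos (k * t) - cos (k * s) - (- sin (k * s)) * (k * t - k * s)) +
     B * (sin (k * t) - sin (k * s) - cos (k * s) * (k * t - k * s))); last by ring.
  rewrite (le_trans (ler_normD _ _))// !normrM.
  apply: (@le_trans _ _ ((`|A| + `|B|) * (k * t - k * s) ^+ 2)).
    rewrite [leRHS]mulrDl.
    by apply: lerD; apply: ler_wpM2l => //; [exact: cos_taylor|exact: sin_taylor].
  by rewrite -mulrBr exprMn mulrA ler_wpM2r ?sqr_ge0.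
have uper A B : u A B tau = u A B 0.
  have := mode_tau n; rewrite /mode -/k /expi => -[h1 h2].
  by rewrite /u mulr0 h1 h2 cos0 sin0.
have ibp A B (p h : R -> R) : bm h -> (forall t, 0 <= t <= tau -> p t = p 0 + integ 0 t h) ->
    p tau = p 0 -> mean (fun t => h t * u A B t) = - mean (fun t => p t * (k * u B (- A) t)).
  move=> bh pE pT.
  have := integration_by_parts_bounded le0tau bh pE (bu A B) (bu' A B) (@L1 A B) (@L2 A B) (@L3 A B).
  rewrite uper pT subrr => /eqP; rewrite addr_eq0 => /eqP E.
  by rewrite /mean E mulrN.
have e1 A B := ibp A B (fun t => complex.Im (phi t)) _ bg1 imE (congr1 (@complex.Im R) phiT).
have e2 A B : mean (fun t => complex.Im (g t) * u A B t) =
    - mean (fun t => - complex.Re (phi t) * (k * u B (- A) t)).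
  apply: ibp => //; last by rewrite phiT.
  by move=> t /reE ->; rewrite opprB addrC.
have bre := bphi.1; have bim := bphi.2.
case: c => c1 c2.
rewrite (@eq_mean _ (fun t => complex.Re (g t) * u c1 (- c2) t + complex.Im (g t) * u c2 c1 t)); last first.
  by move=> t _; rewrite /cdot /u /=; rewrite -/k; ring.
rewrite meanD; [|exact: bmM..]; rewrite e1 e2.
have b1 := bmM bim (bu' c1 (- c2)); have b2 := bmM (bmN bre) (bu' c2 c1).
rewrite -opprD -meanD// -meanN; last exact: bmD.
rewrite -meanZ; last exact/bm_cdot/cbm_cmode.
by apply: eq_mean => t _; rewrite /cdot /u /mode /= -/k; ring.
Qed.

Lemma mean_mode n c d : n != 0 -> mean (fun t => cdot (c * mode n t) d) = 0.
Proof.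
move=> n0; pose one : R -> R[i] := fun=> 1.
have b0 : cbm (fun=> 0) by exact: cbm_cst.
have [|//|_] := @fcoef_derivative one (fun=> 0) (- n) b0.
  move=> t _; rewrite /cintegral /= /Rintegral integral0 /=.
  by rewrite complexr0 mulr0 addr0.
have z : fcoef (fun=> 0) (- n) = 0.
  apply: cdot_inj => e; rewrite cdot_fcoef// cdot0l -[RHS]mean_cst.
  by apply: eq_mean => t _; rewrite cdot0l.
rewrite z => /esym/eqP; rewrite mulf_eq0 => /orP[/eqP[]/eqP|/eqP h].
  by rewrite mulf_eq0 intr_eq0 oppr_eq0 (negbTE n0) gt_eqF.
transitivity (cdot (fcoef one (- n)) (c^* * d)); last by rewrite h cdot0l.
rewrite cdot_fcoef; last exact: cbm_cst.
apply: eq_mean => t _; rewrite /one modeN.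
case: c d (mode n t) => [? ?] [? ?] [? ?]; rewrite /cdot /=; ring.
Qed.

Lemma mean_modes n m c d :
  mean (fun t => cdot (c * mode n t) (d * mode m t)) = (n == m)%:R * cdot c d.
Proof.
have E t : cdot (c * mode n t) (d * mode m t) = cdot (c * mode (n - m) t) d.
  by rewrite [RHS]cdotMl [LHS]cdotC cdotMl [RHS]cdotC modeD modeN -!cdotMl;
   case: c d (mode n t) (mode m t) => [? ?] [? ?] [? ?] [? ?]; rewrite /cdot /=; ring.
rewrite (eq_mean (fun t _ => E t)); case: eqP => [->|/eqP nm].
  rewrite mul1r -[RHS]mean_cst; apply: eq_mean => t _.
  by rewrite subrr mode0 mulr1.
by rewrite mul0r mean_mode// subr_eq0.
Qed.

Definition trig (s : seq int) (x : int -> R[i]) (t : R) : R[i] :=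
  \sum_(n <- s) x n * mode n t.

Lemma cbm_trig s x : cbm (trig s x).
Proof. by apply: cbm_sum => n; exact: cbm_cmode. Qed.

Lemma mean_trig phi s (x : int -> R[i]) : cbm phi ->
  mean (fun t => cdot (phi t) (trig s x t)) = \sum_(n <- s) cdot (fcoef phi n) (x n).
Proof.
move=> bp; transitivity (mean (fun t => \sum_(n <- s) cdot (phi t) (x n * mode n t))).
  by apply: eq_mean => t _; rewrite cdot_sumr.
rewrite mean_sum; last by move=> n; exact/bm_cdot/cbm_cmode.
by apply: eq_bigr => n _; rewrite cdot_fcoef.
Qed.

Lemma fcoef_trig s x n : uniq s ->
  fcoef (trig s x) n = if n \in s then x n else 0.
Proof.
move=> us; apply: cdot_inj => c; rewrite cdot_fcoef; last exact: cbm_trig.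
transitivity (mean (fun t => \sum_(m <- s) cdot (x m * mode m t) (c * mode n t))).
  by apply: eq_mean => t _; rewrite cdot_suml.
rewrite mean_sum; last by move=> m; apply: bm_cdot; exact: cbm_cmode.
under eq_bigr do rewrite mean_modes.
case: ifPn => ns.
  rewrite (bigD1_seq n)//= eqxx mul1r big1 ?addr0// => m /negbTE ->.
  by rewrite mul0r.
rewrite cdot0l big_seq big1// => m ms.
by case: eqP => [mn|]; rewrite ?mul0r//; rewrite -mn ms in ns.
Qed.

Lemma mean_sqnorm_trig s x : uniq s ->
  mean (fun t => sqnorm (trig s x t)) = \sum_(n <- s) sqnorm (x n).
Proof.
move=> us; rewrite -(eq_mean (fun t _ => cdotzz (trig s x t))).
rewrite mean_trig; last exact: cbm_trig.
by rewrite !big_seq; apply: eq_bigr => n ns; rewrite fcoef_trig// ns cdotzz.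
Qed.

(** Pythagoras: the residual is orthogonal to the modes in s. *)
Lemma mean_sqnorm_residual phi s : cbm phi -> uniq s ->
  mean (fun t => sqnorm (phi t - trig s (fcoef phi) t)) =
  mean (fun t => sqnorm (phi t)) - \sum_(n <- s) sqnorm (fcoef phi n).
Proof.
move=> bp us; have bt := cbm_trig s (fcoef phi).
transitivity (mean (fun t => sqnorm (phi t) +
   ((-2) * cdot (phi t) (trig s (fcoef phi) t) + sqnorm (trig s (fcoef phi) t)))).
  by apply: eq_mean => t _; rewrite sqnormD sqnormN cdotNr; ring.
have b1 := bm_sqnorm bp; have b2 := bm_sqnorm bt; have b3 := bm_cdot bp bt.
rewrite meanD//; last by apply: bmD => //; exact: bmZ.
rewrite [X in _ + X]meanD//; last exact: bmZ.
rewrite meanZ// mean_trig// mean_sqnorm_trig//.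
under eq_bigr do rewrite cdotzz.
ring.
Qed.

Lemma bessel phi s : cbm phi -> uniq s ->
  \sum_(n <- s) sqnorm (fcoef phi n) <= mean (fun t => sqnorm (phi t)).
Proof.
move=> bp us; rewrite -subr_ge0 -mean_sqnorm_residual// -[leLHS]mean_cst.
apply: le_mean; first exact: bm_cst.
  by apply/bm_sqnorm/cbmB => //; exact: cbm_trig.
by move=> t _; exact: sqnorm_ge0.
Qed.

End fourier.

Section fourier_convergence.
Variables (R : realType) (tau : R).
Hypothesis tau0 : 0 < tau.
Let omega : R := 2 * pi / tau.
Local Notation bm := (bounded_measurable 0 tau).
Local Notation cbm := (cbm tau).
Local Notation mean := (mean tau).
Local Notation mode := (mode tau).
Local Notation fcoef := (fcoef tau).
Local Notation trig := (trig tau).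
Implicit Types (p : R -> R) (phi psi g : R -> R[i]) (n m : int) (k N M : nat).

Let omega_gt0 : 0 < omega.
Proof. by rewrite divr_gt0// mulr_gt0// pi_gt0. Qed.

Let omega_tau : omega * tau = 2 * pi.
Proof. by rewrite /omega divfK// gt_eqF. Qed.

Definition pos_modes N : seq int := [seq Posz k | k <- iota 0 N].
(** As Negz k stands for - (k + 1), these are the modes from - N to - 1, against 0
    to N - 1 in the other half. *)
Definition neg_modes N : seq int := [seq Negz k | k <- iota 0 N].
Definition modes N : seq int := pos_modes N ++ neg_modes N.

Lemma pos_modes_uniq N : uniq (pos_modes N).
Proof. by rewrite map_inj_uniq ?iota_uniq// => i j []. Qed.

Lemma neg_modes_uniq N : uniq (neg_modes N).
Proof. by rewrite map_inj_uniq ?iota_uniq// => i j []. Qed.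

Lemma modes_uniq N : uniq (modes N).
Proof.
rewrite cat_uniq pos_modes_uniq neg_modes_uniq andbT /=.
by apply/hasPn => _ /mapP[k _ ->]; apply/negP => /mapP[].
Qed.

(** The inequality of Cauchy and Schwarz, by induction on the list. *)
Lemma sqnorm_sum_weighted (I : Type) (s : seq I) (c : I -> R) (z : I -> R[i]) :
  sqnorm (\sum_(i <- s) (c i)%:C * z i) <=
  (\sum_(i <- s) c i ^+ 2) * (\sum_(i <- s) sqnorm (z i)).
Proof.
elim: s => [|i s ih]; first by rewrite !big_nil sqnorm0 mul0r.
rewrite !big_cons sqnormD sqnormM sqnormR cdotRl.
set S := \sum_(j <- s) (c j)%:C * z j in ih *.
set A := \sum_(j <- s) c j ^+ 2 in ih *; set Z := \sum_(j <- s) sqnorm (z j) in ih *.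
have A0 : 0 <= A by apply: sumr_ge0 => j _; exact: sqr_ge0.
have Z0 : 0 <= Z by apply: sumr_ge0 => j _; exact: sqnorm_ge0.
have zi := sqnorm_ge0 (z i).
suff : 2 * (c i * cdot (z i) S) <= c i ^+ 2 * Z + A * sqnorm (z i) by lra.
have [A00|A1] := eqVneq A 0.
  have -> : S = 0.
    by apply: sqnorm_eq0; apply/eqP; rewrite eq_le sqnorm_ge0 andbT (le_trans ih)// A00 mul0r.
  by rewrite cdot0r !mulr0 A00 mul0r addr0 mulr_ge0// sqr_ge0.
have Ap : 0 < A by rewrite lt_neqAle eq_sym A1.
have := ler_cdot (z i) ((c i)%:C * S) Ap; rewrite ler_norml cdotRr sqnormM sqnormR.
move=> /andP[_ h]; have : A^-1 * (c i ^+ 2 * sqnorm S) <= c i ^+ 2 * Z.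
  rewrite mulrCA ler_wpM2l ?sqr_ge0//.
  by rewrite ler_pdivrMl.
lra.
Qed.

(** Comparison with the telescoping sum of 1 / i - 1 / (i + 1). *)
Lemma sum_inverse_squares N k : (0 < N)%N ->
  \sum_(i <- iota N k) (i%:R ^+ 2)^-1 <= 2 * (N%:R^-1 - (N + k)%:R^-1) :> R.
Proof.
elim: k N => [|k ih] N N0; first by rewrite big_nil addn0 subrr mulr0.
rewrite /= big_cons addnS -addSn; have := ih N.+1 isT.
have n0 : 0 < N%:R :> R by rewrite ltr0n.
have n1 : 1 <= N%:R :> R by rewrite ler1n.
suff : (N%:R ^+ 2)^-1 <= 2 * (N%:R^-1 - N.+1%:R^-1) :> R.
  move: (\sum_(_ <- _) _) ((N.+1 + k)%:R^-1) (N.+1%:R^-1) (N%:R ^- 2) => S u v w; lra.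
rewrite -natr1 (_ : _ * _ = 2 * N%:R / (N%:R + 1) / N%:R ^+ 2); last first.
  by field; rewrite !gt_eqF// ltr_wpDl.
rewrite ler_pdivlMr ?exprn_gt0// mulVf ?expf_neq0 ?gt_eqF//.
by rewrite ler_pdivlMr ?ltr_wpDl// mul1r; lra.
Qed.

Section one_function.
Variables (phi g : R -> R[i]).
Hypothesis bg : cbm g.
Hypothesis phiE : forall t, 0 <= t <= tau ->
  phi t = phi 0 + (0 +i* 1) * cintegral `[0%R, t]%classic g.
Hypothesis phi_periodic : phi tau = phi 0.

Let bphi : cbm phi. Proof. by have [] := fcoef_derivative tau0 0 bg phiE phi_periodic. Qed.

(** The coefficients of phi are those of its derivative g divided by n omega;
    Cauchy-Schwarz, the sum of the inverse squares from N on and the inequality of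
    Bessel for g give the bound. *)
Lemma trig_modes_increment N k t : (0 < N)%N ->
  sqnorm (trig (modes (N + k)) (fcoef phi) t - trig (modes N) (fcoef phi) t) <=
  4 / (omega ^+ 2 * N%:R) * mean (fun t => sqnorm (g t)).
Proof.
move=> N0; pose s : seq int := [seq Posz i | i <- iota N k] ++ [seq Negz i | i <- iota N k].
have us : uniq s.
  rewrite cat_uniq !map_inj_uniq ?iota_uniq//=; try by move=> i j [].
  by rewrite andbT; apply/hasPn => _ /mapP[j _ ->]; apply/negP => /mapP[].
have -> : trig (modes (N + k)) (fcoef phi) t - trig (modes N) (fcoef phi) t =
    \sum_(n <- s) ((n%:~R * omega)^-1)%:C * (fcoef g n * mode n t).
  transitivity (\sum_(n <- s) fcoef phi n * mode n t).
    rewrite /trig /modes /pos_modes /neg_modes !iotaD !map_cat !big_cat /= add0n.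
    by ring.
  rewrite big_seq [RHS]big_seq; apply: eq_bigr => n ns.
  have n0 : n != 0.
    move: ns; rewrite mem_cat => /orP[/mapP[i iN ->]|/mapP[i _ ->]//].
    by move: iN; rewrite mem_iota => /andP[Ni _]; rewrite -lt0n (leq_trans N0 Ni).
  have [_ ->] := fcoef_derivative tau0 n bg phiE phi_periodic.
  rewrite mulrA mulrA -(rmorphM (real_complex R)) mulVf ?mul1r//.
  by rewrite mulf_neq0 ?intr_eq0// gt_eqF.
apply: le_trans (sqnorm_sum_weighted _ _ _) _.
apply: ler_pM.
- by apply: sumr_ge0 => n _; exact: sqr_ge0.
- by apply: sumr_ge0 => n _; exact: sqnorm_ge0.
- have n0 : 0 < N%:R :> R by rewrite ltr0n.
  have h : \sum_(n <- s) (n%:~R * omega)^-1 ^+ 2 <=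
      omega^-1 ^+ 2 * (2 * \sum_(i <- iota N k) (i%:R ^+ 2)^-1).
    rewrite big_cat /= !big_map mulrDl mul1r mulrDr; apply: lerD.
      rewrite mulr_sumr; apply: ler_sum => i _.
      by rewrite invfM exprMn mulrC !exprVn.
    rewrite mulr_sumr big_seq [leRHS]big_seq; apply: ler_sum => i.
    rewrite mem_iota => /andP[Ni _].
    have i0 : 0 < i%:R :> R by rewrite ltr0n (leq_trans N0 Ni).
    rewrite NegzE mulrNz mulNr invrN sqrrN invfM exprMn mulrC ler_wpM2l ?sqr_ge0//.
    rewrite [leLHS]exprVn lef_pV2 ?posrE ?exprn_gt0// ler_pXn2r ?nnegrE//.
    by rewrite ler_nat.
  apply: (le_trans h); have := sum_inverse_squares k N0.
  have : 0 <= (N + k)%:R^-1 :> R by rewrite invr_ge0.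
  set S := \sum_(_ <- _) _ => h1 h2.
  rewrite (_ : 4 / _ = omega^-1 ^+ 2 * (2 * (2 * N%:R^-1))); last first.
    by field; rewrite !gt_eqF.
  by rewrite ler_wpM2l ?sqr_ge0//; lra.
- rewrite (eq_bigr (fun n => sqnorm (fcoef g n))); first exact: bessel.
  by move=> n _; rewrite sqnormM sqnorm_mode mulr1.
Qed.

(** The right-hand side is comparable to C times the distance of s and t on the
    circle; past half a period the path through the endpoint is the shorter one. *)
Lemma ler_periodic_lipschitz p (C : R) s t :
  (forall s t, 0 <= s -> s <= t -> t <= tau -> `|p t - p s| <= C * (t - s)) ->
  p tau = p 0 -> 0 <= s <= tau -> 0 <= t <= tau ->
  `|p t - p s| <= 16 * C / omega * `|sin (omega * (t - s) / 2)|.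
Proof.
move=> pC pT.
wlog st : s t / s <= t => [H hs ht|/andP[s0 _] /andP[_ tt]].
  have [|/ltW ts] := leP s t; first by move=> st; exact: H.
  rewrite distrC -(normrN (sin _)) -sinN.
  rewrite (_ : - (omega * (t - s) / 2) = omega * (s - t) / 2); last by ring.
  exact: H.
have C0 : 0 <= C.
  have := pC 0 tau (lexx _) (ltW tau0) (lexx _); rewrite pT subrr normr0 subr0.
  by rewrite pmulr_lge0.
set x := omega * (t - s) / 2.
have co : 0 <= 2 * C / omega by apply: divr_ge0; [exact: mulr_ge0|exact: ltW].
have key (y : R) : 0 <= y -> y <= pi / 2 -> `|p t - p s| <= 2 * C / omega * y ->
    `|sin y| = `|sin x| -> `|p t - p s| <= 16 * C / omega * `|sin x|.
  move=> y0 ypi h sy; apply: (le_trans h).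
  have := ler_norm_sin; move=> /(_ R y); rewrite ger0_norm// sy => /(_ ypi) h'.
  rewrite (_ : 16 * C / omega * _ = 2 * C / omega * (8 * `|sin x|)); last by ring.
  by rewrite ler_wpM2l.
have x0 : 0 <= x.
  by apply: divr_ge0 => //; apply: mulr_ge0; [exact: ltW|rewrite subr_ge0].
have xE : 2 / omega * x = t - s by rewrite /x; field; rewrite gt_eqF.
have [xpi|/ltW xpi] := leP x (pi / 2).
  apply: (key x) => //; rewrite (_ : _ * x = C * (2 / omega * x)); last by ring.
  by rewrite xE; exact: pC.
have xlepi : x <= pi.
  have : omega * (t - s) <= omega * tau.
    by apply: ler_wpM2l; [exact: ltW|lra].
  by rewrite omega_tau /x; lra.
apply: (key (pi - x)).
- by rewrite subr_ge0.
- lra.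
- have -> : p t - p s = (p 0 - p s) - (p tau - p t) by rewrite pT; ring.
  have -> : 2 * C / omega * (pi - x) = C * (tau - t) + C * (s - 0).
    have pE : pi = omega * tau / 2 by rewrite omega_tau mulrAC divff ?mul1r// pnatr_eq0.
    by rewrite pE /x; field; rewrite gt_eqF.
  rewrite addrC (le_trans (ler_normD _ _))// lerD//.
    by rewrite normrN; apply: pC => //; apply: le_trans st.
  by rewrite distrC; apply: pC => //; apply: le_trans tt.
- by rewrite addrC sinDpi sinN opprK.
Qed.

(** The function (phi - phi t0) / (mode 1 (t - t0) - 1) is bounded, and multiplying
    it by the denominator makes the partial Fourier sums of phi - phi t0 at t0
    telescope. *)
Lemma fourier_quotient t0 : 0 <= t0 <= tau ->
  exists2 psi, cbm psi & forall t, 0 <= t <= tau ->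
    phi t - phi t0 = (mode 1 t * mode (-1) t0 - 1) * psi t.
Proof.
move=> ht0; pose den t := mode 1 t * mode (-1) t0 - 1.
have cden : cbm den.
  apply: cbmB; last exact: cbm_cst.
  by apply: cbmM; [exact: cbm_mode|exact: cbm_cst].
have denE t : sqnorm (den t) = 4 * sin (omega * (t - t0) / 2) ^+ 2.
  have -> : den t = expi (omega * (t - t0)) - 1.
    rewrite /den /mode -expiD; congr (expi _ - 1); rewrite /omega mulrNz; ring.
  set x := omega * (t - t0) / 2; have -> : omega * (t - t0) = x *+ 2.
    by rewrite /x -mulr_natr divfK.
  rewrite /sqnorm /= subr0.
  rewrite (_ : _ + _ = cos (x *+ 2) ^+ 2 + sin (x *+ 2) ^+ 2 + 1 - 2 * cos (x *+ 2)).
    by rewrite cos2Dsin2 cos_mulr2n; have := cos2Dsin2 x; lra.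
  by ring.
have [[mg1 [M1 gM1]] [mg2 [M2 gM2]]] := bg.
pose M := M1 + M2.
have M10 : 0 <= M1 by have := gM1 0; rewrite lexx (ltW tau0) => /(_ isT); apply: le_trans.
have M20 : 0 <= M2 by have := gM2 0; rewrite lexx (ltW tau0) => /(_ isT); apply: le_trans.
have incr (h : R -> R) (c : R) : bm h -> (forall t, 0 <= t <= tau -> `|h t| <= M) ->
    forall s t, 0 <= s -> s <= t -> t <= tau ->
    `|integ 0 t h - integ 0 s h| <= M * (t - s).
  move=> bh hM s t s0 st tt; rewrite (integ_chasles s0 st tt bh) addrAC subrr add0r.
  apply: ler_norm_integ => //; first exact: bounded_measurableS bh.
  by move=> r /andP[sr rt]; apply: hM; rewrite (le_trans s0 sr) (le_trans rt tt).
have lre s t : 0 <= s -> s <= t -> t <= tau ->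
    `|complex.Re (phi t) - complex.Re (phi s)| <= M * (t - s).
  move=> s0 st tt; rewrite (phiE (t := t)) ?tt ?(le_trans s0 st)// (phiE (t := s)); last first.
    by rewrite s0 (le_trans st tt).
  have := incr (fun r => complex.Im (g r)) 0 bg.2 _ s t s0 st tt.
  have hM r : 0 <= r <= tau -> `|complex.Im (g r)| <= M.
    by move=> /gM2 h; rewrite (le_trans h)// lerDr.
  move=> /(_ hM); rewrite -normrN; congr (_ <= _); congr (`| _ |).
  by rewrite /integ /cintegral /=; case: (phi 0) => ? ? /=; ring.
have lim s t : 0 <= s -> s <= t -> t <= tau ->
    `|complex.Im (phi t) - complex.Im (phi s)| <= M * (t - s).
  move=> s0 st tt; rewrite (phiE (t := t)) ?tt ?(le_trans s0 st)// (phiE (t := s)); last first.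
    by rewrite s0 (le_trans st tt).
  have := incr (fun r => complex.Re (g r)) 0 bg.1 _ s t s0 st tt.
  have hM r : 0 <= r <= tau -> `|complex.Re (g r)| <= M.
    by move=> /gM1 h; rewrite (le_trans h)// lerDl.
  move=> /(_ hM); congr (_ <= _); congr (`| _ |).
  by rewrite /integ /cintegral /=; case: (phi 0) => ? ? /=; ring.
pose K := 16 * M / omega.
have numE t : 0 <= t <= tau -> sqnorm (phi t - phi t0) <= K ^+ 2 / 2 * sqnorm (den t).
  move=> ht; rewrite denE; set S := sin _.
  have h1 := ler_periodic_lipschitz lre (congr1 (@complex.Re R) phi_periodic) ht0 ht.
  have h2 := ler_periodic_lipschitz lim (congr1 (@complex.Im R) phi_periodic) ht0 ht.
  rewrite -/K -/S in h1 h2.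
  have sq (y : R) : `|y| <= K * `|S| -> y ^+ 2 <= K ^+ 2 * S ^+ 2.
    move=> h; rewrite -(real_normK (num_real y)) -(real_normK (num_real S)) -exprMn.
    by rewrite ler_pXn2r ?nnegrE// (le_trans _ h).
  have := sq _ h1; have := sq _ h2; rewrite /sqnorm.
  case: (phi t) (phi t0) => [a b] [a' b'] /=; lra.
have denD t : den t = mode 1 t * mode (-1) t0 - 1 by [].
clearbody den; exists (fun t => (phi t - phi t0) * (den t)^-1).
  have mnum : cbm (fun t => phi t - phi t0) by apply: cbmB => //; exact: cbm_cst.
  have [[mn1 _] [mn2 _]] := mnum; have [[md1 _] [md2 _]] := cden.
  have msq : measurable_fun `[0, tau]%classic (fun t => (sqnorm (den t))^-1).
    have [mq _] := bm_sqnorm cden.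
    apply: eq_measurable_fun (measurableT_comp (measurable_powR (-1)) mq) => t _ /=.
    by rewrite powR_inv1// sqnorm_ge0.
  have psiE t : (phi t - phi t0) * (den t)^-1 =
     ((sqnorm (den t))^-1)%:C * ((phi t - phi t0) * (den t)^*).
    rewrite mulrCA; congr (_ * _); case: (den t) => a b; rewrite /sqnorm /=.
    by apply/eqP; rewrite eq_complex /=; apply/andP; split; apply/eqP; rewrite /=; ring.
  have bnd t : 0 <= t <= tau -> sqnorm ((phi t - phi t0) * (den t)^-1) <= K ^+ 2 / 2.
    move=> ht; rewrite psiE sqnormM sqnormR sqnormM sqnormC.
    have := numE t ht; have := sqnorm_ge0 (den t); set a := sqnorm (den t).
    set n := sqnorm (phi t - phi t0) => a0 h.
    have [->|az] := eqVneq a 0; first by rewrite !mulr0 divr_ge0// sqr_ge0.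
    have ap : 0 < a by rewrite lt_neqAle eq_sym az.
    rewrite (_ : _ * _ = n / a); last by field.
    by rewrite ler_pdivrMr.
  have bcomp (y B : R) : y ^+ 2 <= B -> `|y| <= 1 + B.
    by rewrite ler_norml expr2 => h; apply/andP; split; nra.
  split; split.
  - apply: eq_measurable_fun (measurable_funM msq (measurable_funD (measurable_funM mn1 md1) (measurable_funM mn2 md2))) => t _ /=.
    by rewrite psiE; case: (phi t - phi t0) (den t) => [? ?] [? ?] /=; ring.
  - exists (1 + K ^+ 2 / 2) => t /bnd h; apply: bcomp; apply: le_trans h.
    by rewrite /sqnorm lerDl sqr_ge0.
  - apply: eq_measurable_fun (measurable_funM msq (measurable_funB (measurable_funM mn2 md1) (measurable_funM mn1 md2))) => t _ /=.
    by rewrite psiE; case: (phi t - phi t0) (den t) => [? ?] [? ?] /=; ring.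
  - exists (1 + K ^+ 2 / 2) => t /bnd h; apply: bcomp; apply: le_trans h.
    by rewrite /sqnorm lerDr sqr_ge0.
move=> t ht; rewrite -denD; have [d0|d0] := eqVneq (den t) 0; last by rewrite mulrCA divff ?mulr1.
rewrite d0 mul0r; apply: sqnorm_eq0; apply/eqP; rewrite eq_le sqnorm_ge0 andbT.
by have := numE t ht; rewrite d0 sqnorm0 mulr0.
Qed.

Lemma fcoef_cst (c : R[i]) n : fcoef (fun=> c) n = if n == 0 then c else 0.
Proof.
have := @fcoef_trig _ _ tau0 [:: 0] (fun=> c) n isT; rewrite inE => <-.
by apply: eq_fcoef => t _; rewrite /trig big_seq1 mode0 mulr1.
Qed.

(** By [fourier_quotient] the error of the partial sum is a difference of two single
    coefficients of psi, whose squares are summable; so it cannot stay away from 0. *)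
Lemma fourier_pointwise t0 N (e : R) : 0 <= t0 <= tau -> 0 < e -> (0 < N)%N ->
  exists k, sqnorm (phi t0 - trig (modes (N + k)) (fcoef phi) t0) <= e.
Proof.
move=> ht0 e0 N0; have [psi bpsi psiE] := fourier_quotient ht0.
pose A n := fcoef psi n * mode n t0.
have coef n : fcoef phi n * mode n t0 = (if n == 0 then phi t0 else 0) + (A (n - 1) - A n).
  have b1 : cbm (fun t => mode (-1) t0 * (mode 1 t * psi t)).
    by apply: cbmZ; apply: cbmM => //; exact: cbm_mode.
  rewrite (@eq_fcoef _ _ _ (fun t => phi t0 + (mode (-1) t0 * (mode 1 t * psi t) - psi t))); last first.
    by move=> t ht; rewrite -[LHS](subrK (phi t0)) psiE//; ring.
  rewrite fcoefD//; [|exact: cbm_cst|exact: cbmB].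
  rewrite fcoefB// fcoefZ//; last by apply: cbmM => //; exact: cbm_mode.
  rewrite fcoef_modeM// fcoef_cst /A modeD.
  by case: eqP => [->|_]; rewrite ?mode0; ring.
have sumE M : (0 < M)%N -> trig (modes M) (fcoef phi) t0 = phi t0 + (A (Negz M) - A (Posz M.-1)).
  move=> M0; rewrite /trig /modes big_cat /= !big_map.
  have -> : \sum_(j <- iota 0 M) fcoef phi (Posz j) * mode (Posz j) t0 =
      phi t0 + (A (Negz 0) - A (Posz M.-1)).
    case: M M0 => // M _; elim: M => [|M ih]; first by rewrite /= big_seq1 coef.
    rewrite -(addn1 M.+1) iotaD big_cat ih /= big_seq1 coef /= add0r add0n.
    rewrite addn1 (_ : Posz M.+1 - 1 = M); first by ring.
    by rewrite intS addrAC subrr add0r.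
  have -> : \sum_(j <- iota 0 M) fcoef phi (Negz j) * mode (Negz j) t0 = A (Negz M) - A (Negz 0).
    elim: M {M0} => [|M ih]; first by rewrite big_nil subrr.
    rewrite -addn1 iotaD big_cat ih /= big_seq1 coef /= add0r add0n addn1.
    rewrite (_ : Negz M - 1 = Negz M.+1); first by ring.
    by rewrite !NegzE [in RHS]intS opprD addrC.
  by ring.
have sb (s : seq int) : uniq s -> \sum_(n <- s) sqnorm (A n) <= mean (fun t => sqnorm (psi t)).
  move=> us; rewrite (eq_bigr (fun n => sqnorm (fcoef psi n))); first exact: bessel.
  by move=> n _; rewrite /A sqnormM sqnorm_mode mulr1.
set B := mean _ in sb.
apply: contrapT => /forallNP small.
have big M : (N <= M)%N -> e / 2 <= sqnorm (A (Negz M)) + sqnorm (A (Posz M.-1)).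
  move=> NM; rewrite leNgt; apply/negP => h; apply: (small (M - N)%N).
  rewrite subnKC// sumE ?(leq_trans N0)// opprD addNKr -sqnormN opprK.
  by rewrite (le_trans (ler_sqnormD2 _ _))// sqnormN; lra.
pose k := (Num.truncn (4 * B / e)).+1.
have B0 : 0 <= B by have := sb [::] isT; rewrite big_nil.
have h1 : k%:R * (e / 2) <= \sum_(M <- iota N k) (sqnorm (A (Negz M)) + sqnorm (A (Posz M.-1))).
  rewrite (_ : k%:R * _ = \sum_(M <- iota N k) e / 2); last first.
    by rewrite big_const_seq count_predT size_iota iter_addr_0 mulr_natl.
  rewrite big_seq [leRHS]big_seq; apply: ler_sum => M; rewrite mem_iota => /andP[NM _].
  exact: big.
have h2 : \sum_(M <- iota N k) (sqnorm (A (Negz M)) + sqnorm (A (Posz M.-1))) <= B + B.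
  rewrite big_split /=; apply: lerD.
    have := sb [seq Negz M | M <- iota N k]; rewrite big_map; apply.
    by rewrite map_inj_uniq ?iota_uniq// => i j [].
  have := sb [seq Posz M.-1 | M <- iota N k]; rewrite big_map; apply.
  rewrite map_inj_in_uniq ?iota_uniq// => i j; rewrite !mem_iota => /andP[Ni _] /andP[Nj _] [].
  by move: (leq_trans N0 Ni) (leq_trans N0 Nj); case: i {Ni} => // i _; case: j {Nj} => // j _ /= ->.
have h3 : 4 * B / e < k%:R.
  have p : 0 <= 4 * B / e by apply: divr_ge0; [exact: mulr_ge0|exact: ltW].
  by have /andP[] := truncn_itv p.
have : 4 * B < k%:R * e by rewrite -ltr_pdivrMr.
lra.
Qed.

(** Pointwise convergence along some sequence of partial sums, and the uniform bound
    on increments. *)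
Lemma fourier_tail t0 N : 0 <= t0 <= tau -> (0 < N)%N ->
  sqnorm (phi t0 - trig (modes N) (fcoef phi) t0) <=
  4 / (omega ^+ 2 * N%:R) * mean (fun t => sqnorm (g t)).
Proof.
move=> ht0 N0; set B := _ * _.
have B0 : 0 <= B.
  by have := trig_modes_increment 0 0 N0; rewrite addn0 subrr sqnorm0.
apply/ler_addgt0Pr => e e0.
pose r := e / (2 * (B + 1)); have B1 : 0 < B + 1 by rewrite ltr_wpDl.
have r0 : 0 < r by rewrite divr_gt0// mulr_gt0.
have r1 : 0 < 1 + r^-1 by rewrite addr_gt0// invr_gt0.
have d0 : 0 < e / 2 / (1 + r^-1) by rewrite !divr_gt0.
have [k hk] := fourier_pointwise ht0 d0 N0.
have := ler_sqnormD (trig (modes (N + k)) (fcoef phi) t0 - trig (modes N) (fcoef phi) t0)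
  (phi t0 - trig (modes (N + k)) (fcoef phi) t0) r0.
rewrite addrC addrA subrK => /le_trans; apply.
have h1 := trig_modes_increment k t0 N0; rewrite -/B in h1.
have h2 : (1 + r) * sqnorm (trig (modes (N + k)) (fcoef phi) t0 - trig (modes N) (fcoef phi) t0) <= (1 + r) * B.
  by rewrite ler_wpM2l// addr_ge0// ltW.
have h3 : (1 + r^-1) * sqnorm (phi t0 - trig (modes (N + k)) (fcoef phi) t0) <= e / 2.
  by rewrite mulrC -ler_pdivlMr.
have h4 : r * B <= e / 2.
  apply: (@le_trans _ _ (r * (B + 1))); first by rewrite ler_wpM2l ?lerDl// ltW.
  by rewrite /r le_eqVlt; apply/orP; left; apply/eqP; field; rewrite gt_eqF.
by move: h2 h3 h4; rewrite [X in _ <= X -> _]mulrDl mul1r; lra.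
Qed.

End one_function.
End fourier_convergence.

(** * Eigenfunctions through their Fourier coefficients *)

(** The integral of a nonnegative function is a supremum over the simple functions
    below it, which makes monotonicity independent of the measurability of the
    larger function. *)
Lemma ge0_integral_mono d (T : measurableType d) (R : realType)
    (mu : {measure set T -> \bar R}) (D : set T) (f g : T -> \bar R) :
  (forall x, D x -> 0 <= f x)%E -> (forall x, D x -> f x <= g x)%E ->
  (\int[mu]_(x in D) f x <= \int[mu]_(x in D) g x)%E.
Proof.
move=> f0 fg; rewrite !ge0_integralE//; last first.
  by move=> x Dx; apply: le_trans (f0 x Dx) (fg x Dx).
apply: le_ereal_sup => _ [h hf <-]; exists h => // x.
apply: le_trans (hf x) _; rewrite /patch; case: ifPn => // xD.
by apply: fg; exact: set_mem.
Qed.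

Section square_integrable.
Variables (R : realType) (T : choiceType) (tau : R).
Hypothesis tau0 : 0 < tau.
Local Notation mu := (@lebesgue_measure R).
Local Notation D := (`[0%R, tau]%classic : set R).
Local Notation cbm := (cbm tau).
Local Notation bm := (bounded_measurable 0 tau).
Local Notation mean := (mean tau).
Implicit Types (k : R * T -> R[i]) (K : seq T).

Let mD : measurable D. Proof. exact: measurable_itv. Qed.

Lemma sum_sqnorm_le_ell2 (f : T -> R[i]) K : uniq K ->
  ((\sum_(x <- K) sqnorm (f x))%:E <= ell2_sqnorm f)%E.
Proof.
move=> uK; apply: esum_ge; exists [set` K]; first by split; [exact: finite_seq|].
by rewrite -fsbig_seq// sumEFin.
Qed.

Lemma measurable_sqnorm (phi : R -> R[i]) (A : set R) :
  measurable_fun A (fun t => complex.Re (phi t)) ->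
  measurable_fun A (fun t => complex.Im (phi t)) ->
  measurable_fun A (fun t => sqnorm (phi t)).
Proof. by move=> m1 m2; apply: measurable_funD; exact: measurable_funX. Qed.

Lemma L2_integrable k x : L2_time tau k ->
  mu.-integrable D (EFin \o (fun t => complex.Re (k (t, x)))) /\
  mu.-integrable D (EFin \o (fun t => complex.Im (k (t, x)))).
Proof.
move=> [mk kfin]; have [m1 m2] := mk x; have ms := measurable_sqnorm m1 m2.
have sfin : (\int[mu]_(t in D) (sqnorm (k (t, x)))%:E < +oo)%E.
  apply: le_lt_trans kfin; apply: ge0_integral_mono => t _.
    by rewrite lee_fin sqnorm_ge0.
  by have := @sum_sqnorm_le_ell2 (fun x => k (t, x)) [:: x] isT; rewrite big_seq1.
have i1 : mu.-integrable D (EFin \o (fun t => 1 + sqnorm (k (t, x)))).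
  apply: (@integrableD _ _ _ mu D mD (EFin \o (fun=> 1)) (EFin \o (fun t => sqnorm (k (t, x))))).
    by apply: (bm_integrable (ltW tau0)); exact: bm_cst.
  apply/integrableP; split; first exact/measurable_EFinP.
  by under eq_integral do rewrite /= ger0_norm ?sqnorm_ge0//.
have dom (h : R -> R) : measurable_fun D h -> (forall t, `|h t| <= 1 + sqnorm (k (t, x))) ->
    mu.-integrable D (EFin \o h).
  move=> mh hs; apply: le_integrable i1 => //; first exact/measurable_EFinP.
  move=> t _ /=; rewrite lee_fin (le_trans (hs t))// ler_norm//.
split; apply: dom => // t; rewrite /sqnorm; case: (k (t, x)) => a b /=;
  by rewrite ler_norml !expr2; apply/andP; split; nra.
Qed.

(** Finite sums over the vertices commute with the integral, and are bounded by the
    integral of the full sum. *)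
Lemma summ_mean_sqnorm k (phi : R -> T -> R[i]) : L2_time tau k ->
  (forall x, cbm (phi ^~ x)) ->
  {ae mu, forall t, 0 <= t <= tau -> forall x, k (t, x) = phi t x} ->
  summ (fun x => mean (fun t => sqnorm (phi t x))).
Proof.
move=> [mk kfin] bphi ae.
have bs x : bm (fun t => sqnorm (phi t x)) by exact: bm_sqnorm.
have kE : (\int[mu]_(t in D) ell2_sqnorm (fun x => k (t, x)) \is a fin_num)%E.
  by rewrite ge0_fin_numE// integral_ge0// => t _; apply: esum_ge0 => x _; rewrite lee_fin sqnorm_ge0.
apply: (@summ_bounded _ _ _ (tau^-1 * fine (\int[mu]_(t in D) ell2_sqnorm (fun x => k (t, x))))).
  by move=> x; rewrite -[leLHS](mean_cst tau0); apply: le_mean => //; [exact: bm_cst|move=> t _; exact: sqnorm_ge0].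
move=> K uK; rewrite -mean_sum// ler_wpM2l ?invr_ge0 ?(ltW tau0)//.
have bsum : bm (fun t => \sum_(x <- K) sqnorm (phi t x)) by exact: bm_sum.
rewrite -lee_fin (fineK kE) /integ /Rintegral fineK; last first.
  by apply: integrable_fin_num => //; exact: (bm_integrable (ltW tau0)).
have msk x : measurable_fun D (fun t => sqnorm (k (t, x))).
  by have [m1 m2] := mk x; exact: measurable_sqnorm.
rewrite (@ae_eq_integral _ _ _ mu D (fun t => (\sum_(x <- K) sqnorm (k (t, x)))%:E)) //.
- apply: ge0_integral_mono => t _; last exact: sum_sqnorm_le_ell2.
  by rewrite lee_fin sumr_ge0// => x _; exact: sqnorm_ge0.
- by apply/measurable_EFinP; have [] := bsum.
- apply/measurable_EFinP.
  by apply: measurable_sum => x; exact: msk.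
apply: (@filterS _ (almost_everywhere mu) _ _ _ _ ae) => t ht; rewrite /= in_itv /= => /ht {}ht.
by congr EFin; apply: eq_bigr => x _; rewrite ht.
Qed.

Lemma bm_primitive_integrable (h : R -> R) : mu.-integrable D (EFin \o h) ->
  bm (fun t => integ 0 t h).
Proof.
move=> ih; split.
  apply: subspace_continuous_measurable_fun; first exact: measurable_itv.
  by apply: parameterized_integral_continuous => //; exact: ltW.
exists (\int[mu]_(t in D) `|h t|) => t /andP[t0 tt].
have sub : `[0, t]%classic `<=` D.
  by move=> r /=; rewrite !in_itv /= => /andP[-> /le_trans ->].
have mt : measurable (`[0, t]%classic : set R) by exact: measurable_itv.
have iht : mu.-integrable `[0, t]%classic (EFin \o h) by exact: integrableS ih.
rewrite /integ (le_trans (le_normr_Rintegral _ iht))//.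
rewrite /Rintegral fine_le//.
- by apply: integrable_fin_num => //; apply: (integrable_norm iht).
- by apply: integrable_fin_num => //; apply: (integrable_norm ih).
apply: ge0_subset_integral => //.
by apply/measurable_EFinP/measurableT_comp => //; apply/measurable_EFinP; case/integrableP: ih.
Qed.

End square_integrable.

Section time_dependent_solutions.
Variables (R : realType) (T : choiceType) (tau : R).
Hypothesis tau0 : 0 < tau.
Let omega : R := 2 * pi / tau.
Local Notation mu := (@lebesgue_measure R).
Local Notation D := (`[0%R, tau]%classic : set R).
Local Notation cbm := (cbm tau).
Local Notation bm := (bounded_measurable 0 tau).
Local Notation mean := (mean tau).
Variable H : (T -> R[i]) -> T -> R[i].
Variable V : R -> T -> R.
Implicit Types (F W : R -> T -> R[i]).

(** A local form of continuity: Fourier coefficients in time then commute with H. *)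
Definition finite_range : Prop := forall x, exists s : seq (R[i] * T),
  forall f, H f x = \sum_(i <- s) i.1 * f i.2.

Definition coef F (n : int) (x : T) : R[i] := fcoef tau (F ^~ x) n.

(** A periodic solution of - i F' + H F + V F = W, kept only through its Fourier
    coefficients and the uniform rate at which its Fourier sums converge. *)
Record solution F W : Prop := {
  sol_cbm : forall x, cbm (F ^~ x);
  sol_cbm_rhs : forall x, cbm (W ^~ x);
  sol_summ : summ (fun x => mean (fun t => sqnorm (F t x)));
  sol_summ_rhs : summ (fun x => mean (fun t => sqnorm (W t x)));
  sol_eq : forall n x, (n%:~R * omega)%:C * coef F n x + H (coef F n) x +
     fcoef tau (fun t => (V t x)%:C * F t x) n = coef W n x;
  sol_tail : exists G : T -> R, [/\ forall x, 0 <= G x, summ G &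
     forall N t x, (0 < N)%N -> 0 <= t <= tau ->
       sqnorm (F t x - trig tau (modes N) (fun n => coef F n x) t) <= G x / N%:R] }.

Hypothesis fin_range : finite_range.
Hypothesis V_bm : forall x, bm (fun t => V t x).

Lemma cbm_V x (phi : R -> R[i]) : cbm phi -> cbm (fun t => (V t x)%:C * phi t).
Proof.
apply: cbmM; split; first exact: V_bm.
exact: bm_cst.
Qed.

Lemma coef_ell2 F n : (forall x, cbm (F ^~ x)) ->
  summ (fun x => mean (fun t => sqnorm (F t x))) -> ell2 (coef F n).
Proof.
move=> bF sF; apply/ell2P/(summ_le sF) => x.
have := @bessel _ _ tau0 (F ^~ x) [:: n] (bF x) isT; rewrite big_seq1 => h.
by rewrite ger0_norm ?sqnorm_ge0// (le_trans h)// ler_norm.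
Qed.

Lemma cbm_H F x : (forall y, cbm (F ^~ y)) -> cbm (fun t => H (F t) x).
Proof.
move=> bF; have [s Hs] := fin_range x.
apply: (@eq_cbm _ _ (fun t => \sum_(i <- s) i.1 * F t i.2)); first by move=> t _; rewrite Hs.
by apply: cbm_sum => i; exact: cbmZ.
Qed.

Lemma fcoef_H F n x : (forall y, cbm (F ^~ y)) ->
  fcoef tau (fun t => H (F t) x) n = H (coef F n) x.
Proof.
move=> bF; have [s Hs] := fin_range x; rewrite Hs.
rewrite (@eq_fcoef _ _ _ (fun t => \sum_(i <- s) i.1 * F t i.2)); last by move=> t _; rewrite Hs.
rewrite fcoef_sum//; last by move=> i; exact: cbmZ.
by apply: eq_bigr => i _; rewrite fcoefZ.
Qed.

Lemma solutionD (c : R[i]) F W F' W' : symmetric_operator H ->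
  solution F W -> solution F' W' ->
  solution (fun t x => c * F t x + F' t x) (fun t x => c * W t x + W' t x).
Proof.
move=> opH sF sF'.
have coefE (A B : R -> T -> R[i]) n x : (forall y, cbm (A ^~ y)) -> (forall y, cbm (B ^~ y)) ->
    coef (fun t y => c * A t y + B t y) n x = c * coef A n x + coef B n x.
  move=> bA bB; rewrite /coef fcoefD//; first by rewrite fcoefZ.
  exact: cbmZ.
have cb (A B : R -> T -> R[i]) : (forall y, cbm (A ^~ y)) -> (forall y, cbm (B ^~ y)) ->
    forall y, cbm (fun t => c * A t y + B t y).
  by move=> bA bB y; apply: cbmD => //; exact: cbmZ.
have sm (A B : R -> T -> R[i]) : (forall y, cbm (A ^~ y)) -> (forall y, cbm (B ^~ y)) ->
    summ (fun x => mean (fun t => sqnorm (A t x))) ->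
    summ (fun x => mean (fun t => sqnorm (B t x))) ->
    summ (fun x => mean (fun t => sqnorm (c * A t x + B t x))).
  move=> bA bB sA sB; apply: (summ_le (summD (summZ (2 * sqnorm c) sA) (summZ 2 sB))) => x.
  have bs := bm_sqnorm (cb A B bA bB x).
  have b1 := bmZ (2 * sqnorm c) (bm_sqnorm (bA x)); have b2 := bmZ 2 (bm_sqnorm (bB x)).
  rewrite ger0_norm; last first.
    by rewrite -[leLHS](mean_cst tau0); apply: le_mean => //; [exact: bm_cst|move=> t _; exact: sqnorm_ge0].
  apply: le_trans (ler_norm _).
  rewrite -!meanZ//; [|exact: bm_sqnorm..]; rewrite -meanD//; apply: le_mean => //.
    exact: bmD.
  by move=> t _; apply: le_trans (ler_sqnormD2 _ _) _; rewrite sqnormM; lra.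
split.
- exact: cb (sol_cbm sF) (sol_cbm sF').
- exact: cb (sol_cbm_rhs sF) (sol_cbm_rhs sF').
- exact: sm (sol_cbm sF) (sol_cbm sF') (sol_summ sF) (sol_summ sF').
- exact: sm (sol_cbm_rhs sF) (sol_cbm_rhs sF') (sol_summ_rhs sF) (sol_summ_rhs sF').
- move=> n x; have bF := sol_cbm sF; have bF' := sol_cbm sF'.
  rewrite (coefE W W')//; [|exact: sol_cbm_rhs sF|exact: sol_cbm_rhs sF'].
  rewrite (coefE F F')//.
  rewrite (_ : coef (fun t x => c * F t x + F' t x) n = fun y => c * coef F n y + coef F' n y); last first.
    by apply/funext => y; exact: coefE.
  rewrite op_linear// -(sol_eq sF) -(sol_eq sF').
  rewrite (@eq_fcoef _ _ _ (fun t => c * ((V t x)%:C * F t x) + (V t x)%:C * F' t x)); last first.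
    by move=> t _; ring.
  have v1 := cbm_V x (bF x); have v2 := cbm_V x (bF' x).
  rewrite fcoefD//; last exact: cbmZ.
  by rewrite fcoefZ//; ring.
have [G [G0 sG GF]] := sol_tail sF; have [G' [G'0 sG' G'F]] := sol_tail sF'.
exists (fun x => 2 * sqnorm c * G x + 2 * G' x); split.
- by move=> x; rewrite addr_ge0// mulr_ge0// mulr_ge0// sqnorm_ge0.
- by apply: summD; exact: summZ.
move=> N t x N0 ht; have h1 := GF N t x N0 ht; have h2 := G'F N t x N0 ht.
rewrite (_ : _ - _ = c * (F t x - trig tau (modes N) (fun n => coef F n x) t) +
   (F' t x - trig tau (modes N) (fun n => coef F' n x) t)); last first.
  rewrite /trig (eq_bigr (fun n => c * (coef F n x * mode tau n t) + coef F' n x * mode tau n t)); last first.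
    move=> n _; rewrite (coefE F F'); [ring|exact: sol_cbm sF|exact: sol_cbm sF'].
  by rewrite big_split /= -mulr_sumr; ring.
apply: le_trans (ler_sqnormD2 _ _) _; rewrite sqnormM.
have c0 := sqnorm_ge0 c.
have : sqnorm c * sqnorm (F t x - trig tau (modes N) (coef F ^~ x) t) <= sqnorm c * (G x / N%:R).
  by rewrite ler_wpM2l.
lra.
Qed.

Lemma solution0 : symmetric_operator H -> solution (fun _ _ => 0) (fun _ _ => 0).
Proof.
move=> opH; have c0 n x : coef (fun _ _ => 0) n x = 0.
  apply: cdot_inj => c; rewrite /coef cdot_fcoef//; last exact: cbm_cst.
  by rewrite cdot0l -[RHS](mean_cst tau0); apply: eq_mean => t _; rewrite cdot0l.
have s0 : summ (fun x : T => mean (fun t => sqnorm (0 : R[i]))).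
  by apply: eq_summ (summ0 R T) => x; rewrite sqnorm0 mean_cst.
split=> //; try by move=> x; exact: cbm_cst.
- move=> n x; rewrite !c0 (_ : coef _ n = fun=> 0); last by apply/funext.
  rewrite op0// mulr0 !add0r -[RHS](c0 n x) /coef.
  by apply: eq_fcoef => t _; rewrite mulr0.
exists (fun=> 0); split=> //; first exact: summ0.
move=> N t x _ _; rewrite /trig big1; first by rewrite subr0 sqnorm0 mul0r.
by move=> n _; rewrite c0 mul0r.
Qed.

Lemma solution_sum (I : Type) (s : seq I) (P : pred I) (c : I -> R[i])
    (F W : I -> R -> T -> R[i]) : symmetric_operator H ->
  (forall i, P i -> solution (F i) (W i)) ->
  solution (fun t x => \sum_(i <- s | P i) c i * F i t x)
           (fun t x => \sum_(i <- s | P i) c i * W i t x).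
Proof.
move=> opH sF.
have eq F1 W1 F2 W2 : solution F1 W1 -> (forall t x, F1 t x = F2 t x) ->
    (forall t x, W1 t x = W2 t x) -> solution F2 W2.
  move=> + h1 h2; have -> : F2 = F1 by apply/funext => t; apply/funext => x.
  by have -> : W2 = W1 by apply/funext => t; apply/funext => x.
elim: s => [|i s ih].
  by apply: (eq _ _ _ _ (solution0 opH)) => t x; rewrite big_nil.
have [Pi|Pi] := boolP (P i); last first.
  by apply: (eq _ _ _ _ ih) => t x; rewrite big_cons (negbTE Pi).
by apply: (eq _ _ _ _ (solutionD (c i) opH (sF i Pi) ih)) => t x; rewrite big_cons Pi.
Qed.

(** The continuous representative F is, at each vertex, a primitive of i (l F - H F
    - V F), which is bounded because F is and H is local; that the derivative is in
    L^2 makes the rate of convergence summable over the vertices. *)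
Lemma eigenfunction_solution (l : R) (f k : R * T -> R[i]) :
  time_derivative tau f k ->
  ae_eq_time tau (fun z => l%:C * f z)
    (fun z => k z + H (fun x => f (z.1, x)) z.2 + (V z.1 z.2)%:C * f z) ->
  exists2 F, solution F (fun t x => l%:C * F t x) & ae_eq_time tau f (fun z => F z.1 z.2).
Proof.
move=> [L2f L2k [F0 [fF Fper FE]]] eigen.
pose F t x := F0 (t, x).
pose g t x := l%:C * F t x - H (F t) x - (V t x)%:C * F t x.
have mD : measurable D by exact: measurable_itv.
have kg : {ae mu, forall t, 0 <= t <= tau -> forall x, k (t, x) = g t x}.
  apply: (@filterS2 _ (almost_everywhere mu) _ _ _ _ _ fF eigen) => t h1 h2 ht x.
  have := h2 ht x; rewrite /g /= (h1 ht x) (_ : (fun x0 => f (t, x0)) = F t); last first.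
    by apply/funext => y; rewrite (h1 ht y).
  by rewrite /F => ->; ring.
have FE' t x : 0 <= t <= tau -> F t x = F 0 x + (0 +i* 1) *
     cintegral `[0, t]%classic (fun r => k (r, x)) by exact: FE.
have bF x : cbm (F ^~ x).
  have [i1 i2] := L2_integrable tau0 x L2k; split.
    apply: eq_bounded_measurable (bmB (bm_cst _ _ (complex.Re (F 0 x))) (bm_primitive_integrable tau0 i2)).
    by move=> t ht; rewrite (FE' t x ht); case: (F 0 x) => ? ?; rewrite /cintegral /integ /=; ring.
  apply: eq_bounded_measurable (bmD (bm_cst _ _ (complex.Im (F 0 x))) (bm_primitive_integrable tau0 i1)).
  by move=> t ht; rewrite (FE' t x ht); case: (F 0 x) => ? ?; rewrite /cintegral /integ /=; ring.
have blF x : cbm (fun t => l%:C * F t x) by exact: cbmZ.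
have bHF x : cbm (fun t => H (F t) x) by exact: cbm_H.
have bVF x := cbm_V x (bF x).
have bg x : cbm (g ^~ x) by apply: cbmB => //; exact: cbmB.
have FEg x t : 0 <= t <= tau -> F t x = F 0 x + (0 +i* 1) * cintegral `[0, t]%classic (g ^~ x).
  move=> ht; rewrite (FE' t x ht); congr (_ + _ * _).
  have [m1 m2] := L2k.1 x; have [[mg1 _] [mg2 _]] := bg x.
  have sub : `[0, t]%classic `<=` D.
    by case/andP: ht => t0 tt r /=; rewrite !in_itv /= => /andP[-> /le_trans ->].
  have mt : measurable (`[0, t]%classic : set R) by exact: measurable_itv.
  rewrite /cintegral; congr (_ +i* _); congr fine; apply: ae_eq_integral => //;
    try (by apply/measurable_EFinP; apply: measurable_funS (sub) _ => //).
    apply: (@filterS _ (almost_everywhere mu) _ _ _ _ kg) => r h /=; rewrite in_itv /= => /andP[r0 rt].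
    by rewrite h// r0 (le_trans rt)//; case/andP: ht.
  apply: (@filterS _ (almost_everywhere mu) _ _ _ _ kg) => r h /=; rewrite in_itv /= => /andP[r0 rt].
  by rewrite h// r0 (le_trans rt)//; case/andP: ht.
have Fp x : F tau x = F 0 x by exact: Fper.
have sF : summ (fun x => mean (fun t => sqnorm (F t x))).
  by apply: (summ_mean_sqnorm tau0 L2f).
have sg : summ (fun x => mean (fun t => sqnorm (g t x))).
  by apply: (summ_mean_sqnorm tau0 L2k).
exists F => //; split=> //.
- apply: eq_summ (summZ (l ^+ 2) sF) => x; rewrite -meanZ//; last exact: bm_sqnorm.
  by apply: eq_mean => t _; rewrite sqnormM sqnormR.
- move=> n x; have [_] := fcoef_derivative tau0 n (bg x) (FEg x) (Fp x).
  rewrite -/omega -/(coef F n x) => <-.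
  rewrite /g (fcoefB tau0 n (cbmB (blF x) (bHF x)) (bVF x)) (fcoefB tau0 n (blF x) (bHF x)).
  by rewrite fcoef_H// /coef; ring.
exists (fun x => 4 / omega ^+ 2 * mean (fun t => sqnorm (g t x))); split.
- move=> x; rewrite mulr_ge0//; first by rewrite divr_ge0// sqr_ge0.
  rewrite -[leLHS](mean_cst tau0); apply: le_mean => //; [exact: bm_cst|exact: bm_sqnorm|].
  by move=> t _; exact: sqnorm_ge0.
- exact: summZ.
move=> N t x N0 ht; have := fourier_tail tau0 (bg x) (FEg x) (Fp x) ht N0.
rewrite -/omega => h; apply: (le_trans h).
by rewrite le_eqVlt; apply/orP; left; apply/eqP; rewrite invfM; ring.
Qed.

End time_dependent_solutions.

(** * Energy identities *)

Section energy_estimates.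
Variables (R : realType) (T : choiceType) (tau : R).
Hypothesis tau0 : 0 < tau.
Let omega : R := 2 * pi / tau.
Local Notation cbm := (cbm tau).
Local Notation bm := (bounded_measurable 0 tau).
Local Notation mean := (mean tau).
Local Notation trig := (trig tau).
Local Notation coef := (coef tau).
Variables (H : (T -> R[i]) -> T -> R[i]) (V : R -> T -> R).
Local Notation solution := (solution tau H V).
Hypothesis opH : symmetric_operator H.
Hypothesis V_bm : forall x, bm (fun t => V t x).
Variable delta : R.
Hypothesis V_delta : forall t x, `|V t x| <= delta.
Implicit Types (f g h F W : R -> T -> R[i]) (b : int -> T -> R[i]) (s : seq int).

(** Boundedness in time at each vertex makes every mean below a genuine integral;
    integrability in space and time together is the summability of the means. *)
Definition square_summable f : Prop :=
  (forall x, cbm (f ^~ x)) /\ summ (fun x => mean (fun t => sqnorm (f t x))).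

Definition normsq f : R := tsum (fun x => mean (fun t => sqnorm (f t x))).

Definition vform f g : R :=
  tsum (fun x => mean (fun t => V t x * cdot (f t x) (g t x))).

Let ssD f g : square_summable f -> square_summable g ->
  square_summable (fun t x => f t x + g t x).
Proof.
move=> [bf sf] [bg sg].
have bD x : cbm (fun t => f t x + g t x) by exact: cbmD.
split; first exact: bD.
apply: (summ_le (summZ 2 (summD sf sg))) => x.
have b1 := bm_sqnorm (bf x); have b2 := bm_sqnorm (bg x).
rewrite ger0_norm; last first.
  rewrite -[leLHS](mean_cst tau0); apply: le_mean => //; [exact: bm_cst|exact: bm_sqnorm|].
  by move=> t _; exact: sqnorm_ge0.
apply: le_trans (ler_norm _); rewrite -meanD// -meanZ//; last exact: bmD.
apply: le_mean => //; [exact: bm_sqnorm|by apply: bmZ; exact: bmD|].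
by move=> t _; exact: ler_sqnormD2.
Qed.

Let ssN f : square_summable f -> square_summable (fun t x => - f t x).
Proof.
move=> [bf sf]; split.
  by move=> x; apply: eq_cbm (cbmZ (-1) (bf x)) => t _; rewrite mulN1r.
by apply: eq_summ sf => x; apply: eq_mean => t _; rewrite sqnormN.
Qed.

Let bm_vform f g x : square_summable f -> square_summable g ->
  bm (fun t => V t x * cdot (f t x) (g t x)).
Proof. by move=> [bf _] [bg _]; apply: bmM => //; exact: bm_cdot. Qed.

Lemma mean_vform_le f g x (k : R) : square_summable f -> square_summable g -> 0 < k ->
  `|mean (fun t => V t x * cdot (f t x) (g t x))| <=
  delta / 2 * (k * mean (fun t => sqnorm (f t x)) + k^-1 * mean (fun t => sqnorm (g t x))).
Proof.
move=> ssf ssg k0; have [bf _] := ssf; have [bg _] := ssg.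
have b1 := bm_sqnorm (bf x); have b2 := bm_sqnorm (bg x).
have bv := bm_vform x ssf ssg.
apply: le_trans (ler_norm_mean tau0 bv) _.
have b3 := bmD (bmZ k b1) (bmZ k^-1 b2).
rewrite -!meanZ// -meanD//; try exact: bmZ.
rewrite -meanZ//; apply: le_mean => //; last first.
- move=> t _; rewrite normrM -mulrA; apply: ler_pM => //.
  by have := ler_cdot (f t x) (g t x) k0; lra.
- exact: bmZ.
have [mv [M vM]] := bv; split; first exact: measurableT_comp.
by exists M => t /vM; rewrite normr_id.
Qed.

Let summ_vform f g : square_summable f -> square_summable g ->
  summ (fun x => mean (fun t => V t x * cdot (f t x) (g t x))).
Proof.
move=> ssf ssg; apply: (summ_le (summZ (delta / 2) (summD ssf.2 ssg.2))) => x.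
apply: le_trans (mean_vform_le x ssf ssg ltr01) _.
by rewrite invr1 !mul1r ler_norm.
Qed.

Lemma vformC f g : vform f g = vform g f.
Proof. by apply: eq_tsum => x; apply: eq_mean => t _; rewrite cdotC. Qed.

Lemma vformDl f g h : square_summable f -> square_summable g -> square_summable h ->
  vform (fun t x => f t x + g t x) h = vform f h + vform g h.
Proof.
move=> ssf ssg ssh; rewrite /vform -tsumD; [|exact: summ_vform..].
apply: eq_tsum => x; rewrite -meanD//; [|exact: bm_vform..].
by apply: eq_mean => t _; rewrite cdotDl mulrDr.
Qed.

Lemma vform_le f g (k : R) : square_summable f -> square_summable g -> 0 < k ->
  `|vform f g| <= delta / 2 * (k * normsq f + k^-1 * normsq g).
Proof.
move=> ssf ssg k0; apply: le_trans (ler_norm_tsum (summ_vform ssf ssg)) _.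
have s1 := summZ k ssf.2; have s2 := summZ k^-1 ssg.2.
rewrite /normsq -(tsumZ k ssf.2) -(tsumZ k^-1 ssg.2) -tsumD// -tsumZ; last exact: summD.
apply: le_tsum; [exact/summ_abs/summ_vform|exact/summZ/summD|].
by move=> x; exact: mean_vform_le.
Qed.

Lemma square_summable_trig s b : uniq s -> (forall n, ell2 (b n)) ->
  square_summable (fun t x => trig s (b ^~ x) t) /\
  normsq (fun t x => trig s (b ^~ x) t) = \sum_(n <- s) rdot (b n) (b n).
Proof.
move=> us lb.
have E x : mean (fun t => sqnorm (trig s (b ^~ x) t)) = \sum_(n <- s) sqnorm (b n x).
  exact: mean_sqnorm_trig.
have sb n : summ (fun x => sqnorm (b n x)) by have /ell2P := lb n.
split.
  split=> [x|]; first exact: cbm_trig.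
  by apply: eq_summ (summ_sum s sb) => x; rewrite E.
by rewrite /normsq (eq_tsum E) tsum_sum.
Qed.

Lemma vform_trig_le s b (q : T -> R) (Q : R) : uniq s -> (forall n, ell2 (b n)) ->
  (forall x, `|q x| <= Q) -> (forall t x, V t x <= q x) ->
  vform (fun t x => trig s (b ^~ x) t) (fun t x => trig s (b ^~ x) t) <=
  \sum_(n <- s) tsum (fun x => q x * sqnorm (b n x)).
Proof.
move=> us lb qQ Vq; have [sst _] := square_summable_trig us lb.
have sb n : summ (fun x => q x * sqnorm (b n x)).
  have /ell2P sn := lb n; apply: (summ_le (summZ Q sn)) => x.
  rewrite !normrM ler_wpM2r// (le_trans (qQ x))// ler_norm//.
rewrite -tsum_sum// /vform; apply: le_tsum; [exact: summ_vform|exact: summ_sum|move=> x].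
rewrite -mulr_sumr -(mean_sqnorm_trig tau0)// -meanZ//; last exact/bm_sqnorm/cbm_trig.
apply: le_mean => //; [exact: (bm_vform x sst sst)|exact/bmZ/bm_sqnorm/cbm_trig|].
by move=> t _; rewrite cdotzz ler_wpM2r// sqnorm_ge0.
Qed.

Lemma vform_trig_ge s b (q : T -> R) (Q : R) : uniq s -> (forall n, ell2 (b n)) ->
  (forall x, `|q x| <= Q) -> (forall t x, - q x <= V t x) ->
  - \sum_(n <- s) tsum (fun x => q x * sqnorm (b n x)) <=
  vform (fun t x => trig s (b ^~ x) t) (fun t x => trig s (b ^~ x) t).
Proof.
move=> us lb qQ Vq; have [sst _] := square_summable_trig us lb.
have sb n : summ (fun x => q x * sqnorm (b n x)).
  have /ell2P sn := lb n; apply: (summ_le (summZ Q sn)) => x.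
  rewrite !normrM ler_wpM2r// (le_trans (qQ x))// ler_norm//.
rewrite -tsum_sum// -tsumN /vform; apply: le_tsum; [exact/summN/summ_sum|exact: summ_vform|move=> x].
have bs : bm (fun t => sqnorm (trig s (b ^~ x) t)) by exact/bm_sqnorm/cbm_trig.
rewrite -mulr_sumr -(mean_sqnorm_trig tau0)// -mulNr -meanZ//.
apply: le_mean => //; [exact: bmZ|exact: (bm_vform x sst sst)|].
by move=> t _; rewrite cdotzz ler_wpM2r// sqnorm_ge0.
Qed.

Lemma sol_square_summable F W : solution F W -> square_summable F.
Proof. by move=> sF; split; [exact: sol_cbm sF|exact: sol_summ sF]. Qed.

Lemma sol_coef_ell2 F W n : solution F W -> ell2 (coef F n).
Proof. by move=> sF; apply: (coef_ell2 tau0); [exact: sol_cbm sF|exact: sol_summ sF]. Qed.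

Lemma sol_coef_rhs_ell2 F W n : solution F W -> ell2 (coef W n).
Proof. by move=> sF; apply: (coef_ell2 tau0); [exact: sol_cbm_rhs sF|exact: sol_summ_rhs sF]. Qed.

(** The equation tested against a trigonometric polynomial: only finitely many
    equations between coefficients are involved, and V enters through its form, with
    no expansion of V F. *)
Lemma sol_test F W s b : solution F W -> uniq s -> (forall n, ell2 (b n)) ->
  \sum_(n <- s) (n%:~R * omega * rdot (coef F n) (b n) + rdot (H (coef F n)) (b n)) +
    vform F (fun t x => trig s (b ^~ x) t) =
  \sum_(n <- s) rdot (coef W n) (b n).
Proof.
move=> sF us lb; have [sst _] := square_summable_trig us lb.
have ssF := sol_square_summable sF.
have lF n := sol_coef_ell2 n sF; have lW n := sol_coef_rhs_ell2 n sF.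
have s1 n : summ (fun x => n%:~R * omega * cdot (coef F n x) (b n x)).
  by apply: summZ; exact: summ_cdot.
have s2 n : summ (fun x => cdot (H (coef F n) x) (b n x)).
  by apply: summ_cdot => //; exact: op_ell2.
have s3 n : summ (fun x => cdot (coef W n x) (b n x)) by exact: summ_cdot.
have s12 n := summD (s1 n) (s2 n).
rewrite -(tsum_sum s s3).
transitivity (tsum (fun x => \sum_(n <- s) (n%:~R * omega * cdot (coef F n x) (b n x) +
    cdot (H (coef F n) x) (b n x)) + mean (fun t => V t x * cdot (F t x) (trig s (b ^~ x) t)))).
  rewrite tsumD; [|exact: summ_sum|exact: summ_vform].
  rewrite tsum_sum//; congr (_ + _); apply: eq_bigr => n _.
  by rewrite tsumD// tsumZ//; exact: summ_cdot.
apply: eq_tsum => x.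
rewrite (@eq_mean _ _ _ (fun t => cdot ((V t x)%:C * F t x) (trig s (b ^~ x) t))); last first.
  by move=> t _; rewrite cdotRl.
have bVF : cbm (fun t => (V t x)%:C * F t x) by apply: cbm_V => //; exact: ssF.1.
rewrite mean_trig// -big_split /=; apply: eq_bigr => n _.
by rewrite -(sol_eq sF) !cdotDl cdotRl.
Qed.

Definition residual F (N : nat) t x : R[i] :=
  F t x - trig (modes N) (fun n => coef F n x) t.

Lemma residual_square_summable F W N : solution F W -> square_summable (residual F N).
Proof.
move=> sF; apply: ssD; first exact: sol_square_summable sF.
apply: ssN; apply: (square_summable_trig _ _).1; first exact: modes_uniq.
by move=> n; exact: sol_coef_ell2 sF.
Qed.

Lemma vform_residual F W N g : solution F W -> square_summable g ->
  vform F g = vform (residual F N) g + vform (fun t x => trig (modes N) (coef F ^~ x) t) g.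
Proof.
move=> sF ssg; have lF n := sol_coef_ell2 n sF.
have [st _] := square_summable_trig (modes_uniq N) lF.
have E : F = (fun t x => residual F N t x + trig (modes N) (coef F ^~ x) t).
  by apply/funext => t; apply/funext => x; rewrite /residual subrK.
by rewrite {1}E (vformDl (residual_square_summable N sF) st ssg).
Qed.

(** The squared norm of the residual is at most the sum of G x over N; the weight k
    trades it against the bound B on g. *)
Lemma vform_residual_small F W (B e : R) : solution F W -> 0 <= B -> 0 < e ->
  \forall N \near \oo, forall g, square_summable g -> normsq g <= B ->
    `|vform (residual F N) g| <= e.
Proof.
move=> sF B0 e0; have [G [G0 sG GF]] := sol_tail sF.
have Gt0 : 0 <= tsum G by exact: tsum_ge0.
have [dl dl0 dd] : exists2 dl : R, 0 < dl & delta <= dl.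
  by exists (`|delta| + 1); [rewrite ltr_wpDl|rewrite (le_trans (ler_norm _))// lerDl].
have B1 : 0 < B + 1 by rewrite ltr_wpDl.
(* The weight is chosen for the part of the estimate that does not involve N; then N
   is chosen for the other part. *)
have [k k0 kE] : exists2 k : R, 0 < k & dl * (k^-1 * (B + 1)) = e.
  exists (dl * (B + 1) / e); first by rewrite divr_gt0// mulr_gt0.
  by field; rewrite !gt_eqF.
pose N0 := (Num.truncn (dl * k * tsum G / e)).+1.
exists N0 => // N /= N0N g ssg gB.
have ssr := residual_square_summable N sF.
have N1 : (0 < N)%N by exact: leq_trans N0N.
have Np : 0 < N%:R :> R by rewrite ltr0n.
have rN : normsq (residual F N) <= tsum G / N%:R.
  rewrite mulrC -tsumZ//; apply: le_tsum; [exact: ssr.2|exact: summZ|move=> x].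
  rewrite -[leRHS](mean_cst tau0); apply: le_mean => //.
  - exact/bm_sqnorm/(ssr.1).
  - exact: bm_cst.
  by move=> t ht; rewrite mulrC; exact: GF.
apply: le_trans (vform_le ssr ssg k0) _.
have nr0 : 0 <= normsq (residual F N).
  apply: tsum_ge0 => x; rewrite -[leLHS](mean_cst tau0); apply: le_mean => //.
  - exact: bm_cst.
  - exact/bm_sqnorm/(ssr.1).
  by move=> t _; exact: sqnorm_ge0.
have ng0 : 0 <= normsq g.
  apply: tsum_ge0 => x; rewrite -[leLHS](mean_cst tau0); apply: le_mean => //.
  - exact: bm_cst.
  - exact/bm_sqnorm/(ssg.1).
  by move=> t _; exact: sqnorm_ge0.
have ki : 0 <= k^-1 by rewrite invr_ge0 ltW.
have in0 : 0 <= k * normsq (residual F N) + k^-1 * normsq g.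
  by rewrite addr_ge0// mulr_ge0// ltW.
apply: (@le_trans _ _ (dl / 2 * (k * normsq (residual F N) + k^-1 * normsq g))).
  by rewrite ler_wpM2r// ler_wpM2r.
have h1 : dl * (k * normsq (residual F N)) <= e.
  apply: (@le_trans _ _ (dl * (k * (tsum G / N%:R)))).
    by rewrite ler_wpM2l ?(ltW dl0)// ler_wpM2l// ltW.
  rewrite !mulrA ler_pdivrMr// [leRHS]mulrC -ler_pdivrMr//.
  have p : 0 <= dl * k * tsum G / e.
    by apply: divr_ge0; [apply: mulr_ge0 => //; apply: mulr_ge0; exact: ltW|exact: ltW].
  have /andP[_ /ltW h] := truncn_itv p; apply: (le_trans h).
  by rewrite ler_nat.
have h2 : dl * (k^-1 * normsq g) <= e.
  apply: (@le_trans _ _ (dl * (k^-1 * (B + 1)))).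
    by rewrite ler_wpM2l ?(ltW dl0)// ler_wpM2l// (le_trans gB)// lerDl.
  by rewrite kE.
apply: (le_trans (y := dl / 2 * (k * normsq (residual F N)) + dl / 2 * (k^-1 * normsq g))).
  by rewrite mulrDr.
by rewrite [leRHS]splitr; apply: lerD; rewrite mulrAC ler_wpM2r.
Qed.

Definition coef_dot s F F' : R := \sum_(n <- s) rdot (coef F n) (coef F' n).

Lemma coef_dot_le_normsq F W s : solution F W -> uniq s ->
  coef_dot s F F <= normsq F.
Proof.
move=> sF us; have lF n := sol_coef_ell2 n sF.
have sn n : summ (fun x => sqnorm (coef F n x)) by have /ell2P := lF n.
rewrite /coef_dot (eq_bigr (fun n => tsum (fun x => sqnorm (coef F n x)))); last first.
  by move=> n _; rewrite rdotff.
rewrite -tsum_sum//; apply: le_tsum; [exact: summ_sum|exact: sol_summ sF|move=> x].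
exact: (bessel tau0 (sol_cbm sF x) us).
Qed.

Lemma normsq_ge0 F W : solution F W -> 0 <= normsq F.
Proof.
by move=> sF; have := coef_dot_le_normsq sF (isT : uniq [::]); rewrite /coef_dot big_nil.
Qed.

(** Testing the equation of each of the two functions against the truncation of the
    other, the symmetric terms cancel and (l - l') (F, F') is left, up to residuals. *)
Lemma coef_dot_small F F' (l l' e : R) : l != l' -> 0 < e ->
  solution F (fun t x => l%:C * F t x) -> solution F' (fun t x => l'%:C * F' t x) ->
  \forall N \near \oo, `|coef_dot (modes N) F F'| <= e.
Proof.
move=> ll' e0 sF sF'.
have d0 : 0 < `|l - l'| * e / 2 by rewrite divr_gt0// mulr_gt0// normr_gt0 subr_eq0.
have h1 := vform_residual_small sF (normsq_ge0 sF') d0.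
have h2 := vform_residual_small sF' (normsq_ge0 sF) d0.
apply: filterS2 h1 h2 => N h1 h2; have us := modes_uniq N.
have lF n := sol_coef_ell2 n sF; have lF' n := sol_coef_ell2 n sF'.
have [st nt] := square_summable_trig us lF; have [st' nt'] := square_summable_trig us lF'.
have {}h1 := h1 _ st' _; have {}h2 := h2 _ st _.
have c1 := coef_dot_le_normsq sF us; have c2 := coef_dot_le_normsq sF' us.
rewrite nt' in h1; rewrite nt in h2; have {}h1 := h1 c2; have {}h2 := h2 c1.
have t1 := sol_test sF us lF'; have t2 := sol_test sF' us lF.
have cl n : rdot (coef (fun t x => l%:C * F t x) n) (coef F' n) = l * rdot (coef F n) (coef F' n).
  by rewrite -rdotRl//; apply: eq_rdot => // x; exact: (fcoefZ tau0 l%:C n (sol_cbm sF x)).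
have cl' n : rdot (coef (fun t x => l'%:C * F' t x) n) (coef F n) = l' * rdot (coef F n) (coef F' n).
  rewrite [in RHS]rdotC -rdotRl//; apply: eq_rdot => // x; exact: (fcoefZ tau0 l'%:C n (sol_cbm sF' x)).
rewrite (vform_residual N sF st') in t1; rewrite (vform_residual N sF' st) [X in _ + (_ + X)]vformC in t2.
have swap : \sum_(n <- modes N) (n%:~R * omega * rdot (coef F' n) (coef F n) + rdot (H (coef F' n)) (coef F n)) =
   \sum_(n <- modes N) (n%:~R * omega * rdot (coef F n) (coef F' n) + rdot (H (coef F n)) (coef F' n)).
  apply: eq_bigr => n _; rewrite (rdotC (coef F' n) (coef F n)) (op_sym opH (lF' n) (lF n)).
  by rewrite (rdotC (coef F' n)).
rewrite swap (eq_bigr _ (fun n _ => cl' n)) -mulr_sumr in t2.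
rewrite (eq_bigr _ (fun n _ => cl n)) -mulr_sumr in t1.
have E : (l - l') * coef_dot (modes N) F F' =
   vform (residual F N) (fun t x => trig (modes N) (coef F' ^~ x) t) -
   vform (residual F' N) (fun t x => trig (modes N) (coef F ^~ x) t).
  have aux (a b x y z v : R) : z + (x + v) = a -> z + (y + v) = b -> a - b = x - y.
    by move=> <- <-; ring.
  by rewrite mulrBl; exact: (aux _ _ _ _ _ _ t1 t2).
have ll0 : 0 < `|l - l'| by rewrite normr_gt0 subr_eq0.
rewrite -(ler_pM2l ll0) -normrM E (le_trans (ler_normB _ _))//.
by rewrite (le_trans (lerD h1 h2))// -splitr.
Qed.

(** If all coefficients vanished, so would F, as the limit of its Fourier sums. *)
Lemma coef_dot_pos F W t x : solution F W -> 0 <= t <= tau -> F t x != 0 ->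
  exists2 e : R, 0 < e & \forall N \near \oo, e <= coef_dot (modes N) F F.
Proof.
move=> sF ht Ftx; have lF n := sol_coef_ell2 n sF.
pose a n := rdot (coef F n) (coef F n).
have a0 n : 0 <= a n by exact: rdot_ge0.
have dE N : coef_dot (modes N) F F = \sum_(k <- iota 0 N) (a (Posz k) + a (Negz k)).
  rewrite /coef_dot /modes big_cat /pos_modes /neg_modes !big_map.
  by rewrite /= -big_split.
have mono M N : (M <= N)%N -> coef_dot (modes M) F F <= coef_dot (modes N) F F.
  move=> MN; rewrite !dE -(subnKC MN) iotaD big_cat /= lerDl.
  by apply: sumr_ge0 => k _; rewrite addr_ge0.
have [[M Mp]|/forallNP none] := pselect (exists M, 0 < coef_dot (modes M) F F).
  exists (coef_dot (modes M) F F) => //; exists M => // N /= MN.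
  exact: mono.
have zero N : forall n, n \in modes N -> a n = 0.
  move=> n nN; have : coef_dot (modes N) F F = 0.
    apply/eqP; rewrite eq_le; have /negP := none N; rewrite -leNgt => -> /=.
    by apply: sumr_ge0 => m _; exact: a0.
  rewrite /coef_dot (bigD1_seq n) ?modes_uniq//= => /eqP.
  rewrite paddr_eq0; [by move=> /andP[/eqP]|exact: a0|].
  by apply: sumr_ge0 => m _; exact: a0.
have [G [G0 _ GF]] := sol_tail sF.
have bound N : (0 < N)%N -> sqnorm (F t x) <= G x / N%:R.
  move=> N0; have := GF N t x N0 ht; rewrite /trig big_seq big1 ?subr0// => n nN.
  by rewrite (rdot_eq0 (lF n) (zero N n nN)) mul0r.
have F0 : 0 < sqnorm (F t x).
  rewrite lt_neqAle sqnorm_ge0 andbT eq_sym; apply/eqP => /sqnorm_eq0 /eqP.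
  exact/negP.
exfalso; pose N := (Num.truncn (G x / sqnorm (F t x))).+1.
have Np : 0 < N%:R :> R by rewrite ltr0n.
have p : 0 <= G x / sqnorm (F t x) by rewrite divr_ge0// ltW.
have /andP[_] := truncn_itv p; rewrite -/N ltr_pdivrMr// mulrC.
by have := bound N isT; rewrite ler_pdivlMr// => h1 h2; lra.
Qed.

End energy_estimates.

Section energy_identity.
Variables (R : realType) (T : choiceType) (tau : R).
Hypothesis tau0 : 0 < tau.
Let omega : R := 2 * pi / tau.
Local Notation cbm := (cbm tau).
Local Notation bm := (bounded_measurable 0 tau).
Local Notation trig := (trig tau).
Local Notation coef := (coef tau).
Variables (H : (T -> R[i]) -> T -> R[i]) (V : R -> T -> R).
Local Notation solution := (solution tau H V).
Local Notation vform := (vform tau V).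
Local Notation residual := (residual tau).
Local Notation coef_dot := (coef_dot tau).
Hypothesis opH : symmetric_operator H.
Hypothesis V_bm : forall x, bm (fun t => V t x).
Variable delta : R.
Hypothesis V_delta : forall t x, `|V t x| <= delta.
Implicit Types (F W : R -> T -> R[i]) (s : seq int).

Definition truncation F s t x : R[i] := trig s (coef F ^~ x) t.

(** The form of the time-periodic operator on a truncation of F, minus its pairing
    with the right-hand side. *)
Definition energy F W s : R :=
  \sum_(n <- s) (n%:~R * omega * rdot (coef F n) (coef F n) +
     rdot (H (coef F n)) (coef F n) - rdot (coef W n) (coef F n)) +
  vform (truncation F s) (truncation F s).

Definition energy_error F N : R :=
  vform (residual F N) (truncation F (neg_modes N)) -
  vform (residual F N) (truncation F (pos_modes N)).

Lemma truncation_square_summable F W s : solution F W -> uniq s ->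
  square_summable tau (truncation F s).
Proof.
move=> sF us.
exact: (square_summable_trig tau0 us (fun n => sol_coef_ell2 tau0 n sF)).1.
Qed.

(** The pairings of V between the two halves appear once in each identity, with the
    same value, and cancel. *)
Lemma energy_identity F W N : solution F W ->
  energy F W (pos_modes N) - energy F W (neg_modes N) = energy_error F N.
Proof.
move=> sF; have lF n := sol_coef_ell2 tau0 n sF.
have sp := truncation_square_summable sF (pos_modes_uniq N).
have sn := truncation_square_summable sF (neg_modes_uniq N).
have E : (fun t x => trig (modes N) (coef F ^~ x) t) =
    (fun t x => truncation F (pos_modes N) t x + truncation F (neg_modes N) t x).
  by apply/funext => t; apply/funext => x; rewrite /truncation /trig /modes big_cat.
have tp := sol_test tau0 opH V_bm V_delta sF (pos_modes_uniq N) lF.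
have tn := sol_test tau0 opH V_bm V_delta sF (neg_modes_uniq N) lF.
rewrite -/(truncation F (pos_modes N)) (vform_residual tau0 V_bm V_delta N sF sp) E
  (vformDl tau0 V_bm V_delta sp sn sp) in tp.
rewrite -/(truncation F (neg_modes N)) (vform_residual tau0 V_bm V_delta N sF sn) E
  (vformDl tau0 V_bm V_delta sp sn sn) in tn.
rewrite /energy /energy_error (sumrB (pos_modes N)) (sumrB (neg_modes N)).
rewrite (vformC tau V (truncation F (neg_modes N)) (truncation F (pos_modes N))) in tp.
have aux (a b x y z v w p q : R) : x + (p + (y + z)) = a -> v + (q + (z + w)) = b ->
    x - a + y - (v - b + w) = q - p.
  by move=> <- <-; ring.
by move: tp tn; exact: aux.
Qed.

Lemma energy_error_small F W (e : R) : solution F W -> 0 < e ->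
  \forall N \near \oo, `|energy_error F N| <= e.
Proof.
move=> sF e0; have e2 : 0 < e / 2 by rewrite divr_gt0.
have h := vform_residual_small tau0 V_bm V_delta sF (normsq_ge0 tau0 sF) e2.
apply: filterS h => N h; have lF n := sol_coef_ell2 tau0 n sF.
have bound s : uniq s -> `|vform (residual F N) (truncation F s)| <= e / 2.
  move=> us; have [ss nE] := square_summable_trig tau0 us lF.
  apply: h => //; rewrite nE; exact (coef_dot_le_normsq tau0 sF us).
rewrite (le_trans (ler_normB _ _))//.
by rewrite [leRHS]splitr lerD// bound// (neg_modes_uniq, pos_modes_uniq).
Qed.

End energy_identity.

(** * Superpositions of eigenfunctions *)

Section superposition.
Variables (R : realType) (T : choiceType) (tau : R).
Hypothesis tau0 : 0 < tau.
Let omega : R := 2 * pi / tau.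
Local Notation bm := (bounded_measurable 0 tau).
Local Notation coef := (coef tau).
Variables (H : (T -> R[i]) -> T -> R[i]) (V : R -> T -> R).
Local Notation solution := (solution tau H V).
Local Notation coef_dot := (coef_dot tau).
Hypothesis opH : symmetric_operator H.
Hypothesis V_bm : forall x, bm (fun t => V t x).
Variable delta : R.
Hypothesis V_delta : forall t x, `|V t x| <= delta.
Variables (ls : seq R) (G : R -> R -> T -> R[i]).
Hypothesis ls_uniq : uniq ls.
Hypothesis G_solution : forall l, solution (G l) (fun t x => l%:C * G l t x).

Definition superposition (y : R -> R) t x : R[i] := \sum_(l <- ls) (y l)%:C * G l t x.

Lemma superposition_solution :
  solution (superposition (fun=> 1)) (superposition id).
Proof.
have := @solution_sum _ _ _ tau0 H V V_bm _ ls xpredT (fun=> 1) G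
  (fun l t x => l%:C * G l t x) opH (fun l _ => G_solution l).
congr solution; apply/funext => t; apply/funext => x; apply: eq_bigr => l _ //.
by rewrite mul1r.
Qed.

Lemma coef_superposition y n x :
  coef (superposition y) n x = \sum_(l <- ls) (y l)%:C * coef (G l) n x.
Proof.
have b l := sol_cbm (G_solution l) x.
rewrite /coef /superposition fcoef_sum//; last by move=> l; exact: cbmZ.
by apply: eq_bigr => l _; exact: (fcoefZ tau0 _ n (b l)).
Qed.

Lemma coef_dot_superposition s y z :
  coef_dot s (superposition y) (superposition z) =
  \sum_(l <- ls) \sum_(l' <- ls) y l * z l' * coef_dot s (G l) (G l').
Proof.
have lG l n := sol_coef_ell2 tau0 n (G_solution l).
have lz (k : R) l n : ell2 (fun x => k%:C * coef (G l) n x) by exact: ell2Z.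
have E n : rdot (coef (superposition y) n) (coef (superposition z) n) =
    \sum_(l <- ls) \sum_(l' <- ls) y l * z l' * rdot (coef (G l) n) (coef (G l') n).
  rewrite (eq_rdot (coef_superposition y n) (coef_superposition z n)).
  rewrite rdot_suml; [|by move=> l; exact: lz|by apply: ell2_sum => l; exact: lz].
  apply: eq_bigr => l _; rewrite rdotC rdot_suml; [|by move=> l'; exact: lz|exact: lz].
  apply: eq_bigr => l' _; rewrite (rdotRl _ (lG _ _) (lz _ _ _)) (rdotRr _ (lG _ _) (lG _ _)).
  by rewrite (rdotC (coef (G l') n)) mulrA (mulrC (z l')).
rewrite /coef_dot (eq_bigr _ (fun n _ => E n)) exchange_big; apply: eq_bigr => l _.
by rewrite exchange_big; apply: eq_bigr => l' _; rewrite /= mulr_sumr.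
Qed.

(** By asymptotic orthogonality only the diagonal of the weight matters. *)
Lemma superposition_negative (rho : R -> R -> R) l0 t x :
  (forall l, l \in ls -> rho l l < 0) -> l0 \in ls -> 0 <= t <= tau -> G l0 t x != 0 ->
  exists2 e : R, 0 < e & \forall N \near \oo,
    \sum_(l <- ls) \sum_(l' <- ls) rho l l' * coef_dot (modes N) (G l) (G l') <= - e.
Proof.
move=> rho0 l0s ht G0; have [m m0 near_m] := coef_dot_pos tau0 (G_solution l0) ht G0.
pose M := \sum_(l <- ls) \sum_(l' <- ls) `|rho l l'|.
have M0 : 0 <= M by apply: sumr_ge0 => l _; apply: sumr_ge0.
have r0 : 0 < - rho l0 l0 by rewrite oppr_gt0 rho0.
pose e := - rho l0 l0 * m / 2.
have e0 : 0 < e by rewrite divr_gt0// mulr_gt0.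
have d0 : 0 < e / (M + 1) by rewrite divr_gt0// ltr_wpDl.
exists e => //.
pose P (ll : R * R) (N : nat) := ll.1 != ll.2 ->
  `|coef_dot (modes N) (G ll.1) (G ll.2)| <= e / (M + 1).
have nP ll : \forall N \near \oo, P ll N.
  have [E|ll'] := eqVneq ll.1 ll.2; first by near=> N; rewrite /P E eqxx.
  have := coef_dot_small tau0 opH V_bm V_delta ll' d0 (G_solution _) (G_solution _).
  by apply: filterS => N h _.
have nPs : \forall N \near \oo, forall ll, ll \in [seq (l, l') | l <- ls, l' <- ls] -> P ll N.
  exact: (@filter_all_seq _ _ _ P _ nP).
apply: filterS2 near_m nPs => N Nm PN.
pose b (l l' : R) := `|rho l l'| * (e / (M + 1)) + (if (l' == l0) && (l == l0) then rho l0 l0 * m else 0).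
apply: (@le_trans _ _ (\sum_(l <- ls) \sum_(l' <- ls) b l l')).
  rewrite big_seq [leRHS]big_seq; apply: ler_sum => l ls1.
  rewrite big_seq [leRHS]big_seq; apply: ler_sum => l' ls2; rewrite /b.
  have n0 : 0 <= `|rho l l'| * (e / (M + 1)) by apply: mulr_ge0 => //; exact: ltW.
  have [<-|ll'] := eqVneq l l'; last first.
    have le : rho l l' * coef_dot (modes N) (G l) (G l') <= `|rho l l'| * (e / (M + 1)).
      rewrite (le_trans (ler_norm _))// normrM ler_wpM2l//.
      by apply: (PN (l, l')) => //; apply/allpairsP; exists (l, l').
    case: ifP => [/andP[/eqP h1 /eqP h2]|_]; last by rewrite addr0.
    by move: ll'; rewrite h1 h2 eqxx.
  rewrite andbb -[leLHS]add0r; apply: lerD; first by rewrite mulr_ge0// ltW.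
  case: ifP => [/eqP ->|_].
    by rewrite ler_wnM2l// ltW// rho0.
  by apply: mulr_le0_ge0; [exact: ltW (rho0 _ ls1)|]; apply: sumr_ge0 => n _; exact: rdot_ge0.
have -> : \sum_(l <- ls) \sum_(l' <- ls) b l l' = M * (e / (M + 1)) + rho l0 l0 * m.
  transitivity (\sum_(l <- ls) ((\sum_(l' <- ls) `|rho l l'|) * (e / (M + 1)) +
      if l == l0 then rho l0 l0 * m else 0)).
    apply: eq_bigr => l _; rewrite big_split /= -mulr_suml; congr (_ + _).
    case: (eqVneq l l0) => _; last by rewrite big1 // => l' _; rewrite andbF.
    by rewrite (bigD1_seq l0)//= eqxx /= big1 ?addr0// => l' /negbTE ->.
  rewrite big_split /= -mulr_suml; congr (_ + _).
  by rewrite -big_mkcond /= -big_filter filter_pred1_uniq// big_seq1.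
have : M * (e / (M + 1)) <= e.
  by rewrite mulrA ler_pdivrMr ?ltr_wpDl// mulrC ler_wpM2l ?(ltW e0)// lerDl.
have : rho l0 l0 * m = - (2 * e) by rewrite /e; field.
by move=> -> h; lra.
Unshelve. all: by end_near.
Qed.

End superposition.

Section reflected_operator.
Variables (R : realType) (T : choiceType).

(** Exchanges the two ends of the spectrum: bound states of this operator below 0
    are those of H above s. *)
Definition reflected (s : R) (H : (T -> R[i]) -> T -> R[i]) f x : R[i] :=
  s%:C * f x - H f x.

Variables (s : R) (H : (T -> R[i]) -> T -> R[i]).
Hypothesis opH : symmetric_operator H.

Lemma reflected_operator : symmetric_operator (reflected s H).
Proof.
split=> [c f g x|f lf|f g lf lg]; rewrite /reflected.
- by rewrite (op_linear opH); ring.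
- by apply: ell2B; [exact: ell2Z|exact: op_ell2].
rewrite rdotBl//; [|exact: ell2Z|exact: op_ell2].
rewrite rdotBr//; [|exact: ell2Z|exact: op_ell2].
by rewrite rdotRl// rdotRr// op_sym.
Qed.

Lemma reflected_form f : ell2 f ->
  rdot (reflected s H f) f = s * rdot f f - rdot (H f) f.
Proof.
move=> lf; rewrite rdotBl//; [|exact: ell2Z|exact: op_ell2].
by rewrite rdotRl.
Qed.

End reflected_operator.

Section mode_inequalities.
Variable R : realFieldType.
Implicit Types (u v w y z o r d e en ep er p n m : R).

Lemma mode_ineq_neg u v w z o r d : v <= r * w -> z <= - o * w ->
  z + v - u + d * w <= - (o - r - d) * w - u.
Proof. lra. Qed.

Lemma mode_ineq_pos u v w z d : 0 <= v -> 0 <= z -> - d * w - u <= z + v - u - d * w.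
Proof. lra. Qed.

Lemma mode_ineq_upper u v w z z' : 0 <= v -> w <= z -> z <= z' -> z' <= u -> 0 <= u + v - w.
Proof. lra. Qed.

Lemma mode_ineq_cancel u v w z d : u + w + d <= - z -> z <= - (u - v + d + (v + w)).
Proof. lra. Qed.

Lemma mode_ineq_edge v w y z o r : y <= 0 ->
  - o * w + v + (o - r) * w + z + y <= - (r * w - v - z).
Proof. lra. Qed.

Lemma mode_ineq_lower u v w y z o r : z <= - (2 * u) -> u = o * w -> v <= r * w ->
  y <= u -> z + v + (o - r) * w + y <= 0.
Proof. lra. Qed.

Lemma energy_balance_lower w en ep er p n m : w <= ep + p -> ep - en = er ->
  en <= n + m -> w <= er + (p + n) + m.
Proof. lra. Qed.

Lemma energy_balance_upper w en ep er p n m : w <= - (en + n) -> ep - en = er ->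
  p - m <= ep -> w <= er - (p + n) + m.
Proof. lra. Qed.

Lemma mode_ineq_young u v w d e : 2 * `|u| <= d * w + e * v ->
  - d * w - u <= u + e * v.
Proof. by have := ler_norm (- u); rewrite normrN => ? ?; lra. Qed.

Lemma mode_ineq_young_dual u v w o r d e :
  2 * `|u + (o - r) * w| <= (o - r - d) * w + e * v ->
  u + (o - r) * w - e * v <= - d * w - u.
Proof. by have := ler_norm (u + (o - r) * w) => ? ?; lra. Qed.

Lemma energy_balance_gap u v w z : u <= w -> z <= - v -> u + v <= w - z.
Proof. lra. Qed.

End mode_inequalities.

Section gap_inequalities.
Variables (R : realType) (T : choiceType) (tau : R).
Hypothesis tau0 : 0 < tau.
Local Notation omega := (2 * pi / tau).
Local Notation bm := (bounded_measurable 0 tau).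
Local Notation coef := (coef tau).
Variables (H : (T -> R[i]) -> T -> R[i]) (V : R -> T -> R).
Local Notation solution := (solution tau H V).
Local Notation coef_dot := (coef_dot tau).
Local Notation energy := (energy tau H V).
Local Notation energy_error := (energy_error tau V).
Hypothesis opH : symmetric_operator H.
Hypothesis V_bm : forall x, bm (fun t => V t x).
Variable s : R.
Hypothesis H_ge0 : forall f, ell2 f -> 0 <= rdot (H f) f.
Hypothesis H_le : forall f, ell2 f -> rdot (H f) f <= s * rdot f f.
Variables dp dm : R.
Hypotheses (dp0 : 0 <= dp) (dm0 : 0 <= dm) (dp_omega : dp <= omega) (dm_omega : dm <= omega).
Hypotheses (V_le : forall t x, V t x <= dp) (V_ge : forall t x, - dm <= V t x).
Implicit Types (F W : R -> T -> R[i]).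

Let V_delta t x : `|V t x| <= dp + dm.
Proof.
rewrite ler_norml; have h1 := V_le t x; have h2 := V_ge t x; have h3 := dp0; have h4 := dm0.
by apply/andP; split; lra.
Qed.

Let tsum_cst (k : R) (f : T -> R[i]) : ell2 f -> tsum (fun x => k * sqnorm (f x)) = k * rdot f f.
Proof. by move=> /ell2P sf; rewrite rdotff tsumZ. Qed.

Let omega0 : 0 < omega. Proof. by rewrite divr_gt0// mulr_gt0// pi_gt0. Qed.

Let mode_ge0 N n : n \in pos_modes N -> 0 <= n%:~R :> R.
Proof. by move=> /mapP[k _ ->]; rewrite -pmulrn. Qed.

Let mode_le0 N n : n \in neg_modes N -> n%:~R * omega <= - omega.
Proof.
move=> /mapP[k _ ->]; rewrite NegzE mulrNz mulNr lerN2 -[leLHS]mul1r.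
by rewrite ler_wpM2r ?(ltW omega0)// -pmulrn ler1n.
Qed.

(** Each negative mode satisfies n omega <= - omega. *)
Lemma energy_neg_le F W N : solution F W -> energy F W (neg_modes N) <=
  \sum_(n <- neg_modes N)
    (- (omega - s - dp) * rdot (coef F n) (coef F n) - rdot (coef W n) (coef F n)).
Proof.
move=> sF; have lF n := sol_coef_ell2 tau0 n sF; have us := neg_modes_uniq N.
have qQ (x : T) : `|dp| <= `|dp| by [].
have h := vform_trig_le tau0 V_bm V_delta us lF qQ V_le.
apply: (le_trans (lerD (lexx _) h)); rewrite -big_split /=.
rewrite big_seq [leRHS]big_seq; apply: ler_sum => n nN.
rewrite tsum_cst//; have h1 := H_le (lF n); have h2 := rdot_ge0 (coef F n).
have h3 : n%:~R * omega * rdot (coef F n) (coef F n) <= - omega * rdot (coef F n) (coef F n).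
  exact: (ler_wpM2r h2 (mode_le0 nN)).
exact: mode_ineq_neg.
Qed.

Lemma energy_pos_ge F W N : solution F W ->
  \sum_(n <- pos_modes N)
    (- dm * rdot (coef F n) (coef F n) - rdot (coef W n) (coef F n)) <=
  energy F W (pos_modes N).
Proof.
move=> sF; have lF n := sol_coef_ell2 tau0 n sF; have us := pos_modes_uniq N.
have qQ (x : T) : `|dm| <= `|dm| by [].
have h := vform_trig_ge tau0 V_bm V_delta us lF qQ V_ge.
apply: (le_trans _ (lerD (lexx _) h)); rewrite -sumrN -big_split /=.
rewrite big_seq [leRHS]big_seq; apply: ler_sum => n nN.
rewrite tsum_cst//; have h1 := H_ge0 (lF n).
have h3 : 0 <= n%:~R * omega * rdot (coef F n) (coef F n).
  apply: mulr_ge0; last exact: rdot_ge0.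
  by apply: mulr_ge0; [exact: mode_ge0 nN|exact: ltW].
exact: mode_ineq_pos.
Qed.

(** For n >= 1 the term n omega compensates q, which is at most dm <= omega; the
    mode 0 is left. *)
Lemma form_le_energy_pos (q : T -> R) F W N : vanishing q -> (forall x, 0 <= q x <= dm) ->
  (forall t x, - q x <= V t x) -> solution F W -> (0 < N)%N ->
  rdot (sub_potential H q (coef F 0)) (coef F 0) <=
  energy F W (pos_modes N) + \sum_(n <- pos_modes N) rdot (coef W n) (coef F n).
Proof.
move=> vq qd Vq sF N0; have lF n := sol_coef_ell2 tau0 n sF; have us := pos_modes_uniq N.
have qp x : 0 <= q x by have /andP[] := qd x.
have qQ x : `|q x| <= dm by rewrite ger0_norm//; have /andP[] := qd x.
have h := vform_trig_ge tau0 V_bm V_delta us lF qQ Vq.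
rewrite /energy addrAC sumrB subrK; apply: (le_trans _ (lerD (lexx _) h)).
rewrite -sumrN -big_split /= (bigD1_seq 0)//=; last first.
  by apply/mapP; exists 0%N => //; rewrite mem_iota.
have [_ ->] := form_sub_potential opH vq qp (lF 0).
rewrite mulr0z !mul0r add0r lerDl big_seq_cond; apply: sumr_ge0 => n /andP[nN n0].
have h1 := H_ge0 (lF n); have h2 := rdot_ge0 (coef F n).
have h3 : omega * rdot (coef F n) (coef F n) <= n%:~R * omega * rdot (coef F n) (coef F n).
  apply: (ler_wpM2r h2); move: nN n0 => /mapP[[|k] _ -> //] _.
  by rewrite -[leLHS]mul1r ler_wpM2r ?(ltW omega0)// -pmulrn ler1n.
have h4 : tsum (fun x => q x * sqnorm (coef F n x)) <= dm * rdot (coef F n) (coef F n).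
  have [sq _] := form_sub_potential opH vq qp (lF n); have /ell2P sn := lF n.
  rewrite -tsum_cst//; apply: le_tsum => //; first exact: summZ.
  by move=> x; apply: ler_wpM2r; [exact: sqnorm_ge0|have /andP[] := qd x].
have h5 : dm * rdot (coef F n) (coef F n) <= omega * rdot (coef F n) (coef F n).
  exact: ler_wpM2r.
exact: (mode_ineq_upper h1 h4 h5 h3).
Qed.

(** Once omega - s is added to the energy, n = -1 contributes minus the form of s -
    H - q, and the modes below it have n omega <= - 2 omega, which compensates s and
    q. *)
Lemma energy_neg_le_form (q : T -> R) F W N : vanishing q -> (forall x, 0 <= q x <= dp) ->
  (forall t x, V t x <= q x) -> solution F W -> (0 < N)%N ->
  rdot (sub_potential (reflected s H) q (coef F (-1))) (coef F (-1)) <=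
  - (energy F W (neg_modes N) + \sum_(n <- neg_modes N)
      (rdot (coef W n) (coef F n) + (omega - s) * rdot (coef F n) (coef F n))).
Proof.
move=> vq qd Vq sF N0; have lF n := sol_coef_ell2 tau0 n sF; have us := neg_modes_uniq N.
have qp x : 0 <= q x by have /andP[] := qd x.
have qQ x : `|q x| <= dp by rewrite ger0_norm//; have /andP[] := qd x.
have h := vform_trig_le tau0 V_bm V_delta us lF qQ Vq.
have [_ ->] := form_sub_potential (reflected_operator s opH) vq qp (lF (-1)).
rewrite (reflected_form s opH (lF (-1))) /energy
  (sumrB (neg_modes N)) (big_split _ _ _ (fun n => rdot (coef W n) (coef F n))) /=.
apply: mode_ineq_cancel; apply: (le_trans (lerD (lexx _) h)).
rewrite -!big_split /= (bigD1_seq (-1))//=; last first.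
  by apply/mapP; exists 0%N => //; rewrite mem_iota.
rewrite (_ : (-1)%:~R * omega = - omega :> R); last by rewrite mulrN1z mulN1r.
apply: mode_ineq_edge.
rewrite big_seq_cond; apply: sumr_le0 => n /andP[nN n1].
have h1 := H_le (lF n); have h2 := rdot_ge0 (coef F n).
have h3 : n%:~R * omega * rdot (coef F n) (coef F n) <= - (2 * (omega * rdot (coef F n) (coef F n))).
  rewrite mulrA -mulNr; apply: (ler_wpM2r h2); move: nN n1 => /mapP[[|k] _ -> //] _.
  by rewrite NegzE mulrNz mulNr lerN2 ler_wpM2r ?(ltW omega0)// -pmulrn ler_nat.
have h4 : tsum (fun x => q x * sqnorm (coef F n x)) <= omega * rdot (coef F n) (coef F n).
  apply: (@le_trans _ _ (dp * rdot (coef F n) (coef F n))); last exact: ler_wpM2r.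
  have [sq _] := form_sub_potential opH vq qp (lF n); have /ell2P sn := lF n.
  rewrite -tsum_cst//; apply: le_tsum => //; first exact: summZ.
  by move=> x; apply: ler_wpM2r; [exact: sqnorm_ge0|have /andP[] := qd x].
exact: (mode_ineq_lower h3 erefl h1 h4).
Qed.

Lemma coef_dot_modes F F' N :
  coef_dot (modes N) F F' = coef_dot (pos_modes N) F F' + coef_dot (neg_modes N) F F'.
Proof. by rewrite /coef_dot big_cat. Qed.

Let coef_dot_ge0 F S : 0 <= coef_dot S F F.
Proof. by apply: sumr_ge0 => n _; exact: rdot_ge0. Qed.

(** The negative modes have energy at most - d with d = omega - s - dp, which
    absorbs, by completing the square, the doubled pairing of W with them. *)
Lemma form_le_residual (q : T -> R) F W N : vanishing q -> (forall x, 0 <= q x <= dm) ->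
  (forall t x, - q x <= V t x) -> solution F W -> (0 < N)%N -> 0 < omega - s - dp ->
  rdot (sub_potential H q (coef F 0)) (coef F 0) <=
  energy_error F N + coef_dot (modes N) W F +
    (omega - s - dp)^-1 * coef_dot (modes N) W W.
Proof.
move=> vq qd Vq sF N0 d0; set d := _ - dp in d0 *.
have lF n := sol_coef_ell2 tau0 n sF; have lW n := sol_coef_rhs_ell2 tau0 n sF.
rewrite !coef_dot_modes.
apply: energy_balance_lower (form_le_energy_pos vq qd Vq sF N0) _ _.
  exact: (energy_identity tau0 opH V_bm V_delta N sF).
apply: (le_trans (energy_neg_le N sF)); rewrite (mulrDr d^-1) addrCA.
apply: ler_wpDl; first by apply: mulr_ge0 => //; rewrite invr_ge0 ltW.
rewrite mulr_sumr -big_split /=; apply: ler_sum => n _.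
have := ler_rdot_weighted (lF n) (lW n) d0; rewrite -/d rdotC.
exact: mode_ineq_young.
Qed.

(** The roles of the two halves are exchanged. The coefficients of W' are those of W
    after the shift of the energy by omega - s. *)
Lemma reflected_form_le_residual (q : T -> R) F W W' N : vanishing q -> (forall x, 0 <= q x <= dp) ->
  (forall t x, V t x <= q x) -> solution F W ->
  (forall n x, coef W' n x = coef W n x + (omega - s)%:C * coef F n x) ->
  (0 < N)%N -> 0 < omega - s - dm ->
  rdot (sub_potential (reflected s H) q (coef F (-1))) (coef F (-1)) <=
  energy_error F N - coef_dot (modes N) W' F +
    (omega - s - dm)^-1 * coef_dot (modes N) W' W'.
Proof.
move=> vq qd Vq sF W'E N0 d0; set d := _ - dm in d0 *.
have lF n := sol_coef_ell2 tau0 n sF; have lW n := sol_coef_rhs_ell2 tau0 n sF.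
have E n : rdot (coef W' n) (coef F n) =
    rdot (coef W n) (coef F n) + (omega - s) * rdot (coef F n) (coef F n).
  rewrite (eq_rdot (W'E n) (fun=> erefl)) rdotDl//; last exact: ell2Z.
  by rewrite rdotRl.
have lW' n : ell2 (coef W' n).
  apply: (@eq_ell2 _ _ (fun x => coef W n x + (omega - s)%:C * coef F n x)) => //.
  by apply: ell2D => //; exact: ell2Z.
rewrite !coef_dot_modes.
apply: energy_balance_upper.
- have := energy_neg_le_form vq qd Vq sF N0; rewrite -(eq_bigr _ (fun n _ => E n)); exact.
- exact: (energy_identity tau0 opH V_bm V_delta N sF).
apply: (le_trans _ (energy_pos_ge N sF)); rewrite (mulrDr d^-1) opprD addrA.
apply: ler_wnDr.
  by rewrite oppr_le0; apply: mulr_ge0 => //; rewrite invr_ge0 ltW.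
rewrite mulr_sumr -sumrB; apply: ler_sum => n _.
have := ler_rdot_weighted (lF n) (lW' n) d0; rewrite rdotC E.
exact: mode_ineq_young_dual.
Qed.

(** Strictly between the two bands every mode has energy of one sign: after
    subtracting l, positive on the upper half and negative on the lower one. *)
Lemma gap_coef_dot_le (l : R) F N : solution F (fun t x => l%:C * F t x) ->
  l < - dm -> dp - (omega - s) < l ->
  Num.min (- dm - l) (omega - s - dp + l) * coef_dot (modes N) F F <= energy_error F N.
Proof.
move=> sF l1 l2; have lF n := sol_coef_ell2 tau0 n sF.
have E n : rdot (coef (fun t x => l%:C * F t x) n) (coef F n) = l * rdot (coef F n) (coef F n).
  rewrite -rdotRl//; apply: eq_rdot => // x; exact: (fcoefZ tau0 l%:C n (sol_cbm sF x)).
rewrite -(energy_identity tau0 opH V_bm V_delta N sF) /coef_dot big_cat /= mulrDr.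
apply: energy_balance_gap.
  apply: (le_trans _ (energy_pos_ge N sF)); rewrite mulr_sumr; apply: ler_sum => n _.
  by rewrite E -mulrBl; apply: ler_wpM2r; [exact: rdot_ge0|rewrite ge_min lexx].
apply: (le_trans (energy_neg_le N sF)); rewrite mulr_sumr -sumrN; apply: ler_sum => n _.
rewrite E -mulrBl -mulNr; apply: ler_wpM2r; first exact: rdot_ge0.
by rewrite -opprD lerN2 ge_min lexx orbT.
Qed.

End gap_inequalities.

Section eigenfunction_superpositions.
Variables (R : realType) (T : choiceType) (tau : R).
Hypothesis tau0 : 0 < tau.
Local Notation omega := (2 * pi / tau).
Local Notation bm := (bounded_measurable 0 tau).
Local Notation coef := (coef tau).
Variables (H : (T -> R[i]) -> T -> R[i]) (V : R -> T -> R).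
Local Notation solution := (solution tau H V).
Local Notation coef_dot := (coef_dot tau).
Hypothesis opH : symmetric_operator H.
Hypothesis V_bm : forall x, bm (fun t => V t x).
Variable s : R.
Hypothesis H_ge0 : forall f, ell2 f -> 0 <= rdot (H f) f.
Hypothesis H_le : forall f, ell2 f -> rdot (H f) f <= s * rdot f f.
Variables dp dm : R.
Hypotheses (dp0 : 0 <= dp) (dm0 : 0 <= dm) (dp_omega : dp <= omega) (dm_omega : dm <= omega).
Hypotheses (V_le : forall t x, V t x <= dp) (V_ge : forall t x, - dm <= V t x).
Hypothesis sum_gap : dp + dm < omega - s.

Let V_delta t x : `|V t x| <= dp + dm.
Proof.
rewrite ler_norml; have h1 := V_le t x; have h2 := V_ge t x; have h3 := dp0; have h4 := dm0.
by apply/andP; split; lra.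
Qed.

Section superposition.
Variables (ls : seq R) (G : R -> R -> T -> R[i]).
Hypothesis ls_uniq : uniq ls.
Hypothesis G_solution : forall l, solution (G l) (fun t x => l%:C * G l t x).
Variables (l0 t0 : R) (x0 : T).
Hypotheses (l0_ls : l0 \in ls) (t0_tau : 0 <= t0 <= tau) (G_neq0 : G l0 t0 x0 != 0).
Local Notation F := (superposition ls G (fun=> 1)).

Let negative_of_bound (rho : R -> R -> R) (a : R) :
  (forall l, l \in ls -> rho l l < 0) ->
  (forall N, (0 < N)%N -> a <= energy_error tau V F N +
     \sum_(l <- ls) \sum_(l' <- ls) rho l l' * coef_dot (modes N) (G l) (G l')) -> a < 0.
Proof.
move=> rho0 bound.
have [e e0 near1] := superposition_negative tau0 opH V_bm V_delta ls_uniq G_solution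
  rho0 l0_ls t0_tau G_neq0.
have e2 : 0 < e / 2 by rewrite divr_gt0.
have near2 := energy_error_small tau0 V_bm V_delta
  (superposition_solution tau0 opH V_bm ls G_solution) e2.
have near3 : \forall N \near \oo, (0 < N)%N by exists 1%N.
have [N [[h1 h2] h3]] := @filter_ex _ _ _ _ (filterI (filterI near1 near2) near3).
have := bound N h3; move: h1 h2; rewrite ler_norml.
move: (\sum_(_ <- _) _) (energy_error _ _ _ _) => u v h1 /andP[_ h2] h; lra.
Qed.

(** The weight on the diagonal is l + l^2 / d with - d < - dm <= l < 0, hence
    negative. *)
Lemma superposition_form_lt0 (q : T -> R) : vanishing q -> (forall x, 0 <= q x <= dm) ->
  (forall t x, - q x <= V t x) -> (forall l, l \in ls -> - dm <= l < 0) ->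
  rdot (sub_potential H q (coef F 0)) (coef F 0) < 0.
Proof.
move=> vq qd Vq ls_dm; set d := omega - s - dp.
have dmd : dm < d by rewrite /d ltrBrDl.
have d0 : 0 < d by exact: le_lt_trans dmd.
apply: (@negative_of_bound (fun l l' => l * 1 + d^-1 * (l * l')) _).
  move=> l /ls_dm /andP[l1 l2].
  rewrite mulr1 mulrA -{1}[l]mul1r -mulrDl (nmulr_llt0 _ l2).
  rewrite -ltrBlDl sub0r mulrC ltr_pdivlMr// mulN1r.
  by apply: lt_le_trans l1; rewrite ltrN2.
move=> N N0; have sF := superposition_solution tau0 opH V_bm ls G_solution.
apply: (le_trans (form_le_residual tau0 opH V_bm H_ge0 H_le dp0 dm0 dm_omega V_le V_ge vq qd Vq sF N0 d0)).
rewrite -/d -addrA lerD2l !(coef_dot_superposition tau0 ls G_solution).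
rewrite (mulr_sumr ls) -big_split /= le_eqVlt; apply/orP; left; apply/eqP.
apply: eq_bigr => l _; rewrite (mulr_sumr ls) -big_split /=; apply: eq_bigr => l' _.
by rewrite (mulrDl (l * 1)) (mulrA d^-1).
Qed.

(** Here y = l + omega - s lies in (0, dp] and dp < d, so that - y + y^2 / d is
    negative. *)
Lemma superposition_reflected_form_lt0 (q : T -> R) : vanishing q -> (forall x, 0 <= q x <= dp) ->
  (forall t x, V t x <= q x) -> (forall l, l \in ls -> 0 < l + (omega - s) <= dp) ->
  rdot (sub_potential (reflected s H) q (coef F (-1))) (coef F (-1)) < 0.
Proof.
move=> vq qd Vq ls_dp; set d := omega - s - dm; pose y l := l + (omega - s).
have dpd : dp < d by rewrite /d ltrBrDr.
have d0 : 0 < d by exact: le_lt_trans dpd.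
apply: (@negative_of_bound (fun l l' => - (y l * 1) + d^-1 * (y l * y l')) _).
  move=> l /ls_dp; rewrite -/(y l) => /andP[l1 l2].
  rewrite mulr1 addrC subr_lt0 mulrA -[ltRHS]mul1r ltr_pM2r// mulrC ltr_pdivrMr// mul1r.
  exact: le_lt_trans dpd.
move=> N N0; have sF := superposition_solution tau0 opH V_bm ls G_solution.
have yE n x : coef (superposition ls G y) n x =
    coef (superposition ls G id) n x + (omega - s)%:C * coef F n x.
  rewrite !(coef_superposition tau0 ls G_solution) mulr_sumr -big_split /=.
  by apply: eq_bigr => l _; rewrite /y mul1r rmorphD mulrDl.
apply: (le_trans (reflected_form_le_residual tau0 opH V_bm H_ge0 H_le dp0 dm0 dp_omega V_le V_ge vq qd Vq sF yE N0 d0)).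
rewrite -/d -addrA lerD2l !(coef_dot_superposition tau0 ls G_solution).
rewrite (mulr_sumr ls) -sumrN -big_split /= le_eqVlt; apply/orP; left; apply/eqP.
apply: eq_bigr => l _; rewrite (mulr_sumr ls) -sumrN -big_split /=; apply: eq_bigr => l' _.
by rewrite (mulrDl (- (y l * 1))) (mulrA d^-1) mulNr.
Qed.

End superposition.

Lemma gap_solution_eq0 (l : R) (F : R -> T -> R[i]) t x :
  solution F (fun t x => l%:C * F t x) -> dp - (omega - s) < l -> l < - dm ->
  0 <= t <= tau -> F t x = 0.
Proof.
move=> sF l1 l2 ht; apply/eqP/negP => /negP Fn0.
have [e e0 near1] := coef_dot_pos tau0 sF ht Fn0.
set k := Num.min (- dm - l) (omega - s - dp + l).
have k0 : 0 < k.
  rewrite /k lt_min; apply/andP; split; first by rewrite subr_gt0.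
  by rewrite -(opprB dp) addrC subr_gt0.
have ke : 0 < k * e / 2 by rewrite divr_gt0// mulr_gt0.
have near2 := energy_error_small tau0 V_bm V_delta sF ke.
have [N [h1 h2]] := @filter_ex _ _ _ _ (filterI near1 near2).
have := gap_coef_dot_le tau0 opH V_bm H_ge0 H_le dp0 dm0 V_le V_ge N sF l2 l1.
rewrite -/k => h; have h3 : k * e <= k * coef_dot (modes N) F F by rewrite ler_pM2l.
have := le_trans h3 (le_trans h (le_trans (ler_norm _) h2)).
rewrite leNgt ltr_pdivrMr// ltr_pMr ?ltr1n// mulr_gt0//.
Qed.

End eigenfunction_superpositions.

(** * Comparison of eigenvalue counts *)

Section orthonormal_families.
Variables (R : realType) (T : choiceType).
Implicit Types (f g : T -> R[i]).

Lemma orthonormal_independent (n : nat) (e : 'I_n -> T -> R[i]) (c : 'I_n -> R[i]) :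
  (forall i, ell2 (e i)) -> (forall i, rdot (e i) (e i) = 1) ->
  (forall i j : 'I_n, (j < i)%N -> hdot (e i) (e j) = 0) ->
  (forall x, \sum_(i < n) c i * e i x = 0) -> forall i, c i = 0.
Proof.
move=> le e1 orth ce i.
have : hdot (fun x => \sum_(j < n) c j * e j x) (e i) = 0.
  apply/hdot_eq0; rewrite /rdot -[X in _ = X /\ _](tsum0 R T) -[X in _ /\ _ = X](tsum0 R T).
  by split; apply: eq_tsum => x; rewrite ce cdot0l.
rewrite hdot_suml// (bigD1 i)//= hdotff e1 mulr1 big1 ?addr0// => j ji.
have [ij|ij|/ord_inj ij] := ltngtP i j; last by rewrite ij eqxx in ji.
  by rewrite orth ?mulr0.
by rewrite hdot_orthoC ?mulr0// orth.
Qed.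

Lemma card_le_orthonormal (Op : (T -> R[i]) -> (T -> R[i]) -> Prop) (A : set R)
    (n : nat) (e : nat -> T -> R[i]) (l : nat -> R) :
  (forall i, (i < n)%N -> [/\ ell2 (e i), A (l i), rdot (e i) (e i) = 1,
     forall j, (j < i)%N -> hdot (e i) (e j) = 0 & Op (e i) (fun x => (l i)%:C * e i x)]) ->
  ((n%:R)%:E <= num_eigenvalues [set f | forall x, f x = 0%R] Op A)%E.
Proof.
move=> el; rewrite -[n in (n%:R)%:E]card_ord.
apply: (@card_le_num_eigenvalues _ _ _ _ _ _ (fun i : 'I_n => l i) (fun i : 'I_n => e i)) => [i|i|c ce].
- by have [] := el i (ltn_ord i).
- by have [] := el i (ltn_ord i).
apply: (@orthonormal_independent n (fun i : 'I_n => e i)) => [i|i|i j ji|//].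
- by have [] := el i (ltn_ord i).
- by have [] := el i (ltn_ord i).
by have [_ _ _ + _] := el i (ltn_ord i); apply.
Qed.

Lemma sub_potential_form_anti (H : (T -> R[i]) -> T -> R[i]) (q Q : T -> R) f :
  symmetric_operator H -> vanishing Q -> (forall x, 0 <= q x <= Q x) -> ell2 f ->
  rdot (sub_potential H Q f) f <= rdot (sub_potential H q f) f.
Proof.
move=> opH vQ qQ lf.
have Q0 x : 0 <= Q x by have /andP[h1 h2] := qQ x; exact: le_trans h2.
have q0 x : 0 <= q x by have /andP[] := qQ x.
have vq : vanishing q.
  move=> e /vQ[K QK]; exists K => x /QK; rewrite !ger0_norm//; apply: le_trans.
  by have /andP[] := qQ x.
have [s1 ->] := form_sub_potential opH vq q0 lf.
have [s2 ->] := form_sub_potential opH vQ Q0 lf.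
rewrite lerD2l lerN2; apply: le_tsum => // x.
by apply: ler_wpM2r; [exact: sqnorm_ge0|have /andP[] := qQ x].
Qed.

End orthonormal_families.

Section eigenfunction_families.
Variables (R : realType) (T : choiceType) (tau : R).
Hypothesis tau0 : 0 < tau.
Local Notation coef := (coef tau).
Variables (H : (T -> R[i]) -> T -> R[i]) (V : R -> T -> R).
Local Notation solution := (solution tau H V).
Hypothesis opH : symmetric_operator H.
Hypothesis V_bm : forall x, bounded_measurable 0 tau (fun t => V t x).
Variables (I : finType) (l : I -> R) (F : I -> R -> T -> R[i]).
Hypothesis F_solution : forall i, solution (F i) (fun t x => (l i)%:C * F i t x).
Hypothesis F_indep : forall x (c : I -> R[i]),
  (forall t y, 0 <= t <= tau -> \sum_(i | l i == x) c i * F i t y = 0) ->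
  forall i, l i = x -> c i = 0.

(** The terms of a linear combination are grouped by eigenvalue. Some group does not
    vanish, since the family is independent within each eigenspace. *)
Lemma family_superposition (c : I -> R[i]) : (exists i, c i != 0) ->
  exists (ls : seq R) (G : R -> R -> T -> R[i]) (l0 t0 : R) (x0 : T),
  [/\ uniq ls, forall x, x \in ls -> exists i, l i = x,
      forall x, solution (G x) (fun t y => x%:C * G x t y),
      [/\ l0 \in ls, 0 <= t0 <= tau & G l0 t0 x0 != 0] &
      forall n x, coef (superposition ls G (fun=> 1)) n x = \sum_i c i * coef (F i) n x].
Proof.
move=> [i0 ci0]; pose G x t y := \sum_(i | l i == x) c i * F i t y.
pose ls := undup [seq l i | i : I].
have [[t0 [x0 [ht G0]]]|none] := pselect (exists t0 x0, 0 <= t0 <= tau /\ G (l i0) t0 x0 != 0); last first.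
  exfalso; move: ci0; rewrite (@F_indep (l i0) c _ i0 erefl) ?eqxx// => t y ht.
  by apply/eqP/negP => /negP Gn0; apply: none; exists t, y.
exists ls, G, (l i0), t0, x0; split.
- exact: undup_uniq.
- by move=> x; rewrite mem_undup => /mapP[i _ ->]; exists i.
- move=> x; have sol := @solution_sum _ _ _ tau0 H V V_bm _ (index_enum I) (fun i => l i == x) c F
    (fun i t y => (l i)%:C * F i t y) opH (fun i _ => F_solution i).
  rewrite (_ : (fun t y => x%:C * G x t y) =
     (fun t y => \sum_(i | l i == x) c i * ((l i)%:C * F i t y)))//.
  apply/funext => t; apply/funext => y; rewrite /G mulr_sumr; apply: eq_bigr => i /eqP ->.
  by rewrite mulrCA.
- by split=> //; rewrite mem_undup; apply/mapP; exists i0 => //; rewrite mem_enum.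
move=> n x.
have b i : cbm tau (fun t => F i t x) by exact: sol_cbm (F_solution i) x.
transitivity (fcoef tau (fun t => \sum_i c i * F i t x) n).
  apply: eq_fcoef => t _; rewrite /superposition /G.
  under eq_bigr do rewrite mul1r big_mkcond.
  rewrite exchange_big; apply: eq_bigr => i _.
  rewrite (bigD1_seq (l i)) ?undup_uniq//=; last first.
    by rewrite mem_undup; apply/mapP; exists i => //; rewrite mem_enum.
  by rewrite eqxx big1 ?addr0// => y /negbTE; rewrite eq_sym => ->.
rewrite fcoef_sum//; last by move=> i; exact: cbmZ.
by apply: eq_bigr => i _; exact: (fcoefZ tau0 (c i) n (b i)).
Qed.

Variable s : R.
Hypothesis H_ge0 : forall f, ell2 f -> 0 <= rdot (H f) f.
Hypothesis H_le : forall f, ell2 f -> rdot (H f) f <= s * rdot f f.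
Variables dp dm : R.
Hypotheses (dp0 : 0 <= dp) (dm0 : 0 <= dm).
Local Notation omega := (2 * pi / tau).
Hypotheses (dp_omega : dp <= omega) (dm_omega : dm <= omega).
Hypotheses (V_le : forall t x, V t x <= dp) (V_ge : forall t x, - dm <= V t x).
Hypothesis sum_gap : dp + dm < omega - s.
Variable Q : T -> R.
Hypotheses (vQ : vanishing Q) (Q0 : forall x, 0 <= Q x).

Let phi n (i : 'I_#|I|) := coef (F (enum_val i)) n.

Let phi_ell2 n i : ell2 (phi n i).
Proof. exact: (sol_coef_ell2 tau0 n (F_solution _)). Qed.

Let vanishing_min (d : R) : 0 <= d -> vanishing (fun x => Num.min (Q x) d).
Proof.
move=> d0 e /vQ[K QK]; exists K => x /QK; rewrite !ger0_norm ?le_min ?Q0//.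
by apply: le_trans; rewrite ge_min lexx.
Qed.

Let family_coef (c : 'I_#|I| -> R[i]) : (exists i, c i != 0) ->
  exists (ls : seq R) (G : R -> R -> T -> R[i]) (l0 t0 : R) (x0 : T),
  [/\ uniq ls, forall x, x \in ls -> exists i, l i = x,
      forall x, solution (G x) (fun t y => x%:C * G x t y),
      [/\ l0 \in ls, 0 <= t0 <= tau & G l0 t0 x0 != 0] &
      forall n, (fun x => \sum_i c i * phi n i x) = coef (superposition ls G (fun=> 1)) n].
Proof.
move=> [i ci]; have [|ls [G [l0 [t0 [x0 [h1 h2 h3 h4 h5]]]]]] :=
  @family_superposition (fun j => c (enum_rank j)).
  by exists (enum_val i); rewrite enum_valK.
exists ls, G, l0, t0, x0; split=> // n; apply/funext => x; rewrite h5.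
rewrite (reindex (@enum_val I predT)) /=; last exact: onW_bij (enum_val_bij I).
by apply: eq_bigr => j _; rewrite enum_valK.
Qed.

(** The Fourier coefficients of order 0 span a negative space of H - min(Q, dm),
    hence of H - Q, of dimension the size of the family. *)
Lemma family_bound_states : (forall t x, - Q x <= V t x) ->
  (forall i, - dm <= l i < 0) ->
  exists (e : nat -> T -> R[i]) (mu : nat -> R), forall i, (i < #|I|)%N ->
    [/\ ell2 (e i), mu i < 0, rdot (e i) (e i) = 1,
        forall j, (j < i)%N -> hdot (e i) (e j) = 0 &
        forall x, sub_potential H Q (e i) x = (mu i)%:C * e i x].
Proof.
move=> VQ ldm; apply: (count_bound_states opH H_ge0 vQ Q0 (phi_ell2 0)) => c /family_coef.
move=> [ls [G [l0 [t0 [x0 [us lsl Gs [l0s ht G0] cE]]]]]].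
rewrite /= (cE 0).
have sF := superposition_solution tau0 opH V_bm ls Gs.
apply: (@le_lt_trans _ _ (rdot (sub_potential H (fun x => Num.min (Q x) dm)
    (coef (superposition ls G (fun=> 1)) 0)) (coef (superposition ls G (fun=> 1)) 0))).
  apply: sub_potential_form_anti => // [x|]; last exact: (sol_coef_ell2 tau0 0 sF).
  by rewrite le_min Q0 dm0 ge_min lexx.
apply: (superposition_form_lt0 tau0 opH V_bm H_ge0 H_le dp0 dm0 dm_omega V_le V_ge sum_gap
  us Gs l0s ht G0) => [|x|t x|x /lsl[i <-]//]; first exact: vanishing_min.
- by rewrite le_min Q0 dm0 ge_min lexx orbT.
by rewrite lerNl le_min lerNl VQ lerNl V_ge.
Qed.

(** The same with the coefficients of order -1 and the operator reflected about the
    top. *)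
Lemma family_reflected_bound_states : (forall t x, V t x <= Q x) ->
  (forall i, - (omega - s) < l i <= dp - (omega - s)) ->
  exists (e : nat -> T -> R[i]) (mu : nat -> R), forall i, (i < #|I|)%N ->
    [/\ ell2 (e i), mu i < 0, rdot (e i) (e i) = 1,
        forall j, (j < i)%N -> hdot (e i) (e j) = 0 &
        forall x, sub_potential (reflected s H) Q (e i) x = (mu i)%:C * e i x].
Proof.
move=> VQ ldp; have opH' := reflected_operator s opH.
have H'_ge0 f : ell2 f -> 0 <= rdot (reflected s H f) f.
  by move=> lf; rewrite (reflected_form s opH lf) subr_ge0 H_le.
apply: (count_bound_states opH' H'_ge0 vQ Q0 (phi_ell2 (-1))) => c /family_coef.
move=> [ls [G [l0 [t0 [x0 [us lsl Gs [l0s ht G0] cE]]]]]].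
rewrite /= (cE (-1)).
have sF := superposition_solution tau0 opH V_bm ls Gs.
apply: (@le_lt_trans _ _ (rdot (sub_potential (reflected s H) (fun x => Num.min (Q x) dp)
    (coef (superposition ls G (fun=> 1)) (-1))) (coef (superposition ls G (fun=> 1)) (-1)))).
  apply: sub_potential_form_anti => // [x|]; last exact: (sol_coef_ell2 tau0 (-1) sF).
  by rewrite le_min Q0 dp0 ge_min lexx.
apply: (superposition_reflected_form_lt0 tau0 opH V_bm H_ge0 H_le dp0 dm0 dp_omega V_le V_ge sum_gap
  us Gs l0s ht G0) => [|x|t x|x /lsl[i <-]]; first exact: vanishing_min.
- by rewrite le_min Q0 dp0 ge_min lexx orbT.
- by rewrite le_min VQ V_le.
by have /andP[h1 h2] := ldp i; rewrite -ltrBlDr sub0r h1 -lerBrDr.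
Qed.

End eigenfunction_families.

Section periodic_graph_counting.
Variables (R : realType) (d : nat) (G : periodic_graph R d) (fp : vertex G -> R).
Hypothesis fp_periodic : periodic_potential fp.
Local Notation T := (vertex G).
Variables (s tau : R) (V : R -> T -> R).
Hypothesis tau0 : 0 < tau.
Hypothesis fp_spectrum : forall z, spectrum (h_o fp) z -> 0 <= z <= s%:C.
Hypothesis V_bm : forall x, bounded_measurable 0 tau (fun t => V t x).
Local Notation H := (h_o fp).
Local Notation solution := (solution tau H V).
Local Notation mu := (@lebesgue_measure R).

Lemma h_o_finite_range : finite_range H.
Proof.
move=> x; pose es := fibre (@src R d G) x.
exists ([seq (1, x) | e <- es] ++ [seq (-1, tgt e) | e <- es] ++ [:: ((fp x)%:C, x)]) => f.
rewrite !big_cat !big_map big_seq1 /= /h_o laplacianE addrA; congr (_ + _).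
rewrite big_split /=; congr (_ + _).
  by apply: eq_bigr => e _; rewrite mul1r.
by apply: eq_bigr => e _; rewrite mulN1r.
Qed.

Let opH : symmetric_operator H := (h_o_operator fp_periodic).1.

Let H_ge0 f : ell2 f -> 0 <= rdot (H f) f.
Proof. by move=> /(h_o_form_bounds fp_periodic fp_spectrum)[]. Qed.

Let H_le f : ell2 f -> rdot (H f) f <= s * rdot f f.
Proof. by move=> /(h_o_form_bounds fp_periodic fp_spectrum)[]. Qed.

Lemma h_tilde_solution (l : R) f : Defs.eigenspace (h_tilde fp tau V) l f ->
  exists F, solution F (fun t x => l%:C * F t x) /\ ae_eq_time tau f (fun z => F z.1 z.2).
Proof.
move=> [k dk ek].
by have [F] := eigenfunction_solution tau0 h_o_finite_range V_bm dk ek; exists F.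
Qed.

(** Independence modulo functions vanishing almost everywhere passes to the
    continuous representatives. *)
Lemma eigenfunction_family (I : finType) (l : I -> R) (e : I -> R * T -> R[i]) :
  (forall i, Defs.eigenspace (h_tilde fp tau V) (l i) (e i)) ->
  (forall x (c : I -> R[i]), ae_eq_time tau (fun z => \sum_(i | l i == x) c i * e i z) (fun=> 0) ->
     forall i, l i = x -> c i = 0) ->
  exists F : I -> R -> T -> R[i],
    (forall i, solution (F i) (fun t x => (l i)%:C * F i t x)) /\
    forall x (c : I -> R[i]),
      (forall t y, 0 <= t <= tau -> \sum_(i | l i == x) c i * F i t y = 0) ->
      forall i, l i = x -> c i = 0.
Proof.
move=> el indep; have [F FE] := choice (fun i => h_tilde_solution (el i)).
exists F; split=> [i|x c Fc]; first exact: (FE i).1.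
apply: indep.
have ae : {ae mu, forall t, forall i, i \in index_enum I ->
    0 <= t <= tau -> forall y, e i (t, y) = F i t y}.
  apply: (@filter_all_seq _ (almost_everywhere mu) I
    (fun i => [set t | 0 <= t <= tau -> forall y, e i (t, y) = F i t y])) => i.
  exact: (FE i).2.
apply: (@filterS _ (almost_everywhere mu) _ _ _ _ ae) => t h ht y.
rewrite -[RHS](Fc t y ht); apply: eq_bigr => i _.
by rewrite h// mem_index_enum.
Qed.

Variables dp dm : R.
Local Notation omega := (2 * pi / tau).
Hypotheses (dp0 : 0 <= dp) (dm0 : 0 <= dm) (dp_omega : dp <= omega) (dm_omega : dm <= omega).
Hypotheses (V_le : forall t x, V t x <= dp) (V_ge : forall t x, - dm <= V t x).
Hypothesis sum_gap : dp + dm < omega - s.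

Lemma n_tilde_lower_le (Q : T -> R) : vanishing Q -> (forall x, 0 <= Q x) ->
  (forall t x, - Q x <= V t x) ->
  (n_tilde fp tau V [set l | (- dm <= l < 0)%R] <=
   n_h_o_plus fp (fun x => (- Q x)%R) [set l | (l < 0)%R])%E.
Proof.
move=> vQ Q0 VQ; apply: num_eigenvalues_le => I l e Al el indep.
have [F [sF indepF]] := eigenfunction_family el indep.
have [phi [nu phiE]] := family_bound_states tau0 opH V_bm sF indepF H_ge0 H_le
  dp0 dm0 dm_omega V_le V_ge sum_gap vQ Q0 VQ Al.
apply: (@card_le_orthonormal _ _ _ _ _ phi nu) => i iI.
have [h1 h2 h3 h4 h5] := phiE i iI; split=> //; split=> // x.
by rewrite -h5 /sub_potential rmorphN mulNr.
Qed.

Lemma n_tilde_upper_le (Q : T -> R) : vanishing Q -> (forall x, 0 <= Q x) ->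
  (forall t x, V t x <= Q x) ->
  (n_tilde fp tau V [set l | (- (omega - s) < l <= dp - (omega - s))%R] <=
   n_h_o_plus fp Q [set l | (s < l)%R])%E.
Proof.
move=> vQ Q0 VQ; apply: num_eigenvalues_le => I l e Al el indep.
have [F [sF indepF]] := eigenfunction_family el indep.
have [phi [nu phiE]] := family_reflected_bound_states tau0 opH V_bm sF indepF H_ge0 H_le
  dp0 dm0 dp_omega V_le V_ge sum_gap vQ Q0 VQ Al.
apply: (@card_le_orthonormal _ _ _ _ _ phi (fun i => s - nu i)) => i iI.
have [h1 h2 h3 h4 h5] := phiE i iI; split=> //; first by rewrite /= ltrBrDr gtrDl.
split=> // x; have := h5 x; rewrite /sub_potential /reflected => h.
by rewrite rmorphB mulrBl -h; ring.
Qed.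

(** The part of the gap between the two bands contains no eigenvalue. *)
Lemma n_tilde_gap_le :
  (n_tilde fp tau V [set l | (- (omega - s) < l < 0)%R] <=
   n_tilde fp tau V [set l | (- (omega - s) < l <= dp - (omega - s))%R] +
   n_tilde fp tau V [set l | (- dm <= l < 0)%R])%E.
Proof.
apply: num_eigenvalues_leU => l /= /andP[l1 l2].
have [h1|h1] := leP l (dp - (omega - s)); first by apply: Or31; rewrite l1.
have [h2|h2] := leP (- dm) l; first by apply: Or32; rewrite l2.
apply: Or33; apply: dim_mod_eq0 => f /h_tilde_solution[F [sF fF]].
apply: (@filterS _ (almost_everywhere mu) _ _ _ _ fF) => t h ht x; rewrite mul1r h//=.
exact: (gap_solution_eq0 tau0 opH V_bm H_ge0 H_le dp0 dm0 V_le V_ge _ sF h1 h2 ht).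
Qed.

End periodic_graph_counting.

(** * Summable potentials and the counting estimates *)

Section lp_spaces.
Variables (R : realType) (T : choiceType) (p : R).
Hypothesis p0 : 0 < p.
Implicit Types q : T -> R.

Lemma normp_sum_ge0 q : (0 <= normp_sum p q)%E.
Proof. by apply: esum_ge0 => x _; rewrite lee_fin powR_ge0. Qed.

Lemma lp_norm_powR q : (lp_norm p q `^ p = normp_sum p q)%E.
Proof.
by rewrite /lp_norm -poweRrM mulVf ?gt_eqF// poweRe1// normp_sum_ge0.
Qed.

Lemma lp_spaceP q : lp_space p q <-> summ (fun x => `|q x| `^ p).
Proof.
have E : (\esum_(x in [set: T]) (`| `|q x| `^ p|)%:E = normp_sum p q)%E.
  by apply: eq_esum => x _; rewrite ger0_norm// powR_ge0.
rewrite /summ E; split=> h; last exact: poweR_lty.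
by rewrite -lp_norm_powR; exact: poweR_lty.
Qed.

Lemma lp_spaceD (c : R) q r : lp_space p q -> lp_space p r ->
  lp_space p (fun x => c * q x + r x).
Proof.
move=> /lp_spaceP sq /lp_spaceP sr; apply/lp_spaceP.
apply: (summ_le (summD (summZ ((2 * `|c|) `^ p) sq) (summZ (2 `^ p) sr))) => x.
have n0 (y : R) : `|y| \in Num.nneg by rewrite nnegrE.
have h0 (a b : R) : 0 <= a -> 0 <= b -> 0 <= a * b by exact: mulr_ge0.
rewrite -powRM// -powRM ?mulr_ge0//.
have le (a b : R) : 0 <= a -> 0 <= b -> (a + b) `^ p <= (2 * a) `^ p + (2 * b) `^ p.
  move=> a0 b0; have [ab|/ltW ab] := leP a b.
    apply: ler_wpDl; first exact: powR_ge0.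
    apply: (ge0_ler_powR (ltW p0)); rewrite ?nnegrE ?addr_ge0 ?mulr_ge0//.
    by rewrite mulr_natl mulr2n lerD2r.
  apply: ler_wpDr; first exact: powR_ge0.
  apply: (ge0_ler_powR (ltW p0)); rewrite ?nnegrE ?addr_ge0 ?mulr_ge0//.
  by rewrite mulr_natl mulr2n lerD2l.
rewrite (ger0_norm (powR_ge0 _ _)) (ger0_norm (addr_ge0 (powR_ge0 _ _) (powR_ge0 _ _))).
apply: (@le_trans _ _ ((`|c| * `|q x| + `|r x|) `^ p)).
  apply: (ge0_ler_powR (ltW p0)); rewrite ?nnegrE ?normr_ge0 ?addr_ge0 ?mulr_ge0//.
  by apply: (le_trans (ler_normD _ _)); rewrite normrM.
by rewrite -mulrA; apply: le => //; exact: mulr_ge0.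
Qed.

(** All but finitely many terms of a convergent sum are small. *)
Lemma lp_space_vanishing q : lp_space p q -> vanishing q.
Proof.
move=> /lp_spaceP sq e e0; have a0 x : 0 <= `|q x| `^ p by exact: powR_ge0.
have ep : 0 < e `^ p by exact: powR_gt0.
have [K _ hK] := tsum_tail sq a0 ep; exists K => x xK.
have sF : summ (fun x => if x \in K then 0 else `|q x| `^ p).
  by apply: (summ_le sq) => y; case: ifP => // _; rewrite normr0.
have F0 y : 0 <= (if y \in K then 0 else `|q y| `^ p) by case: ifP.
have := ge0_le_tsum x sF F0; rewrite (negbTE xK) => h.
rewrite leNgt; apply/negP => eq.
have : e `^ p < `|q x| `^ p by apply: (gt0_ltr_powR p0); rewrite ?nnegrE// ltW.
by rewrite ltNge (le_trans h)// ltW.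
Qed.

Lemma esum_indicator (a : T -> R) (x0 : T) : 0 <= a x0 -> (forall x, x != x0 -> a x = 0) ->
  (\esum_(x in [set: T]) (a x)%:E = (a x0)%:E)%E.
Proof.
move=> a0 aE; rewrite -[RHS](@esum_set1 _ _ x0 (fun x => (a x)%:E)) ?lee_fin// [RHS]esum_mkcond.
apply: eq_esum => x _; have [->|xx0] := eqVneq x x0; first by rewrite mem_set.
by rewrite memNset ?aE//=; exact/eqP.
Qed.

Lemma lp_space_indicator (k : R) (x0 : T) : lp_space p (fun x => if x == x0 then k else 0).
Proof.
apply/lp_spaceP; rewrite /summ (@esum_indicator _ x0) ?ltry//.
by move=> x /negbTE ->; rewrite normr0 powR0 ?normr0// gt_eqF.
Qed.

End lp_spaces.

Section Cwikel_bounds.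
Variables (R : realType) (d : nat) (G : periodic_graph R d) (fp : vertex G -> R).
Local Notation T := (vertex G).
Local Notation p := (d%:R / 2).
Hypothesis d0 : (0 < d)%N.

Let p0 : 0 < p :> R. Proof. by rewrite divr_gt0// ltr0n. Qed.

Lemma n_h_o_plus_ge0 (q : T -> R) A : (0 <= n_h_o_plus fp q A)%E.
Proof. by apply: esum_ge0 => l _; exact: dim_mod_ge0. Qed.

Lemma vertex_inhabited : exists x : T, True.
Proof.
have [//|none] := pselect (exists x : T, True); exfalso.
apply: (@vertex_infinite R d G); rewrite (_ : [set: T] = set0)//.
by apply/seteqP; split=> // x _; apply: none; exists x.
Qed.

(** Counting on a half-line follows from counting beyond each m inside it, since a
    finite set of eigenvalues stays away from the endpoint. *)
Let n_h_o_plus_le (q : T -> R) (A D : set R) (B : R -> set R) (X : \bar R) :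
  (0 <= X)%E ->
  (forall S : seq R, (forall l, l \in S -> A l) -> exists2 m, D m & forall l, l \in S -> B m l) ->
  (forall m, D m -> (n_h_o_plus fp q (B m) <= X)%E) -> (n_h_o_plus fp q A <= X)%E.
Proof.
move=> X0 AB BX; apply: ge_ereal_sup => _ [S [finS SA] <-].
rewrite fsbig_finite//=; have [|m Dm Sm] := AB (fset_set S).
  by move=> l; rewrite in_fset_set// inE => /SA.
apply: (le_trans _ (BX m Dm)); apply: esum_ge; exists S; last by rewrite fsbig_finite.
by split=> // l Sl; apply: Sm; rewrite in_fset_set// inE.
Qed.

(** A potential supported at one vertex makes the sum equal to 1, and a count is
    nonnegative. *)
Lemma Cks_minus_ge0 C : Cks_minus fp C -> 0 <= C.
Proof.
move=> hC; have [x0 _] := vertex_inhabited.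
have := hC _ (- 1) (lp_space_indicator p0 (-2) x0) _; rewrite oppr_lt0 ltr01 => /(_ isT).
rewrite (@esum_indicator _ _ _ x0) ?powR_ge0//; last first.
  move=> x /negbTE ->; rewrite (_ : negative_part _ = 0) ?powR0 ?gt_eqF//.
  by rewrite /negative_part sub0r opprK normr1 subrr mul0r.
rewrite eqxx (_ : negative_part _ = 1) ?powR1; last first.
  by rewrite /negative_part (_ : -2 - -1 = -1); [rewrite normrN1; field|ring].
by rewrite mule1 -lee_fin; apply: le_trans; exact: n_h_o_plus_ge0.
Qed.

Lemma Cks_plus_ge0 s C : Cks_plus fp s C -> 0 <= C.
Proof.
move=> hC; have [x0 _] := vertex_inhabited.
have := hC _ (s + 1) (lp_space_indicator p0 2 x0) _; rewrite ltrDl ltr01 => /(_ isT).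
rewrite (@esum_indicator _ _ _ x0) ?powR_ge0//; last first.
  move=> x /negbTE ->; rewrite (_ : positive_part _ = 0) ?powR0 ?gt_eqF//.
  rewrite /positive_part (_ : 0 - _ + s = -1); last by ring.
  by rewrite normrN1 subrr mul0r.
rewrite eqxx (_ : positive_part _ = 1) ?powR1; last first.
  by rewrite /positive_part (_ : 2 - _ + s = 1); [rewrite normr1; field|ring].
by rewrite mule1 -lee_fin; apply: le_trans; exact: n_h_o_plus_ge0.
Qed.

(** The negative part of - q - mu increases to q as mu tends to 0, hence is bounded
    by q. *)
Lemma Cks_minus_le C (q : T -> R) : Cks_minus fp C -> lp_space p q -> (forall x, 0 <= q x) ->
  (n_h_o_plus fp (fun x => (- q x)%R) [set l | (l < 0)%R] <= C%:E * normp_sum p q)%E.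
Proof.
move=> hC sq q0; have C0 := Cks_minus_ge0 hC.
have X0 : (0 <= C%:E * normp_sum p q)%E by rewrite mule_ge0// normp_sum_ge0.
have sNq : lp_space p (fun x => - q x).
  by move: sq => /(lp_spaceP p0) sq; apply/(lp_spaceP p0)/(summ_le sq) => x; rewrite normrN.
apply: (n_h_o_plus_le (D := [set m | m < 0]) (B := fun m => [set l | l < m])) => //.
  elim=> [_|l S ih lS]; first by exists (-1) => //=; rewrite oppr_lt0.
  have [|m /= m0 Sm] := ih; first by move=> k kS; apply: lS; rewrite inE kS orbT.
  have l0 : l < 0 by apply: lS; rewrite inE eqxx.
  exists (Num.max m (l / 2)) => [|k] /=; first by rewrite gt_max m0 pmulr_llt0.
  rewrite inE lt_max => /predU1P[->|/Sm -> //]; apply/orP; right; lra.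
move=> m /= m0; apply: (le_trans (hC _ _ sNq m0)); apply: lee_wpmul2l; first by rewrite lee_fin.
apply: le_esum => x _; rewrite lee_fin; have qx := q0 x.
have [h|/ltW h] := leP 0 (q x + m).
  have -> : negative_part (- q x - m) = q x + m.
    by rewrite /negative_part -opprD normrN ger0_norm//; field.
  apply: (ge0_ler_powR (ltW p0)); rewrite ?nnegrE// ger0_norm//; lra.
have -> : negative_part (- q x - m) = 0.
  by rewrite /negative_part ger0_norm ?subrr ?mul0r// -opprD oppr_ge0.
by rewrite powR0 ?gt_eqF// powR_ge0.
Qed.

Lemma Cks_plus_le s C (q : T -> R) : Cks_plus fp s C -> lp_space p q -> (forall x, 0 <= q x) ->
  (n_h_o_plus fp q [set l | (s < l)%R] <= C%:E * normp_sum p q)%E.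
Proof.
move=> hC sq q0; have C0 := Cks_plus_ge0 hC.
have X0 : (0 <= C%:E * normp_sum p q)%E by rewrite mule_ge0// normp_sum_ge0.
apply: (n_h_o_plus_le (D := [set m | s < m]) (B := fun m => [set l | m < l])) => //.
  elim=> [_|l S ih lS]; first by exists (s + 1) => //=; rewrite ltrDl.
  have [|m /= m0 Sm] := ih; first by move=> k kS; apply: lS; rewrite inE kS orbT.
  have l0 : s < l by apply: lS; rewrite inE eqxx.
  exists (Num.min m ((s + l) / 2)) => [|k] /=; first by rewrite lt_min m0 /=; lra.
  rewrite inE gt_min => /predU1P[->|/Sm -> //]; apply/orP; right; lra.
move=> m /= m0; apply: (le_trans (hC _ _ sq m0)); apply: lee_wpmul2l; first by rewrite lee_fin.
apply: le_esum => x _; rewrite lee_fin; have qx := q0 x.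
have [h|/ltW h] := leP 0 (q x - m + s).
  have -> : positive_part (q x - m + s) = q x - m + s.
    by rewrite /positive_part ger0_norm//; field.
  apply: (ge0_ler_powR (ltW p0)); rewrite ?nnegrE// ger0_norm//; lra.
have -> : positive_part (q x - m + s) = 0.
  by rewrite /positive_part ler0_norm// addNr mul0r.
by rewrite powR0 ?gt_eqF// powR_ge0.
Qed.

End Cwikel_bounds.

(** * Eigenvalues in the gap *)

Theorem theorem1p4 (R : realType) (d : nat) (hd : (3 <= d)%N)
    (G : periodic_graph R d)
    (fp : vertex G -> R) (hfp : periodic_potential fp)
    (s : R) (hs : is_spectrum_max (h_o fp) s)
    (hspec : forall z, spectrum (h_o fp) z -> 0 <= z <= s%:C)
    (tau : R) (htau : 0 < tau)
    (V : R -> vertex G -> R)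
    (V_meas : forall x, measurable_fun [set: R] (fun t => V t x))
    (V_per : forall t x, V (t + tau) x = V t x)
    (p : R) (hp : p = d%:R / 2)
    (omega : R) (homega : omega = 2 * pi / tau) (homega_s : s < omega)
    (sg : R) (hsg : sg = omega - s)
    (Vp : R -> vertex G -> R) (hVp : forall t x, Vp t x = positive_part (V t x))
    (Vm : R -> vertex G -> R) (hVm : forall t x, Vm t x = negative_part (V t x))
    (dp : R) (hdp : ereal_sup (range (fun z => (Vp z.1 z.2)%:E)) = dp%:E)
    (dm : R) (hdm : ereal_sup (range (fun z => (Vm z.1 z.2)%:E)) = dm%:E)
    (hdp_sg : dp < sg / 2) (hdm_sg : dm < sg / 2) :
  [/\ forall (u vm : vertex G -> R) (c : R),
        gap_condition p s omega V Vm dm dp u vm c ->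
        let qm := fun x => c * u x ^+ 2 + vm x in
        (n_tilde fp tau V [set l | (- dm <= l < 0)%R] <=
         n_h_o_plus fp (fun x => (- qm x)%R) [set l | (l < 0)%R])%E /\
        forall Cm : R, Cks_minus fp Cm ->
          (n_h_o_plus fp (fun x => (- qm x)%R) [set l | (l < 0)%R] <=
           Cm%:E * lp_norm p qm `^ p)%E,
      forall (u vp : vertex G -> R) (c : R),
        regular_top fp s \/ bipartite G ->
        gap_condition p s omega V Vp dp dm u vp c ->
        let qp := fun x => c * u x ^+ 2 + vp x in
        (n_tilde fp tau V [set l | (- sg < l <= dp - sg)%R] <=
         n_h_o_plus fp qp [set l | (s < l)%R])%E /\
        forall Cp : R, Cks_plus fp s Cp ->
          (n_h_o_plus fp qp [set l | (s < l)%R] <=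
           Cp%:E * lp_norm p qp `^ p)%E
    & forall (um vm up vp : vertex G -> R) (cm cp : R),
        regular_top fp s \/ bipartite G ->
        gap_condition p s omega V Vm dm dp um vm cm ->
        gap_condition p s omega V Vp dp dm up vp cp ->
        let qm := fun x => cm * um x ^+ 2 + vm x in
        let qp := fun x => cp * up x ^+ 2 + vp x in
        forall Cm Cp : R, Cks_minus fp Cm -> Cks_plus fp s Cp ->
          (n_tilde fp tau V [set l | (- sg < l < 0)%R] <=
           Cp%:E * lp_norm p qp `^ p + Cm%:E * lp_norm p qm `^ p)%E].
Proof.
have [/hspec/andP[s0 _] _] := hs; rewrite lecR in s0.
have hd0 : (0 < d)%N by exact: leq_trans hd.
have p0 : 0 < p by rewrite hp divr_gt0// ltr0n.
have [x0 _] := vertex_inhabited G.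
have pos_ge0 (z : R) : 0 <= positive_part z /\ z <= positive_part z.
  rewrite /positive_part; have := ler_norm z; have := ler_norm (- z); rewrite normrN.
  by move=> h1 h2; split; lra.
have neg_ge0 (z : R) : 0 <= negative_part z /\ - z <= negative_part z.
  by have := pos_ge0 (- z); rewrite /positive_part normrN.
have Vp_le t x : Vp t x <= dp.
  by rewrite -lee_fin -hdp; apply: ereal_sup_ubound; exists (t, x).
have Vm_le t x : Vm t x <= dm.
  by rewrite -lee_fin -hdm; apply: ereal_sup_ubound; exists (t, x).
have V_Vp t x : V t x <= Vp t x by rewrite hVp; exact: (pos_ge0 _).2.
have V_Vm t x : - Vm t x <= V t x by rewrite lerNl hVm; exact: (neg_ge0 _).2.
have Vp0 t x : 0 <= Vp t x by rewrite hVp; exact: (pos_ge0 _).1.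
have Vm0 t x : 0 <= Vm t x by rewrite hVm; exact: (neg_ge0 _).1.
have V_le t x : V t x <= dp by exact: le_trans (V_Vp t x) (Vp_le t x).
have V_ge t x : - dm <= V t x by apply: le_trans (V_Vm t x); rewrite lerN2.
have dp0 : 0 <= dp by exact: le_trans (Vp0 0 x0) (Vp_le 0 x0).
have dm0 : 0 <= dm by exact: le_trans (Vm0 0 x0) (Vm_le 0 x0).
have dp_omega : dp <= 2 * pi / tau by rewrite -homega; lra.
have dm_omega : dm <= 2 * pi / tau by rewrite -homega; lra.
have sum_gap : dp + dm < 2 * pi / tau - s by rewrite -homega; lra.
have V_bm x : bounded_measurable 0 tau (fun t => V t x).
  split; first exact: measurable_funS (V_meas x).
  exists (dp + dm) => t _; rewrite ler_norml.
  by have := V_le t x; have := V_ge t x; move=> h1 h2; apply/andP; split; lra.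
have q_props (w : R -> vertex G -> R) delta delta' u v c : (forall t x, 0 <= w t x) ->
    gap_condition p s omega V w delta delta' u v c ->
    let q := fun x => c * u x ^+ 2 + v x in
    [/\ lp_space p q, forall x, 0 <= q x & forall t x, w t x <= q x].
  move=> w0 [[_ wv] [lu lv] hc _ _] q.
  have c0 : 0 <= c.
    apply: le_trans (ltW hc); apply: divr_ge0; last exact: sqr_ge0.
    by apply: mulr_ge0 => //; lra.
  have vq x : v x <= q x by rewrite lerDr; apply: mulr_ge0 => //; exact: sqr_ge0.
  split; first exact: (lp_spaceD p0).
    by move=> x; apply: le_trans (vq x); exact: le_trans (w0 0 x) (wv 0 x).
  by move=> t x; exact: le_trans (wv t x) (vq x).
have lower (u vm : vertex G -> R) c : gap_condition p s omega V Vm dm dp u vm c ->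
    let qm := fun x => c * u x ^+ 2 + vm x in
    (n_tilde fp tau V [set l | (- dm <= l < 0)%R] <=
     n_h_o_plus fp (fun x => (- qm x)%R) [set l | (l < 0)%R])%E /\
    forall Cm : R, Cks_minus fp Cm ->
      (n_h_o_plus fp (fun x => (- qm x)%R) [set l | (l < 0)%R] <=
       Cm%:E * lp_norm p qm `^ p)%E.
  move=> gap qm; have [lq q0 wq] := q_props _ _ _ _ _ _ Vm0 gap; split.
    apply: (n_tilde_lower_le hfp htau hspec V_bm dp0 dm0 dm_omega V_le V_ge sum_gap (Q := qm)) => //.
      exact: (lp_space_vanishing p0 lq).
    by move=> t x; apply: le_trans (V_Vm t x); rewrite lerN2; exact: wq.
  by move=> Cm hC; rewrite (lp_norm_powR p0) hp; apply: (Cks_minus_le hd0 hC) => //; rewrite -hp.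
have upper (u vp : vertex G -> R) c : gap_condition p s omega V Vp dp dm u vp c ->
    let qp := fun x => c * u x ^+ 2 + vp x in
    (n_tilde fp tau V [set l | (- sg < l <= dp - sg)%R] <=
     n_h_o_plus fp qp [set l | (s < l)%R])%E /\
    forall Cp : R, Cks_plus fp s Cp ->
      (n_h_o_plus fp qp [set l | (s < l)%R] <= Cp%:E * lp_norm p qp `^ p)%E.
  move=> gap qp; have [lq q0 wq] := q_props _ _ _ _ _ _ Vp0 gap; split.
    rewrite hsg homega.
    apply: (n_tilde_upper_le hfp htau hspec V_bm dp0 dm0 dp_omega V_le V_ge sum_gap (Q := qp)) => //.
      exact: (lp_space_vanishing p0 lq).
    by move=> t x; exact: le_trans (V_Vp t x) (wq t x).
  by move=> Cp hC; rewrite (lp_norm_powR p0) hp; apply: (Cks_plus_le hd0 hC) => //; rewrite -hp.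
split=> // [u vp c _|um vm up vp cm cp _ gapm gapp qm qp Cm Cp hCm hCp]; first exact: upper.
have [l1 /(_ _ hCm) l2] := lower _ _ _ gapm; have [u1 /(_ _ hCp) u2] := upper _ _ _ gapp.
have := n_tilde_gap_le hfp htau hspec V_bm dp0 dm0 V_le V_ge.
rewrite -homega -hsg => h; apply: (le_trans h); apply: leeD.
  exact: le_trans u1 u2.
exact: le_trans l1 l2.
Qed.
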